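(* Let $D$ be a finite $p$-group and $A$ a Dade $D$-algebra over a finite field $E$ of characteristic $p$, let $\rho:D\to A^\times$ be the unique group homomorphism with $x^d=\rho(d)^{-1}x\rho(d)$ for all $d\in D$, $x\in A$, and put $D_1=\rho(D)$. Let $B=\bar A(D)$ with Brauer homomorphism $\mathrm{br}_D:A^D\to B$, $m=\sqrt{\dim_E A}$, $l=\sqrt{\dim_E B}$, $s=[E:\mathbb{F}_p]$, and fix unitary $\mathbb{F}_p$-algebra embeddings $\iota:A\to\mathfrak{E}_1:=\mathrm{M}_{ms}(\mathbb{F}_p)$ and $\iota':B\to\mathfrak{E}_2:=\mathrm{M}_{ls}(\mathbb{F}_p)$. Then there is a group homomorphism $\phi:\mathbf{N}_{\mathfrak{E}_1^\times}(\iota(D_1))\to\mathfrak{E}_2^\times$ such that $\phi(\iota(c))=\iota'(\mathrm{br}_D(c))$ for all $c\in(A^D)^\times$.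
   Context: A $D$-algebra over $E$ is an $E$-algebra with a homomorphism $D\to\mathrm{Aut}_E(A)$, $x\mapsto x^d$. $A^Q$ denotes $Q$-fixed points; $\mathrm{Tr}_Q^D:A^Q\to A^D$, $x\mapsto\sum x^d$ over representatives $d$ of right cosets of $Q$ in $D$, with image $A^D_Q$. $A$ is a Dade $D$-algebra if it is a full matrix algebra over $E$ and has a $D$-stable $E$-basis with at least one $D$-fixed element. Brauer quotient $\bar A(D)=A^D/\sum_{Q<D}A^D_Q$ with quotient map $\mathrm{br}_D$; it is a full matrix algebra over $E$. A unitary embedding is an injective identity-preserving algebra homomorphism; $\mathbf{N}_{\mathfrak{E}_1^\times}(\cdot)$ is the normalizer in the unit group. *)

(* Defs.v *)
From HB Require Import structures.
From mathcomp Require Import all_boot all_order all_algebra all_fingroup all_solvable all_field.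
Set Implicit Arguments.
Unset Strict Implicit.
Unset Printing Implicit Defensive.
Import GRing.Theory.
Local Open Scope ring_scope.

(* A D-algebra structure on A = 'M[E]_m is given by a function
   act : gT -> 'M[E]_m -> 'M[E]_m, with x^d := act d x (right action). *)

Section DadeDefs.
Variables (gT : finGroupType) (E : finFieldType) (m : nat).
Implicit Types (Q D : {group gT}) (act : gT -> 'M[E]_m -> 'M[E]_m).

Definition is_D_algebra act (D : {group gT}) : Prop :=
  [/\ (forall x, act 1%g x = x),
      (forall d e, d \in D -> e \in D -> forall x, act (d * e)%g x = act e (act d x)),
      (forall d, d \in D -> bijective (act d)) &
      (forall d, d \in D ->
         [/\ forall (a : E) x y, act d (a *: x + y) = a *: act d x + act d y,
             forall x y, act d (x *m y) = act d x *m act d y &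
             act d 1%:M = 1%:M])].

Definition fixpts act (Q : {group gT}) : {set 'M[E]_m} :=
  [set x | [forall d in Q, act d x == x]].

Definition rtrace act (Q D : {group gT}) (x : 'M[E]_m) : 'M[E]_m :=
  \sum_(C in rcosets Q D) act (repr C) x.

Definition brauer_ideal act (D : {group gT}) : {vspace 'M[E]_m} :=
  <<enum [set rtrace act Q D x | Q in [set Q : {group gT} | Q \proper D],
                                 x in fixpts act Q]>>%VS.

Definition is_Dade act (D : {group gT}) : Prop :=
  is_D_algebra act D /\
  exists X : seq 'M[E]_m,
    [/\ basis_of fullv X,
        (forall d b, d \in D -> b \in X -> act d b \in X) &
        exists2 b, b \in X & forall d, d \in D -> act d b = b].

(* br : A -> B restricts on A^D to the Brauer quotient map
   A^D -> A^D / sum_{Q<D} A^D_Q = B (B an E-algebra) *)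
Definition is_brauer_quotient act (D : {group gT}) (B : falgType E)
    (br : 'M[E]_m -> B) : Prop :=
  [/\ (forall (a : E) x y, x \in fixpts act D -> y \in fixpts act D ->
          br (a *: x + y) = a *: br x + br y),
      (forall x y, x \in fixpts act D -> y \in fixpts act D ->
          br (x *m y) = br x * br y),
      br 1%:M = 1,
      (forall b : B, exists2 x, x \in fixpts act D & br x = b) &
      (forall x, x \in fixpts act D -> (br x == 0) = (x \in brauer_ideal act D))].

End DadeDefs.

(* unitary (identity-preserving) injective ring homomorphism into 'M['F_p]_n;
   F_p-linearity is automatic from additivity. *)
Definition unitary_embedding (p : nat) (R : pzRingType) (n : nat)
    (f : R -> 'M['F_p]_n) : Prop :=
  [/\ forall x y, f (x + y) = f x + f y,
      forall x y, f (x * y) = f x *m f y,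
      f 1 = 1%:M & injective f].

Definition unit_normalizer (p n : nat) (S : {set 'M['F_p]_n}) : {set 'M['F_p]_n} :=
  [set u | (u \in unitmx) && ([set invmx u *m x *m u | x in S] == S)].

(* Main.v *)
Require Import Defs.
From HB Require Import structures.
From Stdlib Require Import Classical.
From mathcomp Require Import all_boot all_order all_algebra all_fingroup all_solvable all_field.
From mathcomp Require Import mxrepresentation.
From mathcomp.multinomials Require Import mpoly.
Set Implicit Arguments.
Unset Strict Implicit.
Unset Printing Implicit Defensive.
Import GRing.Theory.
Local Open Scope ring_scope.

(** Write [A = M_m(E)], acting on [V = E^m] from the right. By uniqueness of the simple
    module, [iota] and [iota'] are restrictions of scalars, so that [phi] becomes a
    homomorphism from the additive bijections of [V] normalising [rho(D)] to those of [E^l].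

    It is built by descending along central subgroups [Z] of exponent [p] of [rho(D)]: one
    step replaces [A] by the Brauer quotient [A(Z)], on which [rho(D)] acts through a
    smaller group. For a single step, list [rho(Z)] as [r_1, ..., r_n], let
    [xi = sum_i X_i (r_i - 1)] over [R = E[X_1, ..., X_n]], and consider the lattice
    [ker xi] in [R^m]. Over the fraction field, [ker xi / im xi^(p-1)] is a module of
    dimension [l] for the Brauer quotient: genericity of [xi] makes every relative trace
    from a proper subgroup of [Z] a sum [sum_j xi^j b xi^(p-1-j)]. An additive bijection
    [u] normalising [rho(Z)] permutes the [r_i]; permuting the [X_i] accordingly, [u] lifts
    to [R^m] commuting with [xi], hence acts on the image of [ker xi] in
    [ker xi / im xi^(p-1)]. This image is [J^l] for an ideal [J] of [R], and as [R] is
    factorial it may be scaled to have gcd 1; the action then extends to the reflexive hull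
    [R^l], and [phi(u)] is its value at [X = 0]. Frobenius twists enter because [u] is only
    additive: [u(v) = sum_i v^(p^i) U_i]. *)

(** * Matrices *)

Lemma linear_comb (R : pzRingType) (V W : lmodType R) (f : {linear V -> W}) (I : finType)
    (P : pred I) (c : I -> R) (X : I -> V) :
  f (\sum_(i | P i) c i *: X i) = \sum_(i | P i) c i *: f (X i).
Proof. by rewrite linear_sum; apply: eq_bigr => i _; rewrite linearZ. Qed.

Lemma mulmx_exprS (R : pzRingType) m (x : 'M[R]_m) n : x *m x ^+ n = x ^+ n.+1.
Proof. by rewrite mulmxE -exprS. Qed.

Lemma mulmx_exprSr (R : pzRingType) m (x : 'M[R]_m) n : x ^+ n *m x = x ^+ n.+1.
Proof. by rewrite mulmxE -exprSr. Qed.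

Lemma comm_mxX (R : pzRingType) m (a x : 'M[R]_m) n : comm_mx a x -> comm_mx a (x ^+ n).
Proof. by rewrite comm_mxE; apply: commrX. Qed.

Lemma comm_mxZ (R : comPzRingType) m (a x : 'M[R]_m) t : comm_mx a x -> comm_mx a (t *: x).
Proof. by move=> ax; rewrite /comm_mx -scalemxAr -scalemxAl ax. Qed.

Lemma exprZmx (R : comPzRingType) m t (a : 'M[R]_m) n : (t *: a) ^+ n = t ^+ n *: a ^+ n.
Proof.
elim: n => [|n IH]; first by rewrite !expr0 scale1r.
by rewrite !exprS IH -!mulmxE -scalemxAl -scalemxAr scalerA.
Qed.

Lemma row_mul_delta (R : pzSemiRingType) l q (y : 'rV[R]_l) i (j : 'I_q) :
  y *m delta_mx i j = y 0 i *: 'e_j.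
Proof.
rewrite -(mul_delta_mx (0 : 'I_1)) mulmxA -colE.
by apply/rowP => t; rewrite !mxE big_ord1 !mxE.
Qed.

Lemma row_scalar_mx (R : pzSemiRingType) l (j : 'I_l) (c : R) : row j c%:M = c *: 'e_j.
Proof. by apply/rowP => q; rewrite !mxE /= [q == j]eq_sym mulr_natr. Qed.

Lemma scalemx_inj (R : idomainType) m q (h : R) :
  h != 0 -> injective ( *:%R h : 'M[R]_(m, q) -> 'M[R]_(m, q)).
Proof.
move=> h0 x y /matrixP e; apply/matrixP => i j; apply: (mulfI h0).
by have := e i j; rewrite !mxE.
Qed.

Lemma mxtrace_delta_mul (R : comPzRingType) m (b : 'M[R]_m) i j :
  \tr (delta_mx j i *m b) = b i j.
Proof. by rewrite -(mul_delta_mx (0 : 'I_1)) -mulmxA mxtrace_mulC trace_mx11 -rowE -colE !mxE. Qed.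

Lemma mxtrace_nondegenerate (R : comPzRingType) m (b : 'M[R]_m) :
  (forall a, \tr (a *m b) = 0) -> b = 0.
Proof. by move=> h; apply/matrixP => i j; rewrite -mxtrace_delta_mul h mxE. Qed.

Lemma comm_mx_all_scalar (R : comPzRingType) m (a : 'M[R]_m) :
  (forall b, comm_mx a b) -> is_scalar_mx a.
Proof.
case: m a => [|m] a com; first by rewrite /is_scalar_mx insubF.
apply/is_scalar_mxP; exists (a 0 0); apply/matrixP => i j.
have /rowP/(_ 0) := congr1 (row i) (com (delta_mx j 0)).
rewrite !row_mul row_mul_delta !mxE eqxx mulr1 => ->.
rewrite (bigD1 0) //= big1 ?addr0 => [|t /negPf t0]; last by rewrite !mxE t0 andbF mul0r.
by rewrite !mxE eqxx andbT mulr_natl.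
Qed.

Lemma separating_col (k : fieldType) q m (A : 'M[k]_(q, m)) (w : 'rV[k]_m) :
  ~~ (w <= A)%MS ->
  exists f : 'cV[k]_m, A *m f = 0 /\ w *m f = 1%:M.
Proof.
rewrite submxE => /matrix0Pn [i [j]]; rewrite ord1 => nz.
exists (cokermx A *m (((w *m cokermx A) 0 j)^-1 *: delta_mx j 0)).
rewrite (mulmxA A) (mulmxA w) mulmx_coker mul0mx; split=> //.
rewrite -scalemxAr -colE; apply/matrixP => x y; rewrite !ord1.
by rewrite mxE [X in _ * X]mxE mulVf // mxE.
Qed.

Lemma natmx_eq0 (R : pzRingType) m n : n%:R = 0 :> R -> n%:R = 0 :> 'M[R]_m.
Proof. by move=> n0; rewrite -scaler_nat n0 scale0r. Qed.

Section LinearOnMatrices.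
Variables (R : comNzRingType) (m : nat).
Implicit Types (a b : 'M[R]_m) (M N : 'M[R]_(m * m)).

Lemma mxvec_ext M N : (forall b, mxvec b *m M = mxvec b *m N) -> M = N.
Proof.
by move=> h; apply/row_matrixP => i; rewrite !rowE -[delta_mx _ _]vec_mxK h.
Qed.

Let lmul a : 'M[R]_(m * m) := lin_mulmx a.
Let rmul a : 'M[R]_(m * m) := lin_mulmxr a.

Lemma lin_mulmxM a b : lmul (a *m b) = lmul b * lmul a.
Proof. by apply: mxvec_ext => c; rewrite -mulmxE mulmxA !mul_vec_lin /= mulmxA. Qed.

Lemma lin_mulmxrM a b : rmul (a *m b) = rmul a * rmul b.
Proof. by apply: mxvec_ext => c; rewrite -mulmxE mulmxA !mul_vec_lin /= mulmxA. Qed.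

Lemma lin_mulmx_mulmxr_comm a b : GRing.comm (lmul a) (rmul b).
Proof. by apply: mxvec_ext => c; rewrite -!mulmxE !mulmxA !mul_vec_lin /= mulmxA. Qed.

Lemma lin_mulmx1 : lmul 1 = 1.
Proof. by apply: mxvec_ext => c; rewrite mul_vec_lin /= mul1mx mulmx1. Qed.

Lemma lin_mulmxr1 : rmul 1 = 1.
Proof. by apply: mxvec_ext => c; rewrite mul_vec_lin /= !mulmx1. Qed.

Lemma lin_mulmxX a n : lmul (a ^+ n) = lmul a ^+ n.
Proof. by elim: n => [|n IH]; rewrite ?lin_mulmx1 // exprSr lin_mulmxM IH exprS. Qed.

Lemma lin_mulmxrX a n : rmul (a ^+ n) = rmul a ^+ n.
Proof. by elim: n => [|n IH]; rewrite ?lin_mulmxr1 // exprS lin_mulmxrM IH -exprS. Qed.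

Lemma lin_mulmx_comm a b : comm_mx a b -> GRing.comm (lmul a) (lmul b).
Proof. by move=> ab; rewrite /GRing.comm -!lin_mulmxM ab. Qed.

Lemma lin_mulmxr_comm a b : comm_mx a b -> GRing.comm (rmul a) (rmul b).
Proof. by move=> ab; rewrite /GRing.comm -!lin_mulmxrM ab. Qed.

End LinearOnMatrices.

Section PrimeExponent.
Variables (R : pzRingType) (p : nat).
Hypotheses (p_pr : prime p) (pR : p%:R = 0 :> R).

Lemma exprD_comm_prime (x y : R) : GRing.comm x y -> (x + y) ^+ p = x ^+ p + y ^+ p.
Proof.
move=> xy; rewrite exprDn_comm //.
case: p p_pr pR => // q q_pr qR; rewrite big_ord_recl big_ord_recr /=.
rewrite bin0 binn !mulr1n subn0 subnn !expr0 mulr1 mul1r big1 ?add0r // => i _.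
rewrite /bump /= add1n -mulr_natr.
have /dvdnP [c ->] : (q.+1 %| 'C(q.+1, i.+1))%N by rewrite prime_dvd_bin //= ltnS.
by rewrite natrM qR !mulr0.
Qed.

Lemma expr_sum_comm_prime (I : Type) (r : seq I) (F : I -> R) :
  (forall i j, GRing.comm (F i) (F j)) ->
  (\sum_(i <- r) F i) ^+ p = \sum_(i <- r) F i ^+ p.
Proof.
move=> cF; elim: r => [|i r IH]; first by rewrite !big_nil expr0n eqn0Ngt prime_gt0.
rewrite !big_cons exprD_comm_prime ?IH //.
by apply: commr_sum => j _; apply: cF.
Qed.

Lemma expr_sub1_prime (x : R) : x ^+ p = 1 -> (x - 1) ^+ p = 0.
Proof.
move=> xp; have := exprD_comm_prime (commr1 (x - 1)).
by rewrite subrK xp expr1n => /esym/(canRL (addrK 1)) ->; rewrite subrr.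
Qed.

Lemma sign_bin_pred i : (i < p)%N -> (-1) ^+ i * 'C(p.-1, i)%:R = 1 :> R.
Proof.
elim: i => [|i IH] ip; first by rewrite bin0 mulr1.
have /dvdnP [c e] : (p %| 'C(p, i.+1))%N by rewrite prime_dvd_bin.
have : 'C(p.-1, i.+1)%:R = - 'C(p.-1, i)%:R :> R.
  by apply/eqP; rewrite -addr_eq0 -natrD -binS prednK ?prime_gt0 // e natrM pR mulr0.
by move=> ->; rewrite exprS mulN1r mulrN mulNr opprK IH // ltnW.
Qed.

End PrimeExponent.

Section RowSpaceTrace.
Variables (k : fieldType) (m : nat).
Implicit Types (a xi : 'M[k]_m).

Definition rowsp_proj q (U : 'M[k]_(q, m)) : 'M[k]_m := pinvmx U *m U.

Definition rowsp_trace q (U : 'M[k]_(q, m)) a : k := \tr (rowsp_proj U *m a).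

Lemma rowsp_proj_sub q (U : 'M[k]_(q, m)) : (rowsp_proj U <= U)%MS.
Proof. exact: submxMl. Qed.

Lemma rowsp_proj_id q r (U : 'M[k]_(q, m)) (v : 'M[k]_(r, m)) :
  (v <= U)%MS -> v *m rowsp_proj U = v.
Proof. by move=> vU; rewrite mulmxA mulmxKpV. Qed.

Lemma rowsp_trace_proj q (U : 'M[k]_(q, m)) (P : 'M[k]_m) a :
  (P <= U)%MS -> U *m P = U -> (U *m a <= U)%MS -> \tr (P *m a) = rowsp_trace U a.
Proof.
move=> PU UP Ua.
have PaU : (P *m a <= U)%MS by apply: submx_trans Ua; apply: submxMr.
rewrite -(rowsp_proj_id PaU) mxtrace_mulC mulmxA /rowsp_trace.
by rewrite /rowsp_proj -(mulmxA _ U P) UP.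
Qed.

Lemma rowsp_trace_sub q r (U : 'M[k]_(q, m)) (W : 'M[k]_(r, m)) a :
  (U *m a <= W)%MS -> (W <= U)%MS -> rowsp_trace U a = rowsp_trace W a.
Proof.
move=> UaW WU; rewrite /rowsp_trace.
have projUa : (rowsp_proj U *m a <= W)%MS.
  by apply: submx_trans UaW; rewrite submxMr // rowsp_proj_sub.
rewrite -(rowsp_proj_id projUa) mxtrace_mulC mulmxA rowsp_proj_id //.
exact: submx_trans (rowsp_proj_sub _) WU.
Qed.

Lemma cap_kermx_stable q (U : 'M[k]_(q, m)) xi a :
  comm_mx a xi -> (U *m a <= U)%MS -> stablemx (U :&: kermx xi)%MS a.
Proof.
move=> a_xi Ua; rewrite sub_capmx; apply/andP; split.
  by apply: submx_trans Ua; apply/submxMr/capmxSl.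
apply: submx_trans (comm_mx_stable_ker (comm_mx_sym a_xi)).
by apply/submxMr/capmxSr.
Qed.

Lemma rowsp_trace_ker_im q (U : 'M[k]_(q, m)) xi a :
  comm_mx a xi -> (U *m a <= U)%MS ->
  rowsp_trace U a = rowsp_trace (U :&: kermx xi)%MS a + rowsp_trace (U *m xi) a.
Proof.
move=> a_xi Ua; pose K := (U :&: kermx xi)%MS.
have /sub_kermxP K_xi : (K <= kermx xi)%MS by apply: capmxSr.
pose sec := pinvmx (U *m xi) *m U; pose PU := rowsp_proj U.
have sec_sub : (sec <= U)%MS by apply: submxMl.
have secK r (y : 'M[k]_(r, m)) : (y <= U *m xi)%MS -> y *m sec *m xi = y.
  by move=> yU; rewrite /sec mulmxA -mulmxA mulmxKpV.
have PU_xi : (PU *m xi <= U *m xi)%MS by rewrite submxMr // rowsp_proj_sub.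
pose PK := PU - PU *m xi *m sec.
have PK_sub : (PK <= K)%MS.
  rewrite sub_capmx; apply/andP; split; last first.
    by apply/sub_kermxP; rewrite mulmxBl secK // subrr.
  by rewrite addmx_sub ?rowsp_proj_sub // eqmx_opp (submx_trans (submxMl _ _)).
have trK : \tr (PK *m a) = rowsp_trace K a.
  apply: rowsp_trace_proj => //; last exact: cap_kermx_stable.
  have K_PU : K *m PU = K by apply/rowsp_proj_id/capmxSl.
  by rewrite mulmxBr (mulmxA K _ sec) (mulmxA K PU) K_PU K_xi mul0mx subr0.
have tr_im : \tr (sec *m xi *m a) = rowsp_trace (U *m xi) a.
  apply: rowsp_trace_proj; first exact: submxMr.
    by rewrite mulmxA secK.
  by rewrite -mulmxA -a_xi mulmxA submxMr.
rewrite -trK -tr_im -[rowsp_trace U a]/(\tr (PU *m a)).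
rewrite -{1}(subrK (PU *m xi *m sec) PU) -/PK mulmxDl mxtraceD; congr (_ + _).
have sec_a : (sec *m a <= U)%MS by apply: submx_trans Ua; apply: submxMr.
rewrite -(mulmxA _ sec) -(mulmxA PU) mxtrace_mulC -(mulmxA xi) (rowsp_proj_id sec_a).
by rewrite mxtrace_mulC -!mulmxA a_xi.
Qed.

End RowSpaceTrace.

Section NilpotentLayers.
Variables (p : nat) (k : fieldType) (m : nat) (xi : 'M[k]_m).

Definition kermx_layer i := (xi ^+ i :&: kermx xi)%MS.

Lemma kermx_layer_annul i : kermx_layer i *m xi = 0.
Proof. by apply/sub_kermxP/capmxSr. Qed.

Lemma expmx_sub i j : (i <= j)%N -> (xi ^+ j <= xi ^+ i)%MS.
Proof. by move=> ij; rewrite -(subnK ij) exprD submxMl. Qed.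

(* The layers are the successive quotients of the filtration by the im xi^i, and they all
   contribute the same trace, so that the total is a multiple of p. *)
Lemma mxtrace_layers0 (c : 'M[k]_m) : p \in [pchar k] -> xi ^+ p = 0 -> comm_mx c xi ->
  (forall i, (i.+1 < p)%N -> (kermx_layer i *m c <= xi ^+ i.+1)%MS) -> \tr c = 0.
Proof.
move=> pk xip c_xi c_layer; have p_gt0 : (0 < p)%N by case/andP: pk => /prime_gt0.
pose t i := rowsp_trace (kermx_layer i) c.
have trS i : rowsp_trace (xi ^+ i) c = t i + rowsp_trace (xi ^+ i.+1) c.
  rewrite (rowsp_trace_ker_im c_xi) ?mulmx_exprSr //.
  exact/comm_mx_stable/comm_mx_sym/comm_mxX.
have t_const i : (i < p)%N -> t i = t 0%N.
  elim: i => // i IH ip; rewrite -IH 1?ltnW //; apply/esym/rowsp_trace_sub.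
    rewrite sub_capmx c_layer //=; apply/sub_kermxP.
    by rewrite -mulmxA c_xi mulmxA kermx_layer_annul mul0mx.
  by rewrite capmxS // expmx_sub.
have tr_sum n : (n <= p)%N ->
    rowsp_trace (xi ^+ 0) c = t 0%N *+ n + rowsp_trace (xi ^+ n) c.
  elim: n => [|n IH] np; first by rewrite mulr0n add0r.
  by rewrite IH ?(ltnW np) // trS t_const // mulrSr addrA.
have := tr_sum p (leqnn p); rewrite xip -mulr_natr pcharf0 // mulr0 add0r.
rewrite -(@rowsp_trace_proj _ _ _ _ 1%:M) ?submx1 ?mulmx1 ?mul1mx // => ->.
by rewrite /rowsp_trace /rowsp_proj mulmx0 mul0mx raddf0.
Qed.

End NilpotentLayers.

Section DualBases.
Variables (k : fieldType) (m : nat) (I : finType).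
Implicit Types X Y : I -> 'M[k]_m.

Definition dual_bases X Y :=
  (forall i j, \tr (X i *m Y j) = (i == j)%:R) /\
  (forall a, a = \sum_i \tr (a *m Y i) *: X i).

Lemma dual_bases_exists X :
  (forall c : I -> k, \sum_i c i *: X i = 0 -> forall i, c i = 0) ->
  (forall b, exists c : I -> k, b = \sum_i c i *: X i) ->
  exists Y, dual_bases X Y.
Proof.
move=> indep span.
have [c cP] := fin_all_exists (fun ab : 'I_m * 'I_m => span (delta_mx ab.1 ab.2)).
pose Y j := \matrix_(b, a) c (a, b) j; exists Y.
have expand (a : 'M[k]_m) : a = \sum_i \tr (a *m Y i) *: X i.
  have trY i : \tr (a *m Y i) = \sum_(ab : 'I_m * 'I_m) a ab.1 ab.2 * c ab i.
    rewrite /mxtrace (eq_bigr (fun x => \sum_y a x y * c (x, y) i)) => [|x _].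
      by rewrite pair_bigA; apply: eq_bigr => -[x y].
    by rewrite mxE; apply: eq_bigr => y _; rewrite mxE.
  under eq_bigr do rewrite trY scaler_suml.
  rewrite exchange_big {1}(matrix_sum_delta a) [LHS]pair_bigA /=; apply: eq_bigr => ab _.
  by rewrite {1}cP scaler_sumr; apply: eq_bigr => i _; rewrite scalerA.
split=> // i j; apply/eqP; rewrite -subr_eq0; apply/eqP.
apply: (indep (fun j => \tr (X i *m Y j) - (i == j)%:R)).
under eq_bigr do rewrite scalerBl.
rewrite sumrB -expand (bigD1 i) //= eqxx scale1r big1 ?addr0 ?subrr // => x ne.
by rewrite eq_sym (negPf ne) scale0r.
Qed.

Section Pair.
Variables X Y : I -> 'M[k]_m.
Hypothesis XY : dual_bases X Y.

Lemma dual_mxtrace i j : \tr (X i *m Y j) = (i == j)%:R.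
Proof. by case: XY. Qed.

Lemma dual_expand a : a = \sum_i \tr (a *m Y i) *: X i.
Proof. by case: XY. Qed.

Lemma dual_bases_inj : injective X.
Proof.
move=> i j e; have := dual_mxtrace i i; rewrite eqxx e dual_mxtrace eq_sym.
by case: eqP => // _ /esym/eqP; rewrite oner_eq0.
Qed.

Lemma dual_coord (P : pred I) (c : I -> k) j :
  P j -> \tr ((\sum_(i | P i) c i *: X i) *m Y j) = c j.
Proof.
move=> Pj; rewrite mulmx_suml raddf_sum (bigD1 j) //= -scalemxAl mxtraceZ.
rewrite dual_mxtrace eqxx mulr1 big1 ?addr0 // => i /andP[_ ne].
by rewrite -scalemxAl mxtraceZ dual_mxtrace (negPf ne) mulr0.
Qed.

End Pair.
End DualBases.

Lemma map_dual_bases (k K : fieldType) (f : {rmorphism k -> K}) m (I : finType)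
    (X Y : I -> 'M[k]_m) :
  dual_bases X Y -> dual_bases (map_mx f \o X) (map_mx f \o Y).
Proof.
move=> XY; split=> [i j|a]; first by rewrite /= -map_mxM trace_map_mx (dual_mxtrace XY) rmorph_nat.
pose L b := \sum_i \tr (b *m map_mx f (Y i)) *: map_mx f (X i).
have L_lin c : {morph L : b d / c *: b + d}.
  move=> b d; rewrite /L scaler_sumr -big_split; apply: eq_bigr => i _ /=.
  by rewrite mulmxDl mxtraceD -scalemxAl mxtraceZ scalerDl scalerA.
pose linL : {linear 'M[K]_m -> 'M[K]_m} := HB.pack L (GRing.isLinear.Build _ _ _ _ L L_lin).
have L_delta x y : linL (delta_mx x y) = delta_mx x y.
  rewrite -[RHS](map_delta_mx f) [in RHS](dual_expand XY (delta_mx x y)) raddf_sum.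
  by apply: eq_bigr => i _ /=; rewrite map_mxZ -trace_map_mx map_mxM map_delta_mx.
rewrite -[RHS]/(linL a) {1 2}(matrix_sum_delta a) linear_sum; apply: eq_bigr => x _.
by rewrite linear_sum; apply: eq_bigr => y _; rewrite linearZ /= -[L _]/(linL _) L_delta.
Qed.

(* For matrix units e of a matrix algebra of size r over F, the columns of G are the vectors
   e_{j, i0} e_t of a simple submodule, on which e_{i, j} acts as delta_mx i j. *)
Lemma matrix_units_intertwiner (F : fieldType) l r (e : 'I_l -> 'I_l -> 'M[F]_r) i0 :
  (forall i j k q, e i j *m e k q = (j == k)%:R *: e i q) ->
  (forall M, exists c : 'I_l -> 'I_l -> F, M = \sum_i \sum_j c i j *: e i j) ->
  e i0 i0 != 0 ->
  exists G : 'M[F]_(r, l), [/\ forall i j, e i j *m G = G *m delta_mx i j,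
    forall w : 'rV_r, w *m G = 0 -> w = 0 & exists w : 'rV_r, w *m G != 0].
Proof.
move=> eM e_span /matrix0Pn [x0 [t e0t]].
pose G := \matrix_(x < r, j < l) e j i0 x t.
have eG i j : e i j *m G = G *m delta_mx i j.
  apply/matrixP => x k; have /matrixP/(_ x t) := eM i j k i0; rewrite !mxE => h.
  under eq_bigr do rewrite mxE; rewrite h.
  rewrite (bigD1 i) //= big1 ?addr0 => [|y ne]; last by rewrite !mxE (negPf ne) mulr0.
  by rewrite !mxE eqxx /= mulrC [k == j]eq_sym.
have G0 : G x0 i0 != 0 by rewrite mxE.
exists G; split=> // [w wG|]; last first.
  by exists 'e_x0; apply: contraNneq G0 => /rowP/(_ i0); rewrite -rowE !mxE => ->.
have wMG M : w *m M *m G = 0.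
  have [c ->] := e_span M; rewrite mulmx_sumr mulmx_suml big1 // => i _.
  rewrite mulmx_sumr mulmx_suml big1 // => j _.
  by rewrite -scalemxAr -scalemxAl -mulmxA eG mulmxA wG mul0mx scaler0.
apply/rowP => x; rewrite [RHS]mxE; apply/eqP; apply: contraNT G0 => wx.
have /rowP/(_ i0) := wMG (delta_mx x x0).
rewrite row_mul_delta -scalemxAl -rowE mxE [RHS]mxE => /eqP.
by rewrite mulf_eq0 (negPf wx) mxE.
Qed.

(** * Maximal subgroups and orbits of p-groups *)

Section MaximalCosets.
Local Open Scope group_scope.
Variables (p : nat) (gT : finGroupType) (G H : {group gT}) (g : gT).
Hypotheses (pG : p.-group G) (maxH : maximal H G) (gG : g \in G) (gH : g \notin H).

Lemma notin_pgroup_prime : prime p.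
Proof.
have [| p_pr _ _] := pgroup_pdiv pG; last exact: p_pr.
by apply: contra gH => /eqP G1; move: gG; rewrite G1 => /set1P ->; apply: group1.
Qed.

Let sHG : H \subset G. Proof. exact: normal_sub (p_maximal_normal pG maxH). Qed.
Let nHG : G \subset 'N(H). Proof. exact: normal_norm (p_maximal_normal pG maxH). Qed.
Let oGH : #|G / H| = p.
Proof. by rewrite card_quotient // (p_maximal_index pG maxH). Qed.

Lemma order_coset_maximal : #[coset H g] = p.
Proof.
have : (#[coset H g] %| p)%N by rewrite -oGH order_dvdG // mem_quotient.
case/primeP: notin_pgroup_prime => _ h /h /orP[|/eqP//]; rewrite order_eq1.
by move/eqP => gH1; case/negP: gH; apply: coset_idr gH1; apply: subsetP gG.
Qed.

Lemma maximal_expg_mem j : (g ^+ j \in H) = (p %| j)%N.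
Proof.
have gN := subsetP nHG _ gG; rewrite -order_coset_maximal order_dvdn -morphX //.
by apply/idP/eqP => [|/coset_idr->//]; [apply: coset_id | apply: groupX].
Qed.

Lemma maximal_coset_exists z : z \in G -> exists j : 'I_p, z * g ^- j \in H.
Proof.
move=> zG; have zN := subsetP nHG _ zG; have gN := subsetP nHG _ gG.
have : coset H z \in <[coset H g]>.
  suff /eqP <- : G / H == <[coset H g]> by apply: mem_quotient.
  by rewrite eq_sym eqEcard cycle_subG mem_quotient //= -orderE order_coset_maximal oGH.
case/cyclePmin=> j; rewrite order_coset_maximal => jp e; exists (Ordinal jp).
apply: coset_idr; first by rewrite groupM // groupV groupX.
by rewrite morphM ?morphV ?morphX ?groupV ?groupX //= e mulgV.
Qed.

Lemma maximal_expg_inj (i j : 'I_p) : g ^+ i * g ^- j \in H -> i = j.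
Proof.
wlog le_ji : i j / (j <= i)%N => [hwlog|].
  case/orP: (leq_total i j) => le ij; last exact: hwlog.
  by apply/esym/hwlog => //; rewrite -groupV invMg invgK.
rewrite -(subnK le_ji) expgD mulgK maximal_expg_mem => dv; apply: val_inj => /=.
apply/eqP; rewrite eqn_leq le_ji andbT -subn_eq0; apply: contraTT dv.
by rewrite -lt0n => pos; rewrite gtnNdvd // (leq_ltn_trans (leq_subr _ _)).
Qed.

Lemma sum_maximal_coset z : z \in G -> (\sum_(j < p) ((z * g ^- j)%g \in H))%N = 1%N.
Proof.
move=> zG; have [j zjH] := maximal_coset_exists zG.
rewrite (bigD1 j) //= zjH big1 // => i ne_ij; apply/eqP; rewrite eqb0.
apply: contra ne_ij => ziH; apply/eqP/maximal_expg_inj; rewrite -groupV invMg invgK.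
have := groupM (groupVr zjH) ziH.
by rewrite invMg invgK mulgA mulgKV.
Qed.

Lemma rcosets_maximal : rcosets H G = [set H :* g ^+ j | j : 'I_p].
Proof.
apply/setP => C; apply/rcosetsP/imsetP => [[x xG ->]|[j _ ->]]; last first.
  by exists (g ^+ j); rewrite ?groupX.
by have [j xj] := maximal_coset_exists xG; exists j => //; apply/rcoset_eqP; rewrite mem_rcoset.
Qed.

Lemma rcoset_expg_inj : injective (fun j : 'I_p => H :* g ^+ j).
Proof.
move=> i j e; apply: maximal_expg_inj.
by rewrite -mem_rcoset -(e : H :* _ = H :* _) rcoset_refl.
Qed.

End MaximalCosets.

Lemma maximal_cap (p : nat) (gT : finGroupType) (G Z M : {group gT}) :
  (p.-group G)%g -> Z \subset G -> maximal M G -> ~~ (Z \subset M) -> maximal (Z :&: M) Z.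
Proof.
move=> pG sZG maxM /subsetPn [g gZ gM]; have gG := subsetP sZG _ gZ.
apply: p_index_maximal; first exact: subsetIl.
suff -> : #|Z : Z :&: M|%g = #|G : M|%g.
  by rewrite (p_maximal_index pG maxM) (notin_pgroup_prime pG gG gM).
rewrite indexgI /indexg (rcosets_maximal pG maxM gG gM); congr #|(_ : {set _})|.
apply/setP => C; apply/rcosetsP/imsetP => [[x xZ ->]|[j _ ->]].
  have [j xj] := maximal_coset_exists pG maxM gG gM (subsetP sZG _ xZ).
  by exists j => //; apply/rcoset_eqP; rewrite mem_rcoset.
by exists (g ^+ j)%g; rewrite ?groupX.
Qed.

Section OrbitBlocks.
Local Open Scope group_scope.
Variables (p : nat) (gT : finGroupType) (G : {group gT}) (I : finType) (to : action G I).
Hypothesis pG : p.-group G.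

(* A block (H, g, Y) stands for an orbit: Y is the orbit of a point under a maximal subgroup H
   containing its stabiliser, and the orbit is the disjoint union of the translates of Y by
   the powers g^0, ..., g^(p-1). *)
Definition maximal_block (t : {group gT} * gT * {set I}) :=
  [/\ maximal t.1.1 G, t.1.2 \in G, t.1.2 \notin t.1.1 &
      {in t.1.1 & t.2, forall h i, to i h \in t.2}].

Definition block_mult (t : {group gT} * gT * {set I}) (i : I) : nat :=
  (\sum_(j < p) (to i (t.1.2 ^- j)%g \in t.2))%N.

Lemma orbit_block x : x \notin 'Fix_to(G) ->
  exists2 t, maximal_block t & forall i, block_mult t i = (i \in orbit to G x).
Proof.
move=> nfix; have stabG : 'C_G[x | to] \proper G.
  rewrite properE subsetIl /=; apply: contra nfix => /subsetP sG; apply/afixP => g /sG.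
  by case/setIP => _ /astab_act ->; rewrite ?set11.
have [H maxH sH] : {H : {group gT} | maximal H G & 'C_G[x | to] \subset H}.
  have [H maxH sH] :=
    @maxgroup_exists _ (fun K : {group gT} => K \proper G) [group of 'C_G[x | to]] stabG.
  by exists H.
have [g gG gH] : exists2 g, g \in G & g \notin H.
  by have /properP[_ [g gG gH]] := maxgroupp maxH; exists g.
have sHG := subsetP (proper_sub (maxgroupp maxH)).
have memY w : w \in G -> (to x w \in orbit to H x) = (w \in H).
  move=> wG; apply/orbitP/idP => [[h hH e]|]; last by exists w.
  have hG := sHG _ hH; rewrite -(groupMr _ (groupVr hH)); apply: (subsetP sH).
  rewrite !inE sub1set inE groupM ?groupV //=; apply/eqP.
  by rewrite actMin ?groupV // -e actKin.
exists (H, g, orbit to H x); first split=> // h _ hH /orbitP [h' h'H <-].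
  by rewrite -actMin ?sHG // mem_orbit ?groupM.
move=> i; rewrite /block_mult /=; have gXV j : g ^- j \in G by rewrite groupV groupX.
have [/orbitP [z zG <-]|iO] := boolP (i \in _).
  rewrite (eq_bigr (fun j : 'I_p => (z * g ^- j)%g \in H : nat)) => [|j _].
    by rewrite (sum_maximal_coset pG maxH gG gH zG).
  by rewrite -(actMin to x zG (gXV j)) memY //; apply: groupM (gXV j).
rewrite big1 // => j _; apply/eqP; rewrite eqb0; apply: contra iO => /orbitP [h /sHG hG e].
by rewrite -(orbit_actr_in to x i (subxx G) (gXV j)) -e mem_orbit.
Qed.

Lemma nonfixed_blocks : exists T : seq ({group gT} * gT * {set I}),
  (forall t, t \in T -> maximal_block t) /\
  (forall i, (\sum_(t <- T) block_mult t i)%N = (i \notin 'Fix_to(G))).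
Proof.
pose P := orbit to G @: ~: 'Fix_to(G).
have actsC : [acts G, on ~: 'Fix_to(G) | to].
  rewrite astabsC; have := acts_subnorm_fix to G.
  by rewrite setIid (setIidPl (normG G)).
have /and3P [/eqP coverP trivP _] := orbit_partition actsC.
have ex orb : exists t, orb \in P -> maximal_block t /\ forall i, block_mult t i = (i \in orb).
  have [/imsetP [x xS ->]|norb] := boolP (orb \in P).
    by rewrite inE in xS; have [t tP tE] := orbit_block xS; exists t.
  by exists (G, 1, set0).
have [blk blkP] := fin_all_exists ex.
exists [seq blk orb | orb <- enum P]; split=> [t|i].
  by case/mapP => orb; rewrite mem_enum => /blkP [tP _] ->.
rewrite big_map big_enum /= (eq_bigr (fun orb : {set I} => (i \in orb) : nat)) => [|orb /blkP []//].
rewrite -in_setC -coverP.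
have [iP|iP] := boolP (i \in cover P); last first.
  by rewrite big1 // => orb orbP; apply/eqP; rewrite eqb0;
       apply: contra iP => i_orb; apply/bigcupP; exists orb.
rewrite (bigD1 (pblock P i)) ?pblock_mem //= mem_pblock iP big1 // => orb /andP [orbP ne_orb].
by apply/eqP; rewrite eqb0; apply: contra ne_orb => i_orb; rewrite (def_pblock trivP orbP i_orb).
Qed.

End OrbitBlocks.

(** * Conjugation by a matrix representation *)

Section RepConj.
Variables (gT : finGroupType) (k : fieldType) (m : nat) (rho : gT -> 'M[k]_m).
Implicit Types (a b : 'M[k]_m) (g h : gT).

Definition rep_conj g a := rho g^-1%g *m a *m rho g.

Lemma rep_conj_is_linear g : linear (rep_conj g).
Proof. by move=> c a b; rewrite /rep_conj mulmxDr mulmxDl -scalemxAr -scalemxAl. Qed.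

HB.instance Definition _ g := GRing.isLinear.Build _ _ _ _ (rep_conj g) (rep_conj_is_linear g).

Definition centmx (H : {set gT}) a := forall h, h \in H -> comm_mx (rho h) a.

Section Centralizer.
Variable H : {set gT}.

Lemma centmx0 : centmx H 0.
Proof. by move=> h _; apply: comm_mx0. Qed.

Lemma centmx1 : centmx H 1%:M.
Proof. by move=> h _; apply: comm_mx1. Qed.

Lemma centmxM a b : centmx H a -> centmx H b -> centmx H (a *m b).
Proof. by move=> ca cb h hH; apply: comm_mxM; [apply: ca | apply: cb]. Qed.

Lemma centmxD a b : centmx H a -> centmx H b -> centmx H (a + b).
Proof. by move=> ca cb h hH; apply: comm_mxD; [apply: ca | apply: cb]. Qed.

Lemma centmxZ c a : centmx H a -> centmx H (c *: a).
Proof. by move=> ca h hH; apply/comm_mxZ/ca. Qed.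

Lemma centmx_sum (J : Type) (r : seq J) (P : pred J) (F : J -> 'M[k]_m) :
  (forall j, P j -> centmx H (F j)) -> centmx H (\sum_(j <- r | P j) F j).
Proof. by move=> cF; elim/big_ind: _ => //; [apply: centmx0 | apply: centmxD]. Qed.

Lemma centmx_invmx a : a \in unitmx -> centmx H a -> centmx H (invmx a).
Proof.
move=> au ca h hH; apply: (can_inj (mulKmx au)); apply: (can_inj (mulmxK au)).
by rewrite /= !mulmxA mulmxV // mul1mx mulmxKV // ca.
Qed.

End Centralizer.

Lemma centmxS (H K : {set gT}) a : H \subset K -> centmx K a -> centmx H a.
Proof. by move=> /subsetP sHK ca h /sHK; apply: ca. Qed.

End RepConj.

Arguments rep_conj {gT k m} rho g a : simpl never.

Section RepresentationConj.
Variables (gT : finGroupType) (k : fieldType) (m : nat) (G : {group gT})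
  (rG : mx_representation k G m).
Implicit Types (a b : 'M[k]_m) (g h : gT).

Lemma repr_mulVmx g : g \in G -> rG g^-1%g *m rG g = 1%:M.
Proof. by move=> gG; rewrite repr_mxV // mulVmx ?repr_mx_unit. Qed.

Lemma repr_mulmxV g : g \in G -> rG g *m rG g^-1%g = 1%:M.
Proof. by move=> gG; rewrite repr_mxV // mulmxV ?repr_mx_unit. Qed.

Lemma repr_mx_expg j g : g \in G -> rG (g ^+ j)%g = rG g ^+ j.
Proof.
move=> gG; elim: j => [|j IH]; first by rewrite expg0 repr_mx1.
by rewrite expgS repr_mxM ?groupX // IH exprS.
Qed.

Lemma rep_conj1 a : rep_conj rG 1%g a = a.
Proof. by rewrite /rep_conj invg1 repr_mx1 mul1mx mulmx1. Qed.

Lemma rep_conj_comp g h a : g \in G -> h \in G ->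
  rep_conj rG (g * h)%g a = rep_conj rG h (rep_conj rG g a).
Proof. by move=> gG hG; rewrite /rep_conj invMg !repr_mxM ?groupV // !mulmxA. Qed.

Lemma rep_conjK g : g \in G -> cancel (rep_conj rG g) (rep_conj rG g^-1%g).
Proof. by move=> gG a; rewrite -rep_conj_comp ?groupV // mulgV rep_conj1. Qed.

Lemma rep_conjM g a b : g \in G ->
  rep_conj rG g (a *m b) = rep_conj rG g a *m rep_conj rG g b.
Proof.
move=> gG; rewrite /rep_conj -!mulmxA; congr (_ *m (_ *m _)).
by rewrite (mulmxA (rG g)) repr_mulmxV // mul1mx.
Qed.

Lemma mxtrace_rep_conj g a : g \in G -> \tr (rep_conj rG g a) = \tr a.
Proof. by move=> gG; rewrite /rep_conj mxtrace_mulC mulmxA repr_mulmxV // mul1mx. Qed.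

Lemma rep_conj_id g a : g \in G -> rep_conj rG g a = a <-> comm_mx (rG g) a.
Proof.
move=> gG; rewrite /rep_conj /comm_mx; split=> e.
  by rewrite -{1}e !mulmxA repr_mulmxV // mul1mx.
by rewrite -mulmxA -e mulmxA repr_mulVmx // mul1mx.
Qed.

Lemma centmxP a : centmx rG G a <-> forall g, g \in G -> rep_conj rG g a = a.
Proof. by split=> ca g gG; apply/rep_conj_id => //; apply: ca. Qed.

End RepresentationConj.

Section MaximalTraces.
Variables (p : nat) (gT : finGroupType) (k : fieldType) (m : nat).

Definition trace_pow (rho : gT -> 'M[k]_m) g a := \sum_(j < p) rep_conj rho (g ^+ j)%g a.

(* When H is maximal in the p-group G and g lies outside H, the powers of g represent the
   cosets of H, so that trace_pow is the relative trace from H to G. *)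
Variant maximal_trace (G : {group gT}) (rho : gT -> 'M[k]_m) : 'M[k]_m -> Prop :=
  MaximalTrace (H : {group gT}) g a of
    maximal H G & g \in G & g \notin H & centmx rho H a :
    maximal_trace G rho (trace_pow rho g a).

Variables (G : {group gT}) (rG : mx_representation k G m).
Hypothesis pG : (p.-group G)%g.

Lemma trace_pow_rcosets (H : {group gT}) g a :
  maximal H G -> g \in G -> g \notin H -> centmx rG H a ->
  trace_pow rG g a = \sum_(C in rcosets H G) rep_conj rG (repr C) a.
Proof.
move=> mH gG gH ca; have sHG := subsetP (proper_sub (maxgroupp mH)).
rewrite (rcosets_maximal pG mH gG gH) big_imset /=; last first.
  by move=> i j _ _; apply: (rcoset_expg_inj pG mH gG gH).
apply: eq_bigr => j _; have /rcosetP [h hH ->] := mem_repr_rcoset H (g ^+ j)%g.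
have hG := sHG _ hH; rewrite rep_conj_comp ?groupX //; congr (rep_conj _ _ _).
by apply/esym/rep_conj_id => //; apply: ca.
Qed.

Lemma trace_pow_indep (H : {group gT}) g h a : maximal H G ->
  g \in G -> g \notin H -> h \in G -> h \notin H -> centmx rG H a ->
  trace_pow rG g a = trace_pow rG h a.
Proof. by move=> *; rewrite !(@trace_pow_rcosets H). Qed.

End MaximalTraces.

Section PermutationBasis.
Variables (p : nat) (gT : finGroupType) (k : fieldType) (m : nat) (I : finType).

Definition perm_family (G : {group gT}) (rho : gT -> 'M[k]_m) (X : I -> 'M[k]_m) :=
  forall g i, g \in G -> exists j, rep_conj rho g (X i) = X j.

Definition basis_fixed (G : {group gT}) (rho : gT -> 'M[k]_m) (X : I -> 'M[k]_m) : pred I :=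
  fun i => [forall g in G, rep_conj rho g (X i) == X i].

Definition dual_proj (X Y : I -> 'M[k]_m) (S : {set I}) (a : 'M[k]_m) :=
  \sum_(i in S) \tr (a *m Y i) *: X i.

Lemma dual_proj_is_linear X Y S : linear (dual_proj X Y S).
Proof.
move=> c a b; rewrite /dual_proj scaler_sumr -big_split; apply: eq_bigr => i _ /=.
by rewrite mulmxDl mxtraceD -scalemxAl mxtraceZ scalerDl scalerA.
Qed.

HB.instance Definition _ X Y S :=
  GRing.isLinear.Build _ _ _ _ (dual_proj X Y S) (@dual_proj_is_linear X Y S).

Variables (G : {group gT}) (rG : mx_representation k G m) (X Y : I -> 'M[k]_m).
Hypotheses (pG : (p.-group G)%g) (XY : dual_bases X Y) (permX : perm_family G rG X).

Lemma basis_fixed_centmx i : basis_fixed G rG X i -> centmx rG G (X i).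
Proof. by move=> /forall_inP Xi; apply/centmxP => g gG; apply/eqP/Xi. Qed.

Definition basis_index i g :=
  if g \in G then odflt i [pick j | rep_conj rG g (X i) == X j] else i.

Lemma basis_indexE g i : g \in G -> X (basis_index i g) = rep_conj rG g (X i).
Proof.
move=> gG; rewrite /basis_index gG; case: pickP => [j /eqP -> //|no].
by have [j e] := permX i gG; have := no j; rewrite e eqxx.
Qed.

Lemma basis_index_is_action : is_action G basis_index.
Proof.
have inj := dual_bases_inj XY; split=> [g i j|i g h gG hG]; last first.
  by apply: inj; rewrite !basis_indexE ?groupM // rep_conj_comp.
have [gG e|/negPf gG] := boolP (g \in G); last by rewrite /basis_index gG.
by apply/inj/(can_inj (rep_conjK rG gG)); rewrite -!basis_indexE // e.
Qed.

Definition basis_act := Action basis_index_is_action.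

Lemma basis_actE g i : g \in G -> X (basis_act i g) = rep_conj rG g (X i).
Proof. exact: basis_indexE. Qed.

Lemma afix_basis_act i : (i \in 'Fix_basis_act(G)%g) = basis_fixed G rG X i.
Proof.
apply/afixP/forall_inP => Xi g gG; first by rewrite -basis_actE ?Xi.
by apply: (dual_bases_inj XY); rewrite basis_actE //; apply/eqP/Xi.
Qed.

Lemma dual_coord_act g i a : g \in G ->
  \tr (rep_conj rG g a *m Y (basis_act i g)) = \tr (a *m Y i).
Proof.
move=> gG; rewrite {1 2}(dual_expand XY a) linear_sum !mulmx_suml !raddf_sum /=.
apply: eq_bigr => j _; rewrite linearZ /= -!scalemxAl !mxtraceZ -basis_actE //.
by rewrite !(dual_mxtrace XY) (inj_eq (act_inj _ _)).
Qed.

Lemma dual_basis_fixed i : basis_fixed G rG X i -> centmx rG G (Y i).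
Proof.
move=> Xi; apply/centmxP => g gG; apply/eqP; rewrite -subr_eq0; apply/eqP.
apply: mxtrace_nondegenerate => a.
have act_i : basis_act i g = i by move: Xi; rewrite -afix_basis_act => /afixP ->.
rewrite -[a](rep_conjK rG (groupVr gG)) invgK mulmxBr raddfB /=.
rewrite -rep_conjM // mxtrace_rep_conj //.
by have := dual_coord_act i (rep_conj rG g^-1%g a) gG; rewrite act_i => ->; rewrite subrr.
Qed.

Lemma rep_conj_dual_proj g S a : g \in G ->
  rep_conj rG g (dual_proj X Y S a) = dual_proj X Y (setact basis_act S g) (rep_conj rG g a).
Proof.
move=> gG; rewrite /dual_proj linear_sum big_imset /=; last exact: in2W (act_inj basis_act g).
by apply: eq_bigr => i _; rewrite linearZ /= -basis_actE // dual_coord_act.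
Qed.

(* T lists the blocks (H, g, Y) of the nontrivial orbits of G on the basis. *)
Lemma perm_decomposition : exists T : seq ({group gT} * gT * {set I}),
  (forall t, t \in T -> [/\ maximal t.1.1 G, t.1.2 \in G, t.1.2 \notin t.1.1 &
     forall h a, h \in t.1.1 ->
       rep_conj rG h (dual_proj X Y t.2 a) = dual_proj X Y t.2 (rep_conj rG h a)]) /\
  (forall a, a = \sum_(i | basis_fixed G rG X i) \tr (a *m Y i) *: X i +
     \sum_(t <- T) \sum_(j < p)
        rep_conj rG (t.1.2 ^+ j)%g (dual_proj X Y t.2 (rep_conj rG (t.1.2 ^- j)%g a))).
Proof.
have [T [blockT multT]] := nonfixed_blocks basis_act pG.
exists T; split=> [t /blockT [mH gG gH stab]|a].
  split=> // h a hH; have sHG := subsetP (proper_sub (maxgroupp mH)).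
  rewrite rep_conj_dual_proj ?sHG //; congr (dual_proj _ _ _ _).
  apply/eqP; rewrite eqEcard card_setact leqnn andbT.
  by apply/subsetP => _ /imsetP [i iY ->]; apply: stab.
have mem_setact_expg t i j : t \in T ->
    (i \in setact basis_act t.2 (t.1.2 ^+ j)%g) = (basis_act i (t.1.2 ^- j)%g \in t.2).
  case/blockT => _ gG _ _.
  by rewrite -[in LHS](invgK (_ ^+ j)%g) setactVin ?inE // groupV groupX.
rewrite {1}(dual_expand XY a) (bigID (basis_fixed G rG X)) /=; congr (_ + _).
transitivity (\sum_(t <- T) \sum_i \tr (a *m Y i) *: X i *+ block_mult p basis_act t i).
  rewrite exchange_big big_mkcond; apply: eq_bigr => i _ /=.
  by rewrite sumrMnr multT afix_basis_act mulrb.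
rewrite big_seq [RHS]big_seq; apply: eq_bigr => t tT; have [_ gG _ _] := blockT _ tT.
transitivity (\sum_(j < p) \sum_i
    \tr (a *m Y i) *: X i *+ (basis_act i (t.1.2 ^- j)%g \in t.2)).
  by rewrite exchange_big; apply: eq_bigr => i _ /=; rewrite sumrMnr.
apply: eq_bigr => j _.
rewrite rep_conj_dual_proj ?groupX // -rep_conj_comp ?groupV ?groupX // mulVg rep_conj1.
rewrite /dual_proj [RHS]big_mkcond; apply: eq_bigr => i _ /=.
by rewrite mem_setact_expg // mulrb.
Qed.

Lemma fixed_decomposition a : centmx rG G a -> exists T : seq 'M[k]_m,
  (forall b, b \in T -> maximal_trace p G rG b) /\
  a = \sum_(i | basis_fixed G rG X i) \tr (a *m Y i) *: X i + \sum_(b <- T) b.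
Proof.
move=> /centmxP ca; have [T [blockT decT]] := perm_decomposition.
exists [seq trace_pow p rG t.1.2 (dual_proj X Y t.2 a) | t <- T]; split=> [b|].
  case/mapP => t /blockT [mH gG gH projC] ->; apply: (MaximalTrace p mH) => // h hH.
  have hG := subsetP (proper_sub (maxgroupp mH)) _ hH.
  by apply/rep_conj_id => //; rewrite projC // ca.
rewrite {1}[a]decT big_map; congr (_ + _).
rewrite big_seq [RHS]big_seq; apply: eq_bigr => t /blockT [_ gG _ _].
by apply: eq_bigr => j _; rewrite ca ?groupV ?groupX.
Qed.

End PermutationBasis.

(** * Brauer homomorphisms from nilpotent elements *)

Definition admx (R : pzRingType) m (x b : 'M[R]_m) := x *m b - b *m x.

Section AdjointAction.
Variables (R : comPzRingType) (m : nat) (x : 'M[R]_m).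

Lemma admx_is_linear : linear (admx x).
Proof.
move=> c a b; rewrite /admx mulmxDr mulmxDl -scalemxAr -scalemxAl opprD addrACA.
by rewrite -scalerBr.
Qed.

HB.instance Definition _ := GRing.isLinear.Build _ _ _ _ (admx x) admx_is_linear.

Lemma iter_admxZ n c b : iter n (admx x) (c *: b) = c *: iter n (admx x) b.
Proof. by elim: n => // n IH; rewrite !iterS IH linearZ. Qed.

Lemma iter_admxE n b : iter n (admx x) b =
  \sum_(i < n.+1) ((-1) ^+ i * 'C(n, i)%:R) *: (x ^+ (n - i) *m b *m x ^+ i).
Proof.
elim: n => [|n IH].
  by rewrite big_ord1 /= bin0 mulr1 scale1r subn0 expr0 -[1]/(1%:M) mul1mx mulmx1.
rewrite iterS IH /admx mulmx_sumr mulmx_suml.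
rewrite [X in X - _]big_ord_recl [X in _ - X]big_ord_recr [RHS]big_ord_recl [in RHS]big_ord_recr /=.
rewrite !bin0 !binn !subnn !subn0 !expr0 !mulr1 !scale1r -[1]/(1%:M) !mul1mx !mulmx1.
rewrite -addrA; congr (_ + _); first by rewrite mulmxA mulmx_exprS.
rewrite opprD addrA; congr (_ + _); last first.
  by rewrite /bump /= add1n -scalemxAl -mulmxA mulmx_exprSr [(-1) ^+ n.+1]exprS mulN1r scaleNr.
rewrite -sumrB; apply: eq_bigr => i _.
rewrite /bump /= !add1n binS natrD mulrDr scalerDl.
rewrite -scalemxAr -scalemxAl !mulmxA mulmx_exprS -!mulmxA mulmx_exprSr.
rewrite subSS subnSK //; congr (_ + _).
by rewrite [(-1) ^+ i.+1]exprS mulN1r mulNr scaleNr.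
Qed.

Definition expmx_deriv n (b : 'M[R]_m) := \sum_(j < n) x ^+ j *m b *m x ^+ (n.-1 - j).

Lemma expmx_deriv_is_linear n : linear (expmx_deriv n).
Proof.
move=> c a b; rewrite /expmx_deriv scaler_sumr -big_split; apply: eq_bigr => i _ /=.
by rewrite mulmxDr mulmxDl -scalemxAr -scalemxAl.
Qed.

HB.instance Definition _ n :=
  GRing.isLinear.Build _ _ _ _ (expmx_deriv n) (expmx_deriv_is_linear n).

Lemma admx_expmx_deriv n b : admx x (expmx_deriv n b) = x ^+ n *m b - b *m x ^+ n.
Proof.
case: n => [|n]; first by rewrite /expmx_deriv big_ord0 raddf0 expr0 mul1mx mulmx1 subrr.
rewrite /admx /expmx_deriv mulmx_sumr mulmx_suml big_ord_recr [X in _ - X]big_ord_recl /=.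
rewrite subnn subn0 expr0 -[1]/(1%:M) mul1mx mulmx1 mulmxA mulmx_exprS -(mulmxA b) mulmx_exprSr.
rewrite [X in X - _]addrC [X in _ - X]addrC; set A := \sum_i _; set B := \sum_i _.
suff -> : B = A by rewrite addrKA.
apply: eq_bigr => i _; rewrite /bump add1n !mulmxA mulmx_exprS -!mulmxA mulmx_exprSr.
by rewrite subnSK.
Qed.

Lemma expmx_deriv_comm n b :
  x ^+ n *m b = 0 -> b *m x ^+ n = 0 -> comm_mx (expmx_deriv n b) x.
Proof.
move=> xb bx; apply/comm_mx_sym/eqP; rewrite -subr_eq0 -[_ - _]/(admx x _).
by rewrite admx_expmx_deriv xb bx subr0.
Qed.

Lemma expmx_deriv_admx n b : expmx_deriv n (admx x b) = admx x (expmx_deriv n b).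
Proof.
rewrite /expmx_deriv linear_sum; apply: eq_bigr => j _ /=; rewrite /admx.
rewrite mulmxBr mulmxBl !mulmxA mulmx_exprSr mulmx_exprS -!mulmxA.
by rewrite mulmx_exprSr mulmx_exprS.
Qed.

Lemma expmx_deriv_ker n r (v : 'M[R]_(r, m)) b :
  (0 < n)%N -> v *m x = 0 -> v *m expmx_deriv n b = v *m b *m x ^+ n.-1.
Proof.
case: n => // n _ vx; rewrite /expmx_deriv big_ord_recl mulmxDr expr0 -[1]/(1%:M) mul1mx subn0.
rewrite mulmx_sumr big1 ?addr0 ?mulmxA // => j _.
by rewrite lift0 -mulmx_exprS !mulmxA vx !mul0mx.
Qed.

Lemma expmx_deriv_mulr n a b : comm_mx b x ->
  expmx_deriv n a *m b = expmx_deriv n (a *m b).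
Proof.
move=> b_x; rewrite mulmx_suml; apply: eq_bigr => j _.
by rewrite -mulmxA -(comm_mxX _ b_x) !mulmxA.
Qed.

Lemma expmx_deriv_mull n a b : comm_mx b x ->
  b *m expmx_deriv n a = expmx_deriv n (b *m a).
Proof.
move=> b_x; rewrite mulmx_sumr; apply: eq_bigr => j _.
by rewrite !mulmxA -(comm_mxX j b_x).
Qed.

Lemma mxtrace_expmx_deriv n b : \tr (expmx_deriv n b) = \tr (x ^+ n.-1 *m b) *+ n.
Proof.
rewrite raddf_sum /= (eq_bigr (fun=> \tr (x ^+ n.-1 *m b))) => [|j _].
  by rewrite sumr_const card_ord.
rewrite mxtrace_mulC mulmxA mulmxE -exprD subnK // -ltnS prednK //.
exact: leq_ltn_trans (ltn_ord j).
Qed.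

Section Prime.
Variable p : nat.
Hypotheses (p_pr : prime p) (pR : p%:R = 0 :> R).

Lemma expmx_deriv_iter_admx b : expmx_deriv p b = iter p.-1 (admx x) b.
Proof.
rewrite iter_admxE /expmx_deriv prednK ?prime_gt0 //.
rewrite (reindex_inj rev_ord_inj) /=; apply: eq_bigr => i _.
rewrite sign_bin_pred // scale1r.
have -> : (p - i.+1 = p.-1 - i)%N by rewrite -{1}(prednK (prime_gt0 p_pr)) subSS.
by rewrite subKn // -ltnS prednK ?prime_gt0.
Qed.

End Prime.
End AdjointAction.

Lemma expmx_deriv_sub1 (R : comPzRingType) m p (x b : 'M[R]_m) :
  prime p -> p%:R = 0 :> R -> expmx_deriv (x - 1%:M) p b = expmx_deriv x p b.
Proof.
move=> p_pr pR; rewrite !expmx_deriv_iter_admx //; apply: eq_iter => c.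
by rewrite /admx mulmxBl mulmxBr mul1mx mulmx1 opprB addrA addrNK.
Qed.

Section Tate.
Variables (p : nat) (k : fieldType) (m : nat) (xi : 'M[k]_m).

(* The rows of R lift a basis of ker xi / im xi^(p-1), and P computes coordinates. *)
Record tate_basis l (R : 'M[k]_(l, m)) (P : 'M[k]_(m, l)) : Prop := TateBasis {
  tate_annul : R *m xi = 0;
  tate_dual : R *m P = 1%:M;
  tate_coord_im : xi ^+ p.-1 *m P = 0;
  tate_coord_ker : forall r (v : 'M[k]_(r, m)),
    v *m xi = 0 -> (v - v *m P *m R <= xi ^+ p.-1)%MS
}.

Lemma tate_basis_exists : (0 < p)%N -> xi ^+ p = 0 ->
  exists l (R : 'M[k]_(l, m)) P, tate_basis R P.
Proof.
move=> p0 xip; pose K := kermx xi; pose J := xi ^+ p.-1.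
have JK : (J <= K)%MS by apply/sub_kermxP; rewrite mulmxE -exprSr prednK.
pose C := (K :\: J)%MS.
have CJ : (C :&: J)%MS = 0 by apply: capmx_diff.
have CK : (C <= K)%MS by apply: diffmxSl.
pose R := row_base C; exists (\rank C), R, (proj_mx C J *m pinvmx R).
have RC : (R <= C)%MS by rewrite eq_row_base.
split.
- by apply/sub_kermxP; apply: submx_trans RC CK.
- apply: (row_free_inj (row_base_free C)).
  by rewrite /= mulmxA proj_mx_id // mul1mx mulmxKpV.
- by rewrite mulmxA proj_mx_0 // mul0mx.
move=> r v vxi; have vCJ : (v <= C + J)%MS.
  have vK : (v <= K)%MS by apply/sub_kermxP.
  apply: submx_trans vK _; rewrite -(addsmx_diff_cap_eq K J).
  by apply: addsmxS => //; apply: capmxSr.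
rewrite mulmxA mulmxKpV; last by rewrite eq_row_base proj_mx_sub.
by rewrite -{1}(add_proj_mx CJ vCJ) addrC addKr; apply: proj_mx_sub.
Qed.

Section TateMap.
Variables (l : nat) (R : 'M[k]_(l, m)) (P : 'M[k]_(m, l)).

Definition tate_map (a : 'M[k]_m) : 'M[k]_l := R *m a *m P.

Lemma tate_map_is_linear : linear tate_map.
Proof. by move=> c a b; rewrite /tate_map mulmxDr mulmxDl -scalemxAr -scalemxAl. Qed.

HB.instance Definition _ := GRing.isLinear.Build _ _ _ _ tate_map tate_map_is_linear.

Hypothesis RP : tate_basis R P.

Lemma tate_map1 : tate_map 1%:M = 1%:M.
Proof. by rewrite /tate_map mulmx1 (tate_dual RP). Qed.

Lemma tate_coord_act r (v : 'M[k]_(r, m)) a : v *m xi = 0 -> comm_mx a xi ->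
  v *m a *m P = v *m P *m tate_map a.
Proof.
move=> vxi a_xi; have /submxP [D e] := tate_coord_ker RP vxi.
rewrite -{1}[v](subrK (v *m P *m R)) e !mulmxDl -(mulmxA D) -(comm_mxX _ a_xi).
by rewrite (mulmxA D) -(mulmxA (D *m a)) (tate_coord_im RP) mulmx0 add0r /tate_map !mulmxA.
Qed.

Lemma tate_mapM a b : comm_mx a xi -> comm_mx b xi ->
  tate_map (a *m b) = tate_map a *m tate_map b.
Proof.
move=> a_xi b_xi; rewrite {1}/tate_map mulmxA tate_coord_act //.
by rewrite -mulmxA a_xi mulmxA (tate_annul RP) mul0mx.
Qed.

Lemma tate_map_expmx_deriv b : (0 < p)%N -> tate_map (expmx_deriv xi p b) = 0.
Proof.
move=> p0; rewrite /tate_map (expmx_deriv_ker _ p0 (tate_annul RP)).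
by rewrite -(mulmxA _ _ P) (tate_coord_im RP) mulmx0.
Qed.

Lemma tate_coord_eq0 r (v : 'M[k]_(r, m)) :
  v *m xi = 0 -> v *m P = 0 -> (v <= xi ^+ p.-1)%MS.
Proof. by move=> vxi vP; have := tate_coord_ker RP vxi; rewrite vP mul0mx subr0. Qed.

End TateMap.
End Tate.

Section BrauerMap.
Variables (p : nat) (gT : finGroupType) (k : fieldType) (m : nat).

(* Killing the traces from maximal subgroups suffices, by transitivity of the trace; the last
   two clauses make the kernel of beta on A^G exactly the trace ideal, and beta surjective. *)
Record brauer_map (G : {group gT}) (rho : gT -> 'M[k]_m) (I : finType) (X : I -> 'M[k]_m)
    l (beta : {linear 'M[k]_m -> 'M[k]_l}) : Prop := BrauerMap {
  brauer_map1 : beta 1%:M = 1%:M;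
  brauer_mapM : forall a b, centmx rho G a -> centmx rho G b -> beta (a *m b) = beta a *m beta b;
  brauer_map_trace : forall b, maximal_trace p G rho b -> beta b = 0;
  brauer_map_free : forall c : I -> k,
    \sum_(i | basis_fixed G rho X i) c i *: beta (X i) = 0 ->
    forall i, basis_fixed G rho X i -> c i = 0;
  brauer_map_span : forall b,
    exists c : I -> k, b = \sum_(i | basis_fixed G rho X i) c i *: beta (X i)
}.

Variables (G : {group gT}) (rG : mx_representation k G m) (I : finType) (X Y : I -> 'M[k]_m).
Hypotheses (pG : (p.-group G)%g) (XY : dual_bases X Y) (permX : perm_family G rG X).

Section OfBrauerMap.
Variables (l : nat) (beta : {linear 'M[k]_m -> 'M[k]_l}).
Hypothesis betaP : brauer_map G rG X beta.

Lemma brauer_map_ker a : centmx rG G a -> beta a = 0 ->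
  exists2 T : seq 'M[k]_m, forall b, b \in T -> maximal_trace p G rG b & a = \sum_(b <- T) b.
Proof.
move=> ca ba; have [T [TP aE]] := fixed_decomposition pG XY permX ca.
exists T => //; rewrite {1}aE big1 ?add0r // => i Xi.
rewrite (brauer_map_free betaP (c := fun i => \tr (a *m Y i)) _ Xi) ?scale0r //.
move: ba; rewrite {1}aE linearD /= linear_comb linear_sum big_seq.
by rewrite [X in _ + X]big1 ?addr0 // => b /TP; apply: brauer_map_trace betaP _.
Qed.

Lemma brauer_map_surj b : exists2 a, centmx rG G a & beta a = b.
Proof.
have [c ->] := brauer_map_span betaP b.
exists (\sum_(i | basis_fixed G rG X i) c i *: X i); last exact: linear_comb.
by apply: centmx_sum => i Xi; apply/centmxZ/basis_fixed_centmx.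
Qed.

End OfBrauerMap.
End BrauerMap.

Section NilpotentBrauerMap.
Variables (p : nat) (gT : finGroupType) (k : fieldType) (m : nat) (G : {group gT})
  (rG : mx_representation k G m) (I : finType) (X Y : I -> 'M[k]_m) (xi : 'M[k]_m)
  (l : nat) (R : 'M[k]_(l, m)) (P : 'M[k]_(m, l)).
Hypotheses (pG : (p.-group G)%g) (XY : dual_bases X Y) (permX : perm_family G rG X)
  (pk : p \in [pchar k]) (xip : xi ^+ p = 0) (RP : tate_basis p xi R P)
  (cent_xi : forall a, centmx rG G a -> comm_mx a xi)
  (trace_deriv : forall b, maximal_trace p G rG b -> exists c, b = expmx_deriv xi p c)
  (xi_cent : forall a, comm_mx a xi ->
     exists2 a0, centmx rG G a0 & exists a1, a = a0 + expmx_deriv xi p a1).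

Let p_pr : prime p. Proof. by case/andP: pk. Qed.
Let p_gt0 : (0 < p)%N. Proof. exact: prime_gt0. Qed.
Local Notation beta := (tate_map R P).

Lemma tate_map_maximal_trace b : maximal_trace p G rG b -> beta b = 0.
Proof. by case/trace_deriv => c ->; apply: tate_map_expmx_deriv RP _ p_gt0. Qed.

Lemma tate_map_fixed a : centmx rG G a ->
  beta a = \sum_(i | basis_fixed G rG X i) \tr (a *m Y i) *: beta (X i).
Proof.
move=> ca; have [T [TP {1}->]] := fixed_decomposition pG XY permX ca.
rewrite linearD /= linear_comb linear_sum big_seq [X in _ + X]big1 ?addr0 // => b /TP.
exact: tate_map_maximal_trace.
Qed.

Lemma tate_map_nondegenerate a : comm_mx a xi ->
  (forall b, comm_mx b xi -> \tr (a *m b) = 0) -> beta a = 0.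
Proof.
move=> a_xi tr_a; have [a0 ca0 [a1 aE]] := xi_cent a_xi.
have -> : beta a = beta a0.
  by rewrite aE linearD /= (tate_map_expmx_deriv RP) // addr0.
rewrite tate_map_fixed // big1 // => i Xi.
have cY : comm_mx (Y i) xi by apply/cent_xi/(dual_basis_fixed XY permX).
have := tr_a _ cY; rewrite aE mulmxDl mxtraceD expmx_deriv_mulr // mxtrace_expmx_deriv.
by rewrite -mulr_natr pcharf0 // mulr0 addr0 => ->; rewrite scale0r.
Qed.

Local Notation layer := (kermx_layer xi).
Local Notation empty_layer i := (layer i <= xi ^+ i.+1)%MS.

(* The derivative of x^(j+1) at xi in a direction of rank one pairing layers i and j commutes
   with xi and has trace zero against its whole commutant: beta kills it, by nondegeneracy of
   the trace form. *)
Lemma layer_concentrated i j : (i < j)%N -> (j.+1 < p)%N -> empty_layer i || empty_layer j.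
Proof.
move=> ij jp; apply: contraT; rewrite negb_or => /andP[/row_subPn [i' ni'] /row_subPn [j' nj']].
set w' := row i' _ in ni'; set w := row j' _ in nj'.
have w'_xi : w' *m xi = 0 by rewrite -row_mul kermx_layer_annul row0.
have w_xi : w *m xi = 0 by rewrite -row_mul kermx_layer_annul row0.
have /submxP [w0 ew] : (w <= xi ^+ j)%MS by apply: submx_trans (row_sub _ _) (capmxSl _ _).
have [f [xf w'f]] : exists f : 'cV[k]_m, xi ^+ j *m f = 0 /\ w' *m f = 1%:M.
  by apply: separating_col; apply: contra ni' => h; apply: submx_trans h (expmx_sub xi ij).
pose c := expmx_deriv xi j.+1 (f *m w0).
have c_xi : comm_mx c xi.
  apply: expmx_deriv_comm; first by rewrite mulmxA -mulmx_exprS -(mulmxA xi) xf mulmx0 mul0mx.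
  by rewrite -mulmxA -mulmx_exprSr (mulmxA w0) -ew w_xi mulmx0.
have ker_c r (v : 'M[k]_(r, m)) : v *m xi = 0 -> v *m c = v *m f *m w.
  by move=> v_xi; rewrite expmx_deriv_ker // !mulmxA -mulmxA -ew.
have bc : beta c = 0.
  apply: tate_map_nondegenerate => // d d_xi; apply: (mxtrace_layers0 pk xip).
    by apply/comm_mx_sym/comm_mxM; apply: comm_mx_sym.
  move=> t tp; rewrite mulmxA ker_c ?kermx_layer_annul //; have [tj|jt] := ltnP t j.
    rewrite -mulmxA ew -!mulmxA -(comm_mxX _ d_xi) !mulmxA.
    exact: submx_trans (submxMl _ _) (expmx_sub xi tj).
  have /submxP [V ->] : (layer t <= xi ^+ j)%MS.
    by apply: submx_trans (capmxSl _ _) (expmx_sub xi jt).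
  by rewrite -(mulmxA V) xf mulmx0 !mul0mx sub0mx.
have := tate_coord_act RP w'_xi c_xi; rewrite ker_c // w'f mul1mx bc mulmx0 => wP.
case/negP: nj'; apply: submx_trans (tate_coord_eq0 RP w_xi wP) (expmx_sub xi _).
by rewrite -ltnS prednK.
Qed.

Lemma kermx_layer_sub a b : (a <= b)%N -> (forall i, (a <= i < b)%N -> empty_layer i) ->
  (layer a <= xi ^+ b)%MS.
Proof.
elim: b => [|b IH]; first by rewrite leqn0 => /eqP -> _; apply: capmxSl.
rewrite leq_eqVlt ltnS => /orP [/eqP <- _|ab empty]; first exact: capmxSl.
apply: submx_trans (empty b _); last by rewrite ab ltnSn.
rewrite sub_capmx capmxSr andbT; apply: IH => // i /andP [ai ib].
by apply: empty; rewrite ai ltnS ltnW.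
Qed.

Lemma tate_coord_lift j : (layer j <= xi ^+ p.-1)%MS ->
  exists B, xi ^+ j *m B = 0 /\ R *m B = 1%:M.
Proof.
move=> layer_im; have [B RB] : exists B, R *m cokermx (xi ^+ j) *m B = 1%:M.
  apply/row_freeP; rewrite -kermx_eq0; apply/rowV0P => D /sub_kermxP.
  rewrite mulmxA => /eqP; rewrite -submxE => DR.
  have : (D *m R <= xi ^+ p.-1)%MS.
    apply: submx_trans layer_im; rewrite sub_capmx DR /=; apply/sub_kermxP.
    by rewrite -mulmxA (tate_annul RP) mulmx0.
  case/submxP => V eV.
  by rewrite -[D]mulmx1 -(tate_dual RP) mulmxA eV -mulmxA (tate_coord_im RP) mulmx0.
by exists (cokermx (xi ^+ j) *m B); rewrite (mulmxA R) (mulmxA (xi ^+ j)) mulmx_coker mul0mx.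
Qed.

Lemma tate_map_onto M : exists2 a, comm_mx a xi & beta a = M.
Proof.
have R_ker n : (layer 0 <= xi ^+ n)%MS -> (R <= xi ^+ n)%MS.
  move=> ker_n; apply: submx_trans ker_n; rewrite sub_capmx expr0 submx1 /=.
  exact/sub_kermxP/(tate_annul RP).
have [/existsP [j /andP[jp nj]]|] := boolP [exists j : 'I_p, (j.+1 < p)%N && ~~ empty_layer j].
  have empty i : (i.+1 < p)%N -> i != j -> empty_layer i.
    move=> ip; rewrite neq_ltn => /orP [ij|ji].
      by have := layer_concentrated ij jp; rewrite (negPf nj) orbF.
    by have := layer_concentrated ji ip; rewrite (negPf nj).
  have [W RW] : exists W, R = W *m xi ^+ j.
    apply/submxP/R_ker/kermx_layer_sub => // i /andP [_ ij].
    by apply: empty; [apply: leq_ltn_trans jp; apply: ltnW | rewrite ltn_eqF].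
  have [B [xB RB]] : exists B, xi ^+ j.+1 *m B = 0 /\ R *m B = 1%:M.
    apply/tate_coord_lift/kermx_layer_sub; first by rewrite -ltnS prednK.
    by move=> i /andP [ji ip]; apply: empty; rewrite ?gtn_eqF // -ltn_predRL.
  exists (expmx_deriv xi j.+1 (B *m M *m W)).
    apply: expmx_deriv_comm; first by rewrite !mulmxA xB !mul0mx.
    by rewrite -(mulmxA _ W) -mulmx_exprSr (mulmxA W) -RW (tate_annul RP) mulmx0.
  rewrite /tate_map (expmx_deriv_ker _ _ (tate_annul RP)) // !mulmxA RB mul1mx.
  by rewrite -(mulmxA M) -RW -mulmxA (tate_dual RP) mulmx1.
rewrite negb_exists => /forallP empty; exists 0; first exact: comm0mx.
have /submxP [D eD] : (R <= xi ^+ p.-1)%MS.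
  apply/R_ker/kermx_layer_sub => // i /andP [_ ip].
  have ip' : (i < p)%N by apply: leq_trans ip (leq_pred _).
  by have := empty (Ordinal ip'); rewrite /= -ltn_predRL ip negbK.
have one0 : 1%:M = 0 :> 'M[k]_l.
  by rewrite -(tate_dual RP) eD -mulmxA (tate_coord_im RP) mulmx0.
by rewrite raddf0 -[M]mul1mx one0 mul0mx.
Qed.

Lemma tate_map_free (c : I -> k) :
  \sum_(i | basis_fixed G rG X i) c i *: beta (X i) = 0 ->
  forall i, basis_fixed G rG X i -> c i = 0.
Proof.
rewrite -linear_comb; set a := \sum_(i | _) _ => ba i Xi.
have a_xi : comm_mx a xi.
  by apply/cent_xi/centmx_sum => j Xj; apply/centmxZ/basis_fixed_centmx.
have Y_xi : comm_mx (Y i) xi by apply/cent_xi/(dual_basis_fixed XY permX).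
rewrite -(dual_coord XY c Xi) -/a; apply: (mxtrace_layers0 pk xip).
  by apply/comm_mx_sym/comm_mxM; apply: comm_mx_sym.
move=> t tp; have U_xi := kermx_layer_annul xi t.
have Ua_xi : layer t *m a *m xi = 0 by rewrite -mulmxA a_xi mulmxA U_xi mul0mx.
have Ua_P : layer t *m a *m P = 0 by rewrite (tate_coord_act RP) // ba mulmx0.
have /submxP [V eV] := tate_coord_eq0 RP Ua_xi Ua_P.
rewrite mulmxA eV -mulmxA -(comm_mxX _ Y_xi) mulmxA.
by apply: submx_trans (submxMl _ _) (expmx_sub xi _); rewrite -ltnS prednK.
Qed.

Theorem tate_map_brauer : brauer_map p G rG X beta.
Proof.
split; [exact: tate_map1 RP| |exact: tate_map_maximal_trace|exact: tate_map_free|].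
  by move=> a b ca cb; apply: (tate_mapM RP); apply: cent_xi.
move=> M; have [a a_xi <-] := tate_map_onto M; have [a0 ca0 [a1 ->]] := xi_cent a_xi.
exists (fun i => \tr (a0 *m Y i)).
by rewrite linearD /= (tate_map_expmx_deriv RP) // addr0 tate_map_fixed.
Qed.

End NilpotentBrauerMap.

(** * Transitivity of the Brauer construction *)

Section CentralBrauerMap.
Variables (p : nat) (gT : finGroupType) (k : fieldType) (m : nat) (G Z : {group gT})
  (rG : mx_representation k G m) (I : finType) (X : I -> 'M[k]_m)
  (l : nat) (beta : {linear 'M[k]_m -> 'M[k]_l}).
Hypotheses (pG : (p.-group G)%g) (permX : perm_family G rG X)
  (sZG : Z \subset G) (centZ : forall g, g \in G -> centmx rG Z (rG g))
  (betaP : brauer_map p Z rG X beta).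

Let rZ := subg_repr rG sZG.

Lemma brauer_mx_repr : mx_repr G (fun g => beta (rG g)).
Proof.
split=> [|x y xG yG]; first by rewrite repr_mx1 (brauer_map1 betaP).
by rewrite repr_mxM // (brauer_mapM betaP) //; apply: centZ.
Qed.

Definition brauer_repr := MxRepresentation brauer_mx_repr.

Definition brauer_basis (i : {i | basis_fixed Z rG X i}) := beta (X (val i)).

Let fixed_centmx i : basis_fixed Z rG X i -> centmx rG Z (X i).
Proof. exact: (@basis_fixed_centmx _ _ _ _ _ rZ). Qed.

Lemma centmx_rep_conj g a : g \in G -> centmx rG Z a -> centmx rG Z (rep_conj rG g a).
Proof.
by move=> gG ca; apply: centmxM; [apply: centmxM => // |]; apply: centZ; rewrite ?groupV.
Qed.

Lemma centmx_brauer_repr (H : {set gT}) a : H \subset G ->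
  centmx rG Z a -> centmx rG H a -> centmx brauer_repr H (beta a).
Proof.
move=> sHG cZ ca h hH; have hG := subsetP sHG _ hH.
by rewrite /comm_mx /= -!(brauer_mapM betaP) ?ca //; apply: centZ.
Qed.

Lemma rep_conj_brauer_repr g a : g \in G -> centmx rG Z a ->
  rep_conj brauer_repr g (beta a) = beta (rep_conj rG g a).
Proof.
move=> gG ca; have cg := centZ gG; have cgV := centZ (groupVr gG).
by rewrite /rep_conj /= !(brauer_mapM betaP) //; apply: centmxM.
Qed.

Lemma basis_fixed_conj g i j : g \in G -> rep_conj rG g (X i) = X j ->
  basis_fixed Z rG X i -> basis_fixed Z rG X j.
Proof.
move=> gG e Xi; apply/forall_inP => z zZ; rewrite -e; apply/eqP.
by apply/(@rep_conj_id _ _ _ _ rZ) => //; apply: centmx_rep_conj (fixed_centmx Xi) z zZ.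
Qed.

Lemma perm_family_brauer : perm_family G brauer_repr brauer_basis.
Proof.
move=> g [i Xi] gG; have [j e] := permX i gG.
exists (Sub j (basis_fixed_conj gG e Xi)).
by rewrite /brauer_basis /= rep_conj_brauer_repr ?e //; apply: fixed_centmx.
Qed.

Lemma brauer_basis_inj : injective brauer_basis.
Proof.
move=> [i Xi] [j Xj] /= e; apply/eqP; rewrite -val_eqE; apply: contraT => /= ne.
pose c x : k := (x == i)%:R - (x == j)%:R.
have sum_delta x0 : basis_fixed Z rG X x0 ->
    \sum_(x | basis_fixed Z rG X x) (x == x0)%:R *: beta (X x) = beta (X x0).
  move=> X0; rewrite (bigD1 x0) //= eqxx scale1r big1 ?addr0 // => x /andP[_ /negPf ->].
  by rewrite scale0r.
have /(brauer_map_free betaP)/(_ i Xi) : \sum_(x | basis_fixed Z rG X x) c x *: beta (X x) = 0.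
  by under eq_bigr do rewrite scalerBl; rewrite sumrB !sum_delta // -[X in X - _]/(brauer_basis
     (exist _ i Xi)) e subrr.
by rewrite /c eqxx (negPf ne) subr0 => /eqP; rewrite oner_eq0.
Qed.

Lemma basis_fixed_brauer i : basis_fixed G brauer_repr brauer_basis i = basis_fixed G rG X (val i).
Proof.
case: i => i Xi; apply: eq_forallb => g /=; case gG: (g \in G) => //=.
have [j e] := permX i gG; have Xj := basis_fixed_conj gG e Xi.
rewrite /brauer_basis /= rep_conj_brauer_repr ?e //; last exact: fixed_centmx.
apply/eqP/eqP => [h|-> //].
by have := @brauer_basis_inj (exist _ j Xj) (exist _ i Xi) h => /(congr1 val) /= ->.
Qed.

Lemma basis_fixedS i : basis_fixed G rG X i -> basis_fixed Z rG X i.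
Proof. by move=> /forall_inP Xi; apply/forall_inP => z /(subsetP sZG); apply: Xi. Qed.

Lemma sum_basis_fixed_brauer n (c : I -> k) (F : I -> 'M[k]_n) :
  \sum_(i | basis_fixed G rG X i) c i *: F i =
  \sum_(i | basis_fixed G brauer_repr brauer_basis i) c (val i) *: F (val i).
Proof.
rewrite (eq_bigl (fun i => (i \in basis_fixed Z rG X) && basis_fixed G rG X i)) => [|i].
  by rewrite big_sub_cond; apply: eq_bigl => i; rewrite basis_fixed_brauer.
by apply/idP/andP => [Xi|[]//]; split=> //; apply: basis_fixedS.
Qed.

Lemma sum_brauer_basis (c : I -> k) :
  \sum_(i | basis_fixed Z rG X i) c i *: beta (X i) = \sum_i c (val i) *: brauer_basis i.
Proof. by rewrite (big_sub (basis_fixed Z rG X)). Qed.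

Lemma coeff_extension (c : {i | basis_fixed Z rG X i} -> k) :
  exists c' : I -> k, forall i, c' (val i) = c i.
Proof. by exists (fun i => if insub i is Some j then c j else 0) => i; rewrite valK. Qed.

Lemma dual_bases_brauer : exists Y', dual_bases brauer_basis Y'.
Proof.
apply: dual_bases_exists => [c h i|b].
  have [c' c'E] := coeff_extension c; rewrite -c'E; apply: (brauer_map_free betaP) (valP i).
  by rewrite sum_brauer_basis -[RHS]h; apply: eq_bigr => j _; rewrite c'E.
have [c ->] := brauer_map_span betaP b.
by rewrite sum_brauer_basis; exists (fun i => c (val i)).
Qed.

(* The image of z is central in the matrix algebra spanned by the fixed basis, hence a scalar
   of order dividing p. *)
Lemma brauer_repr_exp_p z : p \in [pchar k] -> z \in Z -> rG z ^+ p = 1 ->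
  brauer_repr z = 1%:M.
Proof.
move=> pk zZ zp; have zG := subsetP sZG _ zZ; have p_pr : prime p by case/andP: pk.
have /is_scalar_mxP [c zc] : is_scalar_mx (brauer_repr z).
  apply: comm_mx_all_scalar => b; have [d ->] := brauer_map_span betaP b.
  apply: comm_mx_sum => i Xi; apply: comm_mxZ; have cX := fixed_centmx Xi.
  by rewrite /comm_mx /= -!(brauer_mapM betaP) ?cX //; apply: centZ.
have : (brauer_repr z - 1) ^+ p = 0.
  apply: (expr_sub1_prime p_pr); first by apply/natmx_eq0/pcharf0.
  rewrite -repr_mx_expg //= repr_mx_expg // zp; exact: brauer_map1 betaP.
rewrite zc -[X in _ - X]scale1r -[c%:M]scalemx1 -[1%:M]/(1 : 'M_l) -scalerBl.
rewrite exprZmx expr1n => /eqP.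
rewrite scalemx_eq0 expf_eq0 subr_eq0 => /orP [/andP [_ /eqP ->]|/eqP one0].
  by rewrite scale1r.
by rewrite one0 scaler0.
Qed.

Lemma rker_brauer_repr z : p \in [pchar k] -> z \in Z -> rG z != 1%:M -> rG z ^+ p = 1 ->
  rker rG \proper rker brauer_repr.
Proof.
move=> pk zZ z1 zp; have zG := subsetP sZG _ zZ; apply/properP; split.
  apply/subsetP => x /rkerP [xG x1]; apply/rkerP; split=> //=.
  by rewrite x1 (brauer_map1 betaP).
exists z; first by apply/rkerP; split; last exact: brauer_repr_exp_p.
by apply/rkerP => -[_ /eqP]; rewrite (negPf z1).
Qed.

Lemma comp_brauer_map l2 (beta2 : {linear 'M[k]_l -> 'M[k]_l2}) :
  brauer_map p G brauer_repr brauer_basis beta2 -> brauer_map p G rG X (beta2 \o beta).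
Proof.
move=> beta2P; split=> /= [|a b ca cb|b|c c0 i Xi|b].
- by rewrite (brauer_map1 betaP) (brauer_map1 beta2P).
- have cZa := centmxS sZG ca; have cZb := centmxS sZG cb.
  by rewrite (brauer_mapM betaP) // (brauer_mapM beta2P) //; apply: centmx_brauer_repr.
- case=> M g a mM gG gM ca.
  have sMG := proper_sub (maxgroupp mM).
  have [sZM|/subsetPn [z zZ zM]] := boolP (Z \subset M).
    have cZa := centmxS sZM ca.
    have -> : beta (trace_pow p rG g a) = trace_pow p brauer_repr g (beta a).
      by rewrite /trace_pow linear_sum; apply: eq_bigr => j _; rewrite rep_conj_brauer_repr ?groupX.
    by apply/(brauer_map_trace beta2P)/(MaximalTrace p mM) => //; apply: centmx_brauer_repr.
  have zG := subsetP sZG _ zZ; rewrite (trace_pow_indep pG mM gG gM zG zM ca).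
  rewrite (brauer_map_trace betaP) ?linear0 //; apply: (@MaximalTrace p _ _ _ _ _ (Z :&: M)) => //.
  + by apply: maximal_cap pG sZG mM _; apply/subsetPn; exists z.
  + by rewrite inE negb_and zM orbT.
  by apply: centmxS ca; apply: subsetIr.
- move: c0; rewrite (sum_basis_fixed_brauer c (fun i => beta2 (beta (X i)))) => c0.
  have := brauer_map_free beta2P c0 (i := Sub i (basis_fixedS Xi)).
  by rewrite basis_fixed_brauer /= => /(_ Xi).
have [c ->] := brauer_map_span beta2P b; have [c' c'E] := coeff_extension c; exists c'.
rewrite (sum_basis_fixed_brauer c' (fun i => beta2 (beta (X i)))).
by apply: eq_bigr => i _; rewrite c'E.
Qed.

End CentralBrauerMap.

Section CentralDescent.
Variables (p : nat) (gT : finGroupType) (k : fieldType) (G : {group gT}).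
Hypotheses (pk : p \in [pchar k]) (pG : (p.-group G)%g).

Let p_pr : prime p. Proof. by case/andP: pk. Qed.

Lemma central_exp_p_element m (rG : mx_representation k G m) : ~~ (G \subset rker rG) ->
  exists z, [/\ z \in G, rG z != 1%:M, rG z ^+ p = 1 &
    forall g, g \in G -> comm_mx (rG g) (rG z)].
Proof.
move=> nKG; pose K := rker_group rG; have nKG' : G \subset 'N(K)%g := rker_norm rG.
have pQ : (p.-group (G / K))%g by apply: quotient_pgroup.
have ntZ : 'Z(G / K)%g != 1%g.
  by rewrite center_nil_eq1 ?(pgroup_nil pQ) // -subG1 quotient_sub1.
have [_ dvp _] := pgroup_pdiv (pgroupS (center_sub _) pQ) ntZ.
have [x xZ ox] := Cauchy p_pr dvp.
have /centerP [/morphimP [z zN zG ex] xC] := xZ.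
have rK y : y \in K -> rG y = 1%:M by case/rkerP.
exists z; split=> //.
- apply/eqP => z1; have zK : z \in K by apply/rkerP.
  by move: ox; rewrite ex /= coset_id // order1 => p1; move: p_pr; rewrite -p1.
- rewrite -repr_mx_expg //; apply/rK/coset_idr; first exact: groupX.
  by rewrite morphX //= -[coset K z]ex -ox expg_order.
move=> g gG; have gN := subsetP nKG' _ gG.
have gzK : [~ g, z]%g \in K.
  apply: coset_idr; first by rewrite groupR.
  rewrite morphR //= -[coset K z]ex; apply/eqP/commgP.
  by apply/commute_sym/xC/mem_quotient.
rewrite /comm_mx -!repr_mxM // commgC (repr_mxM _ (groupM zG gG) (groupR gG zG)).
by rewrite (rK _ gzK) mulmx1.
Qed.

Variable P : forall m, mx_representation k G m -> forall I : finType, (I -> 'M[k]_m) -> Prop.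

(* Induction on the order of G / rker rG, along the Brauer constructions for central
   subgroups Z containing an element z of order p modulo the kernel. *)
Lemma central_descent :
  (forall m (rG : mx_representation k G m) (I : finType) (X Y : I -> 'M[k]_m),
     dual_bases X Y -> G \subset rker rG -> P rG X) ->
  (forall m (rG : mx_representation k G m) (I : finType) (X Y : I -> 'M[k]_m) z,
     dual_bases X Y -> perm_family G rG X -> z \in G -> rG z ^+ p = 1 ->
     (forall g, g \in G -> comm_mx (rG g) (rG z)) ->
     exists (Z : {group gT}) (sZG : Z \subset G)
       (centZ : forall g, g \in G -> centmx rG Z (rG g)) l
       (beta : {linear 'M[k]_m -> 'M[k]_l}) (betaP : brauer_map p Z rG X beta),
       z \in Z /\ (P (brauer_repr centZ betaP)
         (brauer_basis (Z := Z) (rG := rG) (X := X) beta) -> P rG X)) ->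
  forall m (rG : mx_representation k G m) (I : finType) (X Y : I -> 'M[k]_m),
    dual_bases X Y -> perm_family G rG X -> P rG X.
Proof.
move=> trivial_case central_case m rG; have [n] := ubnP (#|G| - #|rker rG|).
elim: n m rG => // n IH m rG ltn I X Y XY permX.
have [kG|/central_exp_p_element [z [zG z1 zp zC]]] := boolP (G \subset rker rG).
  exact: trivial_case XY kG.
have [Z [sZG [centZ [l [beta [betaP [zZ]]]]]]] := central_case _ _ _ _ _ _ XY permX zG zp zC.
apply; have [Y' XY'] := dual_bases_brauer betaP.
have ker_lt := rker_brauer_repr sZG centZ betaP pk zZ z1 zp.
apply: IH XY' _; last exact: perm_family_brauer.
have kerG : (#|rker rG| < #|G|)%N.
  exact: leq_trans (proper_card ker_lt) (subset_leq_card (rstab_sub _ _)).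
by rewrite -ltnS; apply: leq_trans ltn; rewrite ltnS ltn_sub2l // proper_card.
Qed.

End CentralDescent.

Lemma brauer_map_trivial p (gT : finGroupType) (k : fieldType) (G : {group gT}) m
    (rG : mx_representation k G m) (I : finType) (X Y : I -> 'M[k]_m) :
  p \in [pchar k] -> dual_bases X Y -> G \subset rker rG -> brauer_map p G rG X idfun.
Proof.
move=> pk XY /subsetP kG.
have conj_id g a : g \in G -> rep_conj rG g a = a.
  by move=> gG; apply/rep_conj_id => //; have /rkerP [_ ->] := kG g gG; apply: comm1mx.
have fixed i : basis_fixed G rG X i by apply/forall_inP => g gG; rewrite conj_id.
split=> // [_ [H g a _ gG _ _]|c c0 i Xi|b] /=.
- rewrite /trace_pow (eq_bigr (fun=> a)) => [|j _]; last by rewrite conj_id ?groupX.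
  by rewrite sumr_const card_ord -scaler_nat pcharf0 // scale0r.
- by rewrite -(dual_coord XY c Xi) c0 mul0mx raddf0.
exists (fun i => \tr (b *m Y i)); rewrite {1}(dual_expand XY b).
by apply: eq_bigl => i; rewrite fixed.
Qed.

Section ExistenceOfBrauerMaps.
Variables (p : nat) (gT : finGroupType) (k : fieldType) (G : {group gT}).
Hypotheses (pk : p \in [pchar k]) (pG : (p.-group G)%g).

Let p_pr : prime p. Proof. by case/andP: pk. Qed.

Lemma trace_pow_expmx_deriv m (rG : mx_representation k G m) z a :
  z \in G -> rG z ^+ p = 1 -> trace_pow p rG z a = expmx_deriv (rG z) p (rG z *m a).
Proof.
move=> zG zp; rewrite /trace_pow /expmx_deriv (reindex_inj rev_ord_inj) /=.
apply: eq_bigr => j _; rewrite /rep_conj repr_mx_expg //.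
have -> : (p - j.+1 = p.-1 - j)%N by rewrite -subn1 subnAC subn1 -subnS.
congr (_ *m _); rewrite mulmxA; congr (_ *m _); rewrite mulmx_exprSr.
have jp : (j <= p.-1)%N by rewrite -ltnS prednK ?prime_gt0.
have inv_zj : rG (z ^+ (p.-1 - j))%g *m rG z ^+ j.+1 = 1%:M.
  by rewrite repr_mx_expg // mulmxE -exprD addnS subnK // prednK ?prime_gt0.
by rewrite -[LHS]mulmx1 -inv_zj mulmxA repr_mulVmx ?groupX // mul1mx.
Qed.

Lemma brauer_map_cyclic m (rG : mx_representation k G m) (I : finType) (X Y : I -> 'M[k]_m) z :
  dual_bases X Y -> perm_family G rG X -> z \in G -> rG z ^+ p = 1 ->
  exists l (beta : {linear 'M[k]_m -> 'M[k]_l}), brauer_map p <[z]>%G rG X beta.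
Proof.
move=> XY permX zG zp; have sZG : (<[z]> \subset G)%g by rewrite cycle_subG.
pose rZ := subg_repr rG sZG; pose xi := rG z - 1%:M.
have permZ : perm_family <[z]>%G rZ X by move=> g i /(subsetP sZG); apply: permX.
have xip : xi ^+ p = 0 by apply: expr_sub1_prime zp; last exact/natmx_eq0/pcharf0.
have [l [R [P RP]]] := tate_basis_exists (prime_gt0 p_pr) xip.
exists l, (tate_map R P); apply: (tate_map_brauer (rG := rZ) _ XY permZ pk xip RP).
- exact: pgroupS sZG pG.
- by move=> a /(_ z (cycle_id z)) ca; apply/comm_mxB; [apply: comm_mx_sym | apply: comm_mx1].
- move=> _ [H g a mH gZ gH ca]; exists (rG z *m a).
  have zH : z \notin H by apply: contra gH => zH; apply: subsetP gZ; rewrite cycle_subG.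
  rewrite (trace_pow_indep (pgroupS sZG pG) mH gZ gH (cycle_id z) zH ca).
  by rewrite expmx_deriv_sub1 ?pcharf0 // trace_pow_expmx_deriv.
move=> a a_xi; exists a; last by exists 0; rewrite raddf0 addr0.
have az : comm_mx a (rG z).
  by rewrite -[rG z](subrK 1%:M); apply: comm_mxD => //; apply: comm_mx1.
by move=> _ /cycleP [j ->]; rewrite /= repr_mx_expg //; apply/comm_mx_sym/comm_mxX.
Qed.

Theorem brauer_map_exists m (rG : mx_representation k G m) (I : finType) (X Y : I -> 'M[k]_m) :
  dual_bases X Y -> perm_family G rG X ->
  exists l (beta : {linear 'M[k]_m -> 'M[k]_l}), brauer_map p G rG X beta.
Proof.
apply: (central_descent pk pG (P := fun m rG I X =>
  exists l (beta : {linear 'M[k]_m -> 'M[k]_l}), brauer_map p G rG X beta)) =>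
  {}m {}rG {}I {}X {}Y => [XY kG|z XY permX zG zp zC].
  by exists m, idfun; apply: brauer_map_trivial XY kG.
have sZG : (<[z]> \subset G)%g by rewrite cycle_subG.
have centZ g : g \in G -> centmx rG <[z]>%g (rG g).
  by move=> /zC gz _ /cycleP [j ->]; rewrite repr_mx_expg //; apply/comm_mx_sym/comm_mxX.
have [l [beta betaP]] := brauer_map_cyclic XY permX zG zp.
exists <[z]>%G, sZG, centZ, l, beta, betaP; split=> [|[l2 [beta2 beta2P]]]; first exact: cycle_id.
by exists l2, (beta2 \o beta); apply: comp_brauer_map beta2P.
Qed.

End ExistenceOfBrauerMaps.

(** * Generic elements *)

Section GenericElement.
Variables (R : comPzRingType) (n m : nat).
Implicit Types (x : 'I_n -> R) (c d : 'I_n -> 'M[R]_m).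

Definition generic_elt x c := \sum_i x i *: (c i - 1%:M).

Definition generic_op x c d (b : 'M[R]_m) := \sum_i x i *: (d i *m b *m c i - b).

Lemma comm_generic_elt a x c : (forall i, comm_mx a (c i)) -> comm_mx a (generic_elt x c).
Proof.
by move=> a_c; apply: comm_mx_sum => i _; apply/comm_mxZ/comm_mxB => //; apply: comm_mx1.
Qed.

Lemma generic_opZ x c d t b : generic_op x c d (t *: b) = t *: generic_op x c d b.
Proof.
rewrite /generic_op scaler_sumr; apply: eq_bigr => i _.
by rewrite -scalemxAr -scalemxAl -scalerBr scalerA mulrC -scalerA.
Qed.

Lemma iter_generic_opZ j x c d t b :
  iter j (generic_op x c d) (t *: b) = t *: iter j (generic_op x c d) b.
Proof. by elim: j => // j IH; rewrite !iterS IH generic_opZ. Qed.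

Lemma generic_elt_exp p x c : prime p -> p%:R = 0 :> R ->
  (forall i j, comm_mx (c i) (c j)) -> (forall i, c i ^+ p = 1) -> generic_elt x c ^+ p = 0.
Proof.
move=> p_pr pR c_comm cp; have pM := natmx_eq0 m pR.
rewrite /generic_elt (expr_sum_comm_prime p_pr pM) => [|i j].
  by rewrite big1 // => i _; rewrite exprZmx (expr_sub1_prime p_pr pM) // scaler0.
have comm_sub1 a b : comm_mx a b -> comm_mx a (b - 1%:M).
  by move=> ab; apply: comm_mxB => //; apply: comm_mx1.
apply/comm_mxZ/comm_mx_sym/comm_mxZ; apply/comm_sub1/comm_mx_sym/comm_sub1.
exact: c_comm.
Qed.

End GenericElement.

Lemma map_generic_elt (R S : comPzRingType) (f : {rmorphism R -> S}) n m (x : 'I_n -> R)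
    (c : 'I_n -> 'M[R]_m) :
  map_mx f (generic_elt x c) = generic_elt (f \o x) (map_mx f \o c).
Proof.
rewrite /generic_elt raddf_sum; apply: eq_bigr => i _ /=.
by rewrite map_mxZ map_mxB map_mx1.
Qed.

Lemma map_generic_op (R S : comPzRingType) (f : {rmorphism R -> S}) n m (x : 'I_n -> R)
    (c d : 'I_n -> 'M[R]_m) b :
  map_mx f (generic_op x c d b) =
  generic_op (f \o x) (map_mx f \o c) (map_mx f \o d) (map_mx f b).
Proof.
rewrite /generic_op raddf_sum; apply: eq_bigr => i _ /=.
by rewrite map_mxZ map_mxB !map_mxM.
Qed.

Section GenericDerivative.
Variables (p : nat) (k : fieldType) (m n : nat) (x : 'I_n -> k) (h : 'I_n -> 'M[k]_m)
  (g : 'M[k]_m) (chi : 'I_n -> nat).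
Hypotheses (pk : p \in [pchar k]) (hp : forall i, h i ^+ p = 1) (gp : g ^+ p = 1)
  (hg : forall i, comm_mx (h i) g) (hh : forall i j, comm_mx (h i) (h j)).

Let p_pr : prime p. Proof. by case/andP: pk. Qed.
Let xi := generic_elt x (fun i => h i *m g ^+ chi i).
Let weight := \sum_i x i * (chi i)%:R.
Local Notation h_invariant b := (forall i, comm_mx (h i) b).

(* On h-invariant matrices, [xi, .] is the composite of the commuting operators [g, .] and
   ad_ratio, and the p-th power of ad_ratio is multiplication by weight^p. *)
Definition ad_ratio (b : 'M[k]_m) := \sum_i x i *: (h i *m expmx_deriv g (chi i) b).

Lemma h_invariant_admx b : h_invariant b -> h_invariant (admx g b).
Proof. by move=> cb i; apply: comm_mxB; apply: comm_mxM. Qed.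

Lemma h_invariant_ad_ratio b : h_invariant b -> h_invariant (ad_ratio b).
Proof.
move=> cb i; apply: comm_mx_sum => j _; apply/comm_mxZ/comm_mxM => //.
by apply: comm_mx_sum => t _; do !apply: comm_mxM => //; apply: comm_mxX.
Qed.

Lemma admx_generic_elt b : h_invariant b -> admx xi b = ad_ratio (admx g b).
Proof.
move=> cb; rewrite /admx /xi /generic_elt /ad_ratio mulmx_suml mulmx_sumr -sumrB.
apply: eq_bigr => i _; rewrite -scalemxAl -scalemxAr -scalerBr; congr (_ *: _).
rewrite mulmxBl mulmxBr mul1mx mulmx1 opprB addrA addrNK.
by rewrite -/(admx g b) expmx_deriv_admx admx_expmx_deriv mulmxBr !mulmxA cb.
Qed.

Lemma ad_ratio_admx b : ad_ratio (admx g b) = admx g (ad_ratio b).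
Proof.
rewrite /ad_ratio linear_sum; apply: eq_bigr => i _ /=; rewrite linearZ /=; congr (_ *: _).
by rewrite expmx_deriv_admx /admx mulmxBr !mulmxA hg.
Qed.

Let lmul (a : 'M[k]_m) : 'M[k]_(m * m) := lin_mulmx a.
Let rmul (a : 'M[k]_m) : 'M[k]_(m * m) := lin_mulmxr a.

Let term i j := lmul (g ^+ j) * rmul (g ^+ ((chi i).-1 - j)) * lmul (h i).

Let term_comm i j i' j' : GRing.comm (term i j) (term i' j').
Proof.
have gg s t : comm_mx (g ^+ s) (g ^+ t) by apply/comm_mxX/comm_mx_sym/comm_mxX.
have hgX s t : comm_mx (h s) (g ^+ t) by apply/comm_mxX/hg.
have lr a b : GRing.comm (lmul a) (rmul b) := lin_mulmx_mulmxr_comm a b.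
have ll a b : comm_mx a b -> GRing.comm (lmul a) (lmul b) := @lin_mulmx_comm _ _ a b.
have rr a b : comm_mx a b -> GRing.comm (rmul a) (rmul b) := @lin_mulmxr_comm _ _ a b.
rewrite /term; do !apply: commrM; apply/commr_sym; do !apply: commrM.
- exact/ll/gg.
- exact: lr.
- exact/ll/comm_mx_sym/hgX.
- exact/commr_sym/lr.
- exact/rr/gg.
- exact/commr_sym/lr.
- exact/ll/hgX.
- exact: lr.
exact/ll/hh.
Qed.

Let term_exp i j : term i j ^+ p = 1.
Proof.
have lr a b : GRing.comm (lmul a) (rmul b) := lin_mulmx_mulmxr_comm a b.
have exp1 (a : 'M[k]_m) s : a ^+ p = 1 -> (a ^+ s) ^+ p = 1.
  by move=> ap; rewrite -exprM mulnC exprM ap expr1n.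
rewrite /term !exprMn_comm //.
  by rewrite -!lin_mulmxX -lin_mulmxrX !exp1 // hp lin_mulmx1 lin_mulmxr1 !mulr1.
apply/commr_sym/commrM; last exact: lr.
by apply/lin_mulmx_comm/comm_mxX/hg.
Qed.

Let ad_ratio_mx := \sum_i x i *: \sum_(j < chi i) term i j.

Let mul_ad_ratio_mx b : mxvec b *m ad_ratio_mx = mxvec (ad_ratio b).
Proof.
rewrite /ad_ratio_mx /ad_ratio mulmx_sumr linear_sum /=; apply: eq_bigr => i _.
rewrite -scalemxAr [RHS]linearZ /=; congr (_ *: _).
rewrite mulmx_sumr mulmx_sumr linear_sum /=; apply: eq_bigr => j _.
by rewrite /term -!mulmxE (mulmxA (mxvec b)) (mulmxA (mxvec b)) !mul_vec_lin.
Qed.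

Let weight_exp : weight ^+ p = \sum_i x i ^+ p * (chi i)%:R.
Proof.
have pR := pcharf0 pk; rewrite /weight (expr_sum_comm_prime p_pr pR) => [|*]; last exact: mulrC.
apply: eq_bigr => i _; rewrite exprMn; congr (_ * _).
have -> : (chi i)%:R = \sum_(j < chi i) 1 :> k by rewrite sumr_const card_ord.
by rewrite (expr_sum_comm_prime p_pr pR) //; apply: eq_bigr => j _; rewrite expr1n.
Qed.

Let ad_ratio_mx_exp : ad_ratio_mx ^+ p = (weight ^+ p)%:M.
Proof.
have pM := natmx_eq0 (m * m) (pcharf0 pk).
rewrite /ad_ratio_mx (expr_sum_comm_prime p_pr pM) => [|i i'].
  rewrite weight_exp raddf_sum; apply: eq_bigr => i _ /=.
  rewrite exprZmx (expr_sum_comm_prime p_pr pM) => [|j j']; last exact: term_comm.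
  rewrite (eq_bigr (fun=> 1)) => [|j _]; last exact: term_exp.
  by rewrite sumr_const card_ord -[1]/(1%:M) -raddfMn /= scale_scalar_mx.
apply/comm_mxZ/comm_mx_sym/comm_mxZ; apply: comm_mx_sum => j _.
by apply/comm_mx_sym/comm_mx_sum => j' _; apply: term_comm.
Qed.

Lemma iter_ad_ratio_p b : iter p ad_ratio b = weight ^+ p *: b.
Proof.
have iterE s : mxvec (iter s ad_ratio b) = mxvec b *m ad_ratio_mx ^+ s.
  elim: s => [|s IH]; first by rewrite expr0 mulmx1.
  by rewrite iterS -mul_ad_ratio_mx IH exprSr mulmxA.
have := iterE p; rewrite ad_ratio_mx_exp mul_mx_scalar => /(congr1 vec_mx).
by rewrite linearZ /= !mxvecK.
Qed.

Lemma expmx_deriv_generic a : weight != 0 -> h_invariant a ->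
  exists b, expmx_deriv g p a = expmx_deriv xi p b.
Proof.
move=> weight0 ca; pose b s := iter s ad_ratio a.
have cb s : h_invariant (b s) by elim: s => // s IH; apply: h_invariant_ad_ratio.
have cad r s : h_invariant (iter r (admx g) (b s)).
  by elim: r => [|r IH] /=; [apply: cb | apply: h_invariant_admx].
have ratio_iter r s : ad_ratio (iter r (admx g) (b s)) = iter r (admx g) (b s.+1).
  by elim: r => // r IH; rewrite !iterS ad_ratio_admx IH.
have iter_admx_xi s t : iter s (admx xi) (b t) = iter s (admx g) (b (s + t)%N).
  elim: s => // s IH; rewrite !iterS IH admx_generic_elt //.
  by rewrite ad_ratio_admx ratio_iter.
have b_mulp q : b (p * q)%N = weight ^+ (p * q) *: a.
  elim: q => [|q IH]; first by rewrite muln0 scale1r.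
  by rewrite mulnS /b iterD -/(b _) iter_ad_ratio_p IH scalerA -exprD.
exists ((weight ^+ (p * p.-1))^-1 *: b (p.-1 * p.-1)%N).
rewrite !(expmx_deriv_iter_admx _ p_pr (pcharf0 pk)) iter_admxZ iter_admx_xi.
have -> : (p.-1 + p.-1 * p.-1 = p * p.-1)%N by rewrite -mulSn prednK ?prime_gt0.
by rewrite b_mulp iter_admxZ scalerA mulVf ?scale1r // expf_neq0.
Qed.

End GenericDerivative.

Section ElementaryRepresentations.
Variables (p : nat) (gT : finGroupType) (k : fieldType) (n : nat) (Z : {group gT})
  (zs : 'I_n -> gT).

Record elementary_rep m (rZ : mx_representation k Z m) : Prop := ElementaryRep {
  elementary_exp : forall z, z \in Z -> rZ z ^+ p = 1;
  elementary_comm : {in Z &, forall y z, comm_mx (rZ y) (rZ z)};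
  elementary_image : forall z, z \in Z -> exists i, rZ z = rZ (zs i)
}.

Section PermutationModule.
Variables (m : nat) (rZ : mx_representation k Z m).

(* Locked because unfolding lin_mulmx makes unification diverge. *)
Definition conj_mx (g : gT) : 'M[k]_(m * m) :=
  locked (lin_mulmx (rZ g^-1%g) *m lin_mulmxr (rZ g)).

Lemma mxvec_conj_mx g b : mxvec b *m conj_mx g = mxvec (rep_conj rZ g b).
Proof. by rewrite /conj_mx -lock mulmxA !mul_vec_lin. Qed.

Lemma conj_mx_repr : mx_repr Z conj_mx.
Proof.
split=> [|y z yZ zZ]; apply: mxvec_ext => b; first by rewrite mxvec_conj_mx rep_conj1 mulmx1.
by rewrite mulmxA !mxvec_conj_mx rep_conj_comp.
Qed.

Definition conj_repr := MxRepresentation conj_mx_repr.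

Lemma conj_repr_elementary :
  (forall i, zs i \in Z) -> elementary_rep rZ -> elementary_rep conj_repr.
Proof.
move=> zsZ rZ_elem; split=> [z zZ|y z yZ zZ|z zZ].
- rewrite -repr_mx_expg //; apply: mxvec_ext => b; rewrite mxvec_conj_mx mulmx1.
  congr mxvec; apply/rep_conj_id; first exact: groupX.
  by rewrite repr_mx_expg // (elementary_exp rZ_elem) //; apply: comm1mx.
- apply: mxvec_ext => b; rewrite !mulmxA !mxvec_conj_mx; congr mxvec.
  rewrite /rep_conj !mulmxA [rZ z^-1%g *m _](elementary_comm rZ_elem) ?groupV //.
  by rewrite -!mulmxA [rZ y *m _](elementary_comm rZ_elem).
have [i zE] := elementary_image rZ_elem zZ; exists i; apply: mxvec_ext => b.
by rewrite !mxvec_conj_mx /rep_conj !repr_mxV // zE.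
Qed.

End PermutationModule.

Variable x : 'I_n -> k.
Hypotheses (pk : p \in [pchar k]) (pZ : (p.-group Z)%g) (zsZ : forall i, zs i \in Z)
  (x_indep : forall chi : 'I_n -> nat, (exists i, ~~ (p %| chi i)%N) ->
     \sum_i x i * (chi i)%:R != 0).

Let p_pr : prime p. Proof. by case/andP: pk. Qed.

Lemma maximal_trace_generic m (rZ : mx_representation k Z m) b :
  elementary_rep rZ -> maximal_trace p Z rZ b ->
  exists c, b = expmx_deriv (generic_elt x (rZ \o zs)) p c.
Proof.
move=> rZ_elem [H g a mH gZ gH ca].
have rZ_comm := elementary_comm rZ_elem; have rZ_exp := elementary_exp rZ_elem.
have [chi chiH] := fin_all_exists (fun i => maximal_coset_exists pZ mH gZ gH (zsZ i)).
have hZ i : (zs i * g ^- chi i)%g \in Z by rewrite groupM // groupV groupX.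
have [/existsP chi_neq0|] := boolP [exists i, ~~ (p %| chi i)%N].
  have -> : generic_elt x (rZ \o zs) =
      generic_elt x (fun i => rZ (zs i * g ^- chi i)%g *m rZ g ^+ chi i).
    apply: eq_bigr => i _; congr (_ *: (_ - _)).
    by rewrite -repr_mx_expg // -repr_mxM ?groupX // mulgKV.
  rewrite (trace_pow_expmx_deriv pk) ?rZ_exp //; apply: expmx_deriv_generic => // [i||i|i j||i].
  - exact: rZ_exp.
  - exact: rZ_exp.
  - exact: rZ_comm.
  - exact: rZ_comm.
  - exact: (x_indep (chi := chi)).
  by apply: comm_mxM; [apply: rZ_comm | apply: ca].
rewrite negb_exists => /forallP p_dvd_chi.
have zsH i : zs i \in H.
  have chi0 : chi i = 0%N :> nat.
    have := p_dvd_chi i; rewrite negbK; apply: contraTeq; rewrite -lt0n => chi_gt0.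
    by rewrite gtnNdvd.
  by have := chiH i; rewrite chi0 expg0 invg1 mulg1.
have ag : comm_mx (rZ g) a by have [i ->] := elementary_image rZ_elem gZ; apply: ca.
exists 0; rewrite raddf0 /trace_pow (eq_bigr (fun=> a)) => [|j _].
  by rewrite sumr_const card_ord -scaler_nat pcharf0 // scale0r.
apply/rep_conj_id; first exact: groupX.
by rewrite repr_mx_expg //; apply/comm_mx_sym/comm_mxX/comm_mx_sym.
Qed.

Lemma sum_maximal_trace_generic m (rZ : mx_representation k Z m) (T : seq 'M[k]_m) :
  elementary_rep rZ -> (forall b, b \in T -> maximal_trace p Z rZ b) ->
  exists c, \sum_(b <- T) b = expmx_deriv (generic_elt x (rZ \o zs)) p c.
Proof.
move=> rZ_elem; elim: T => [|b T IH] TP; first by exists 0; rewrite big_nil raddf0.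
have [c ->] := maximal_trace_generic rZ_elem (TP b (mem_head b T)).
have [|d] := IH; first by move=> t tT; apply: TP; rewrite inE tT orbT.
by rewrite big_cons => ->; exists (c + d); rewrite raddfD.
Qed.

Section KernelOfGenericOp.
Variables (m : nat) (rZ : mx_representation k Z m) (I : finType) (X Y : I -> 'M[k]_m).
Hypotheses (rZ_elem : elementary_rep rZ) (XY : dual_bases X Y) (permX : perm_family Z rZ X).

Local Notation op := (generic_op x (rZ \o zs) (fun i => rZ (zs i)^-1%g)).
Local Notation Xi := (generic_elt x (conj_repr rZ \o zs)).

Lemma mxvec_generic_elt b : mxvec b *m Xi = mxvec (op b).
Proof.
rewrite mulmx_sumr /generic_op linear_sum /=; apply: eq_bigr => i _.
rewrite -scalemxAr [RHS]linearZ /= mulmxBr mulmx1 mxvec_conj_mx.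
by congr (_ *: _); rewrite linearB.
Qed.

Lemma mxvec_iter_generic_op j b : mxvec (iter j op b) = mxvec b *m Xi ^+ j.
Proof.
elim: j => [|j IH]; first by rewrite expr0 mulmx1.
by rewrite iterS -mxvec_generic_elt IH -mulmxA mulmx_exprSr.
Qed.

Lemma generic_op_kernel b : op b = 0 ->
  exists2 b0, centmx rZ Z b0 & exists b1, b = b0 + iter p.-1 op b1.
Proof.
move=> op_b; have [T [blockT decT]] := perm_decomposition pZ XY permX.
pose projT t : 'M[k]_(m * m) := lin_mx (dual_proj X Y t).
have [C CE] : exists C, \sum_(d <- [seq trace_pow p (conj_repr rZ) t.1.2 (projT t.2) | t <- T]) d =
    expmx_deriv Xi p C.
  apply: sum_maximal_trace_generic; first exact: conj_repr_elementary.
  move=> _ /mapP [t /blockT [mH gZ gH projC] ->]; apply: (MaximalTrace p mH) => // h hH.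
  apply: mxvec_ext => d; rewrite !mulmxA mxvec_conj_mx !mul_vec_lin mxvec_conj_mx /=.
  by rewrite projC.
exists (\sum_(i | basis_fixed Z rZ X i) \tr (b *m Y i) *: X i).
  by apply: centmx_sum => i Xi; apply/centmxZ/basis_fixed_centmx.
exists (vec_mx (mxvec b *m C)); rewrite {1}[b]decT; congr (_ + _).
apply: (can_inj mxvecK); rewrite mxvec_iter_generic_op vec_mxK.
rewrite -(expmx_deriv_ker _ (prime_gt0 p_pr)); last by rewrite mxvec_generic_elt op_b linear0.
rewrite -CE big_map mulmx_sumr linear_sum /= big_seq [RHS]big_seq; apply: eq_bigr => t tT.
have [_ gZ _ _] := blockT t tT.
rewrite mulmx_sumr linear_sum; apply: eq_bigr => j _ /=.
rewrite -mxvec_conj_mx -mul_vec_lin -[in LHS]mxvec_conj_mx -!mulmxA.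
by rewrite /rep_conj -!mulmxA.
Qed.

End KernelOfGenericOp.
End ElementaryRepresentations.

(** * Factorial rings *)

Lemma exists_minimal (T : Type) (P : T -> Prop) (mu : T -> nat) x0 :
  P x0 -> exists2 x, P x & forall y, P y -> (mu x <= mu y)%N.
Proof.
have [n] := ubnP (mu x0); elim: n x0 => // n IH x0 lt_n Px0.
have [[y Py lt_y]|no] := classic (exists2 y, P y & (mu y < mu x0)%N).
  by apply: (IH y) => //; apply: leq_trans lt_y lt_n.
by exists x0 => // y Py; rewrite leqNgt; apply/negP => lt_y; apply: no; exists y.
Qed.

Section FactorialRings.
Variable R : idomainType.
Implicit Types (a b c d h q : R).

Definition divides a b := exists c, b = c * a.

Definition prime_elt q :=
  [/\ q != 0, q \isn't a GRing.unit &
      forall a b, divides q (a * b) -> divides q a \/ divides q b].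

Definition factorial_ring := forall a, a != 0 ->
  exists (u : R) (s : seq R), [/\ u \is a GRing.unit,
    forall q, q \in s -> prime_elt q & a = u * \prod_(q <- s) q].

Lemma divides_refl a : divides a a.
Proof. by exists 1; rewrite mul1r. Qed.

Lemma divides_mull a b c : divides a b -> divides a (c * b).
Proof. by case=> d ->; exists (c * d); rewrite mulrA. Qed.

Lemma divides_mulr a b c : divides a b -> divides a (b * c).
Proof. by rewrite mulrC; apply: divides_mull. Qed.

Lemma dividesD a b c : divides a b -> divides a c -> divides a (b + c).
Proof. by case=> d -> [e ->]; exists (d + e); rewrite mulrDl. Qed.

Lemma divides_addr a b c : divides a b -> divides a (c + b) -> divides a c.
Proof. by case=> d -> [e e_cb]; exists (e - d); rewrite mulrBl -e_cb addrK. Qed.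

Lemma divides_sum a (I : Type) (r : seq I) (P : pred I) (F : I -> R) :
  (forall i, P i -> divides a (F i)) -> divides a (\sum_(i <- r | P i) F i).
Proof. by move=> aF; elim/big_ind: _ => //; [exists 0; rewrite mul0r | apply: dividesD]. Qed.

Lemma divides_trans a b c : divides a b -> divides b c -> divides a c.
Proof. by case=> d -> [e ->]; exists (e * d); rewrite mulrA. Qed.

Lemma divides_mul2 a b c : divides a b -> divides (c * a) (c * b).
Proof. by case=> d ->; exists d; rewrite mulrCA. Qed.

Lemma divides_mul2l a b c : c != 0 -> divides (c * a) (c * b) -> divides a b.
Proof. by move=> c0 [d e]; exists d; apply: (mulfI c0); rewrite e mulrCA. Qed.

Lemma prime_divides_sym q r : prime_elt q -> prime_elt r -> divides q r -> divides r q.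
Proof.
move=> [q0 qu _] [r0 ru pr] [c e].
case: (pr c q) => [|[d ed]|//]; first by rewrite -e; apply: divides_refl.
case/negP: qu; apply/unitrPr; exists d; apply: (mulfI r0).
by rewrite mulr1 [in RHS]e ed mulrA mulrC mulrA.
Qed.

Lemma prime_divides_prod q (s : seq R) u : prime_elt q -> u \is a GRing.unit ->
  divides q (u * \prod_(r <- s) r) -> exists2 r, r \in s & divides q r.
Proof.
move=> qP uu; elim: s => [|r s IH].
  rewrite big_nil mulr1 => -[c e]; case: qP => _ /negP[]; move: uu.
  by rewrite e unitrM => /andP[].
rewrite big_cons mulrCA; case: (qP) => _ _ pr /pr [qr|/IH [r' r's qr']].
  by exists r; rewrite ?mem_head.
by exists r'; rewrite // inE r's orbT.
Qed.

Hypothesis RF : factorial_ring.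

Lemma colon_principal a b : a != 0 -> exists w, forall c, divides a (c * b) <-> divides w c.
Proof.
move=> a0; have [u [s [uu sP ->]]] := RF a0.
elim: s b sP {a a0} => [|q s IH] b sP.
  exists 1 => c; rewrite big_nil mulr1; split=> _; first by exists c; rewrite mulr1.
  by exists (c * b * u^-1); rewrite mulrVK.
have qP : prime_elt q by apply: sP; rewrite mem_head.
have sP' : forall r, r \in s -> prime_elt r by move=> r rs; apply: sP; rewrite inE rs orbT.
case: (qP) => q0 _ pr; rewrite big_cons mulrCA.
have [[b' eb]|nqb] := classic (divides q b).
  have [w wP] := IH b' sP'; exists w => c; rewrite -wP eb.
  have -> : c * (b' * q) = q * (c * b') by rewrite [b' * q]mulrC mulrCA.
  by split; [apply: divides_mul2l | apply: divides_mul2].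
have [w wP] := IH b sP'; exists (q * w) => c; split.
  move=> dv; have : divides q (c * b).
    by apply: divides_trans dv; exists (u * \prod_(j <- s) j); rewrite mulrC.
  case/pr => // -[c' ec]; move: dv; rewrite ec [c' * q]mulrC -mulrA => /(divides_mul2l q0) /wP.
  exact: divides_mul2.
case=> t ->; have -> : t * (q * w) * b = q * (t * w * b) by rewrite !mulrA [t * q]mulrC.
by apply: divides_mul2; apply/wP; exists t.
Qed.

Lemma strong_gcd a b : a != 0 -> exists d,
  [/\ divides d a, divides d b &
      forall h c, divides h (c * a) -> divides h (c * b) -> divides h (c * d)].
Proof.
move=> a0; have [w wP] := colon_principal b a0.
have [d ed] : divides w a by apply/wP; exists b; rewrite mulrC.
have w0 : w != 0 by apply: contraNneq a0 => w0; rewrite ed w0 mulr0.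
exists d; split; first by exists w; rewrite mulrC.
  by apply: (divides_mul2l w0); rewrite [w * d]mulrC -ed; apply/wP/divides_refl.
move=> h c ha hb; have [h0|h0] := eqVneq h 0.
  case: ha => t; rewrite h0 mulr0 => /eqP; rewrite mulf_eq0 (negPf a0) orbF => /eqP->.
  by exists 0; rewrite !mul0r.
have [v vP] := colon_principal c h0.
have [b' eb] : divides v b by apply/vP; rewrite mulrC.
have [a' ea] : divides v a by apply/vP; rewrite mulrC.
rewrite mulrC; apply/vP.
have [d' ed'] : divides w a' by apply/wP; rewrite ea eb; exists b'; rewrite mulrCA.
by exists d'; apply: (mulIf w0); rewrite -ed ea ed' mulrAC.
Qed.

End FactorialRings.

Section FactorialPolynomials.
Variable R : idomainType.
Implicit Types (f g : {poly R}) (q : R).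

Lemma divides_polyC q f : divides q%:P f <-> forall i, divides q f`_i.
Proof.
split=> [[g ->] i|h]; first by exists g`_i; rewrite coefMC.
have [c cP] := fin_all_exists (fun i : 'I_(size f) => h i).
exists (\poly_(i < size f) (if insub i is Some j then c j else 0)).
apply/polyP => i; rewrite coefMC coef_poly; case: ltnP => [lt|le].
  by rewrite insubT -cP.
by rewrite mul0r nth_default.
Qed.

Lemma first_coef_ndivides q f : ~ divides q%:P f ->
  exists2 i, ~ divides q f`_i & forall j, (j < i)%N -> divides q f`_j.
Proof.
move=> ndf; have [i0 ndi0] : exists i, ~ divides q f`_i.
  by apply: not_all_ex_not => h; apply/ndf/divides_polyC.
have [i ndi min_i] := exists_minimal (P := fun i => ~ divides q f`_i) id ndi0.
by exists i => // j; rewrite ltnNge => /negP ji; apply: NNPP => ndj; apply/ji/min_i.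
Qed.

Lemma prime_polyC q : prime_elt q -> prime_elt q%:P.
Proof.
case=> q0 qu pr; split; [by rewrite polyC_eq0 | by rewrite poly_unitE size_polyC q0 coefC |].
move=> f g /divides_polyC dv; apply: NNPP => /not_or_and [nf ng].
have [i ni lti] := first_coef_ndivides nf; have [j nj ltj] := first_coef_ndivides ng.
have {}dv : divides q (f`_i * g`_j).
  have := dv (i + j)%N; rewrite coefM (bigD1 (inord i)) //= inordK ?ltnS ?leq_addr // addKn.
  apply: divides_addr; apply: divides_sum => x ne_xi.
  have [x_lt_i|i_le_x] := ltnP x i; first by apply/divides_mulr/lti.
  have i_lt_x : (i < x)%N.
    rewrite ltn_neqAle i_le_x andbT; apply: contra ne_xi => /eqP e.
    by apply/eqP/val_inj; rewrite /= inordK ?ltnS ?leq_addr.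
  apply/divides_mull/ltj; rewrite ltn_subLR; last by rewrite -ltnS.
  by rewrite ltn_add2r.
by case/pr: dv.
Qed.

Hypothesis RF : factorial_ring R.

Definition primitive_poly f := forall q, prime_elt q -> ~ divides q%:P f.

(* Induction on the number of prime factors of the leading coefficient. *)
Lemma primitive_part f : f != 0 -> exists c g, [/\ c != 0, f = c *: g & primitive_poly g].
Proof.
move=> f0; have lf0 : lead_coef f != 0 by rewrite lead_coef_eq0.
have [u [s [uu sP]]] := RF lf0.
have [n] := ubnP (size s); elim: n s u f f0 {lf0} uu sP => // n IH s u f f0 uu sP lt_n lead_f.
have [pf|npf] := classic (primitive_poly f); first by exists 1, f; rewrite oner_neq0 scale1r.
have [q qP [g eg]] : exists2 q, prime_elt q & divides q%:P f.
  by apply: NNPP => h; apply: npf => q qP dv; apply: h; exists q.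
have q0 : q != 0 by case: qP.
have g0 : g != 0 by apply: contraNneq f0 => g0; rewrite eg g0 mul0r.
have lead_g : lead_coef f = lead_coef g * q by rewrite eg lead_coefM lead_coefC.
have [r rs qr] : exists2 r, r \in s & divides q r.
  by apply: (prime_divides_prod qP uu); rewrite -lead_f lead_g; exists (lead_coef g).
have rP := sP _ rs; have r0 : r != 0 by case: rP.
have [v' ev'] := prime_divides_sym qP rP qr; case: qr => v ev.
have vu : v \is a GRing.unit.
  by apply/unitrPr; exists v'; apply: (mulIf r0); rewrite mul1r -mulrA -ev' -ev.
have [||||c [g1 [c0 eg1 pg1]]] := IH (rem r s) (u * v) g g0.
- by rewrite unitrM uu.
- by move=> x /mem_rem; apply: sP.
- by rewrite -ltnS; apply: leq_trans lt_n; rewrite ltnS size_rem // prednK //; case: (s) rs.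
- apply: (mulIf q0); rewrite -lead_g lead_f (big_rem r) //= {1}ev.
  by rewrite -!mulrA; congr (_ * (_ * _)); rewrite mulrC.
exists (q * c), g1; rewrite mulf_neq0 //; split=> //.
by rewrite eg eg1 -scalerA mulrC mul_polyC.
Qed.

Lemma primitive_divides_scale g r f : primitive_poly g -> r != 0 ->
  divides g (r *: f) -> divides g f.
Proof.
move=> pg r0; have [u [s [uu sP ->]]] := RF r0 => {r0}.
elim: s sP => [|q s IH] sP.
  rewrite big_nil mulr1 => -[t et]; exists (u^-1 *: t).
  by rewrite -scalerAl -et scalerA mulVr // scale1r.
rewrite big_cons mulrCA -scalerA => -[t et].
have qP : prime_elt q by apply: sP; rewrite mem_head.
have [q0 _ pr] := prime_polyC qP.
have dvt : divides q%:P (t * g).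
  by exists ((u * \prod_(j <- s) j) *: f); rewrite -et -mul_polyC mulrC.
case: (pr t g dvt) => [[t' et']|dg]; last by case: (pg q qP dg).
apply: IH; first by move=> y ys; apply: sP; rewrite inE ys orbT.
exists t'; apply: (mulfI q0).
by rewrite mul_polyC et et' mulrA [q%:P * t']mulrC.
Qed.

Lemma primitive_dvdp g f : primitive_poly g -> (g %| f)%R -> divides g f.
Proof.
move=> pg /Pdiv.Idomain.dvdpP [[c q] /= c0 e].
by apply: (primitive_divides_scale pg c0); exists q.
Qed.

Lemma primitive_prime_elt g : primitive_poly g -> (1 < size g)%N ->
  (forall d : {poly R}, (1 < size d)%N -> d %| g -> (size g <= size d)%N) -> prime_elt g.
Proof.
move=> pg g1 g_min; have g0 : g != 0 by rewrite -size_poly_gt0 ltnW.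
split=> //; first by rewrite poly_unitE; case: eqP g1 => // ->.
move=> a b [t et]; have dv : g %| a * b by rewrite et dvdp_mull // dvdpp.
have [cop|] := boolP (coprimep g a).
  by right; apply: primitive_dvdp => //; rewrite -(Gauss_dvdpr b cop).
rewrite coprimep_def => nco; left; apply: primitive_dvdp => //.
have dg := dvdp_gcdl g a.
have gcd1 : (1 < size (gcdp g a))%N.
  by rewrite ltn_neqAle eq_sym nco size_poly_gt0 gcdp_eq0 (negPf g0).
have : size (gcdp g a) == size g by rewrite eqn_leq dvdp_leq //= g_min.
by rewrite dvdp_size_eqp // => /eqp_dvdl <-; apply: dvdp_gcdr.
Qed.

Lemma prime_factor_poly f : (1 < size f)%N ->
  exists g, [/\ prime_elt g, (1 < size g)%N & divides g f].
Proof.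
move=> f1; have [g [g1 gf] g_min] :=
  exists_minimal (P := fun g : {poly R} => (1 < size g)%N /\ g %| f)
    (fun g : {poly R} => size g) (conj f1 (dvdpp f)).
have g0 : g != 0 by rewrite -size_poly_gt0 ltnW.
have [c [h [c0 eg ph]]] := primitive_part g0.
have sh : size h = size g by rewrite eg size_scale.
have hf : h %| f by apply: dvdp_trans gf; rewrite eg dvdpZr // dvdpp.
exists h; rewrite sh; split=> //; last exact: primitive_dvdp.
apply: primitive_prime_elt => //; rewrite sh // => d d1 dh.
by apply: g_min; split=> //; apply: dvdp_trans hf.
Qed.

Lemma factorial_poly : factorial_ring {poly R}.
Proof.
move=> f; have [n] := ubnP (size f); elim: n f => // n IH f lt_n f0.
have [f1|f1] := leqP (size f) 1.
  have fE := size1_polyC f1; have a0 : f`_0 != 0 by move: f0; rewrite fE polyC_eq0 coefC.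
  have [u [s [uu sP e]]] := RF a0.
  exists u%:P, [seq q%:P | q <- s]; split.
  - have u0 : u != 0 by apply: contraTneq uu => ->; rewrite unitr0.
    by rewrite poly_unitE size_polyC u0 coefC.
  - by move=> _ /mapP [q qs ->]; apply/prime_polyC/sP.
  by rewrite big_map {1}fE e polyCM rmorph_prod.
have [g [gP g1 [t et]]] := prime_factor_poly f1; have [g0 _ _] := gP.
have t0 : t != 0 by apply: contraNneq f0 => t0; rewrite et t0 mul0r.
have [||u [s [uu sP es]]] := IH t => //.
  rewrite -ltnS; apply: leq_trans lt_n; rewrite ltnS et size_mul //.
  by case: (size g) g1 => [|[|d]] // _; rewrite addnS /= addnS ltnS leq_addr.
exists u, (g :: s); split=> //.
  by move=> q; rewrite inE => /orP[/eqP->|/sP].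
by rewrite big_cons et es mulrC mulrCA.
Qed.

End FactorialPolynomials.

Lemma factorial_iso (R S : idomainType) (f : {rmorphism R -> S}) (g : {rmorphism S -> R}) :
  cancel f g -> cancel g f -> factorial_ring S -> factorial_ring R.
Proof.
move=> fK gK SF a a0.
have f0 : f a != 0 by apply: contraNneq a0 => fa; rewrite -(fK a) fa rmorph0.
have [u [s [uu sP e]]] := SF _ f0.
have divides_g x y : divides x (f y) -> divides (g x) y.
  by case=> c ec; exists (g c); rewrite -[y]fK ec rmorphM.
have divides_f x y : divides (g x) y -> divides x (f y).
  by case=> c ->; exists (f c); rewrite rmorphM gK.
exists (g u), [seq g q | q <- s]; split.
- exact: rmorph_unit.
- move=> _ /mapP [q qs ->]; have [q0 qu pr] := sP _ qs; split.
  + by apply: contraNneq q0 => gq; rewrite -(gK q) gq rmorph0.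
  + by apply: contra qu => gqu; rewrite -(gK q) rmorph_unit.
  + by move=> x y /divides_f; rewrite rmorphM => /pr [/divides_g|/divides_g]; [left | right].
by rewrite big_map -rmorph_prod -rmorphM -e fK.
Qed.

Section FactorialMpoly.
Variable E : fieldType.

Definition mpoly_of_poly (n : nat) : {poly {mpoly E[n]}} -> {mpoly E[n.+1]} :=
  horner_morph (fun x => mulrC ('X_ord_max) (mwiden x)).
HB.instance Definition _ n := GRing.RMorphism.on (@mpoly_of_poly n).

Lemma muniX n m : muni 'X_[E, m] =
  'X_[[multinom (m (widen_ord (leqnSn n) i)) | i < n]] *: 'X^(m ord_max).
Proof. by rewrite muniE msuppX big_seq1 mcoeffX eqxx scale1r. Qed.

Lemma mnmwiden_add n (m : 'X_{1..n.+1}) :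
  (mnmwiden [multinom (m (widen_ord (leqnSn n) i)) | i < n] + U_(ord_max) *+ m ord_max)%MM = m.
Proof.
apply/mnmP => i; rewrite mnmDE mulmnE mnm1E.
have [<-|ne] := eqVneq ord_max i; first by rewrite mnmwiden_ordmax mul1n.
have lt_in : (i < n)%N.
  rewrite ltn_neqAle -ltnS ltn_ord andbT; apply: contra ne => /eqP e.
  by apply/eqP/val_inj.
have -> : i = widen_ord (leqnSn n) (Ordinal lt_in) by apply: val_inj.
by rewrite mnmwiden_widen mnmE mul0n addn0.
Qed.

Lemma muniK n : cancel (@muni n E) (@mpoly_of_poly n).
Proof.
move=> q; elim/mpolyind: q => [|c m q _ _ IH]; first by rewrite !rmorph0.
rewrite muniD [LHS]rmorphD; congr (_ + _); last exact: IH.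
rewrite muniZ muniX -!mul_polyC !rmorphM /= rmorphXn /= /mpoly_of_poly /horner_morph.
rewrite !map_polyC /= map_polyX !hornerE mwidenC /= -mulrA mul_mpolyC; congr (_ *: _).
by rewrite mwidenX mpolyXn -mpolyXD mnmwiden_add.
Qed.

Lemma mpoly_of_polyK n : cancel (@mpoly_of_poly n) (@muni n E).
Proof.
move=> q; elim/poly_ind: q => [|q c IH]; first by rewrite !rmorph0.
rewrite rmorphD rmorphM /= rmorphD rmorphM /= IH; congr (_ * _ + _).
  rewrite /mpoly_of_poly /horner_morph map_polyX hornerX muniX mnm1E eqxx expr1.
  rewrite (_ : [multinom _ | i < n] = 0%MM) ?mpolyX0 ?scale1r //.
  apply/mnmP => i; rewrite mnmE mnm1E mnm0E; case: eqP => // /(congr1 val) /= e.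
  by have := ltn_ord i; rewrite -e ltnn.
rewrite /mpoly_of_poly /horner_morph map_polyC hornerC /=.
elim/mpolyind: c => [|c m r _ _ IHr]; first by rewrite !rmorph0.
rewrite mwidenD muniD IHr polyCD; congr (_ + _).
rewrite mwidenZ mwidenX muniZ muniX mnmwiden_ordmax expr0.
rewrite (_ : [multinom _ | i < n] = m); last by apply/mnmP => i; rewrite mnmE mnmwiden_widen.
by rewrite -mul_mpolyC polyCM -!mul_polyC mulr1.
Qed.

Lemma factorial_mpoly n : factorial_ring {mpoly E[n]}.
Proof.
elim: n => [|n IH]; last exact: factorial_iso (@muniK n) (@mpoly_of_polyK n) (factorial_poly IH).
move=> a a0; exists a, [::]; split=> //; last by rewrite big_nil mulr1.
move: a0; rewrite [a]nvar0_mpolyC mpolyC_eq0 => c0.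
by apply/unitrPr; exists (a@_0%MM)^-1%:MP; rewrite -mpolyCM mulfV.
Qed.

(* The minimal degree d works: the gcd of d and any f in I divides d and is a candidate. *)
Lemma gcd_family n (I : {mpoly E[n]} -> Prop) f0 : I f0 -> f0 != 0 ->
  exists d, [/\ d != 0, forall f, I f -> divides d f &
    forall h c, (forall f, I f -> divides h (c * f)) -> divides h (c * d)].
Proof.
move=> If0 f00.
pose S (d : {mpoly E[n]}) :=
  d != 0 /\ forall h c, (forall f, I f -> divides h (c * f)) -> divides h (c * d).
have Sf0 : S f0 by split=> // h c; apply.
have [d [d0 dP] d_min] := exists_minimal (P := S) (fun d => msize d) Sf0.
exists d; split=> // f If.
have [e [[t et] ef eP]] := strong_gcd (@factorial_mpoly n) f d0.
have e0 : e != 0 by apply: contraNneq d0 => e0; rewrite et e0 mulr0.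
have t0 : t != 0 by apply: contraNneq d0 => t0; rewrite et t0 mul0r.
have Se : S e by split=> // h c hI; apply: eP; [apply: dP | apply: hI].
have tg : (0 < msize t)%N by rewrite lt0n msize_poly_eq0.
have eg : (0 < msize e)%N by rewrite lt0n msize_poly_eq0.
have /msize_poly1P [c c0 tE] : msize t == 1%N.
  rewrite eqn_leq tg andbT -(leq_add2r (msize e)) -[(_ + msize e)%N]prednK ?addn_gt0 ?tg //.
  by rewrite -msizeM // -et add1n ltnS d_min.
case: ef => y ->; exists (y * c^-1%:MP); rewrite et tE -!mulrA; congr (_ * _).
by rewrite mulrA -mpolyCM mulVf // mpolyC1 mul1r.
Qed.

End FactorialMpoly.

Section MapRepresentation.
Variables (gT : finGroupType) (k K : fieldType) (f : {rmorphism k -> K}) (Z : {group gT})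
  (m : nat) (rZ : mx_representation k Z m) (I : finType) (X : I -> 'M[k]_m).

Local Notation fZ := (map_repr f rZ).
Local Notation fX := (map_mx f \o X).

Lemma map_rep_conj g a : rep_conj fZ g (map_mx f a) = map_mx f (rep_conj rZ g a).
Proof. by rewrite /rep_conj !map_mxM. Qed.

Lemma map_centmx (H : {set gT}) a : centmx rZ H a -> centmx fZ H (map_mx f a).
Proof. by move=> ca h hH; rewrite /comm_mx -!map_mxM ca. Qed.

Lemma map_perm_family : perm_family Z rZ X -> perm_family Z fZ fX.
Proof.
by move=> permX g i gZ; have [j e] := permX g i gZ; exists j; rewrite /= map_rep_conj e.
Qed.

Lemma map_basis_fixed i : basis_fixed Z fZ fX i = basis_fixed Z rZ X i.
Proof.
apply: eq_forallb => g; congr (_ ==> _); rewrite /= map_rep_conj.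
by apply: inj_eq; apply: map_mx_inj.
Qed.

Lemma map_maximal_trace p b : maximal_trace p Z rZ b -> maximal_trace p Z fZ (map_mx f b).
Proof.
case=> H g a mH gZ gH ca; rewrite /trace_pow raddf_sum.
rewrite (eq_bigr (fun j : 'I_p => rep_conj fZ (g ^+ j)%g (map_mx f a))) => [|j _].
  by apply: (MaximalTrace p mH) => //; apply: map_centmx.
by rewrite map_rep_conj.
Qed.

Lemma map_elementary_rep p n (zs : 'I_n -> gT) :
  elementary_rep p zs rZ -> elementary_rep p zs fZ.
Proof.
case=> rZ_exp rZ_comm rZ_image; split=> [z zZ|y z yZ zZ|z zZ].
- by rewrite /= /map_repr_mx -rmorphXn /= rZ_exp // rmorph1.
- by rewrite /comm_mx /= /map_repr_mx -!map_mxM rZ_comm.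
by have [i e] := rZ_image z zZ; exists i; rewrite /= /map_repr_mx e.
Qed.

End MapRepresentation.

(** * Polynomial matrices *)

Notation polymx := (map_mx (@mpolyC _ _)).
Notation fracmx := (map_mx (@tofrac _)).

Lemma mpoly_mx_ind (E : fieldType) (n m q : nat) (P : 'M[{mpoly E[n]}]_(m, q) -> Prop) :
  P 0 -> (forall a b, P a -> P b -> P (a + b)) ->
  (forall mu (a : 'M[E]_(m, q)), P ('X_[mu] *: polymx a)) -> forall b, P b.
Proof.
move=> P0 PD PX b; rewrite (matrix_sum_delta b).
elim/big_ind: _ => // i _; elim/big_ind: _ => // j _.
elim/mpolyind: (b i j) => [|c mu f _ _ Pf]; first by rewrite scale0r.
rewrite scalerDl; apply: PD => //.
have -> : (c *: 'X_[mu]) *: delta_mx i j =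
    'X_[mu] *: polymx (c *: delta_mx i j) :> 'M[{mpoly E[n]}]_(m, q).
  apply/matrixP => x y; rewrite !mxE mpolyCM rmorph_nat mulrA; congr (_ * _).
  by rewrite -mul_mpolyC mulrC.
exact: PX.
Qed.

Lemma mmap1_commD (n : nat) (S : nzRingType) (r : 'I_n -> S) mu nu :
  (forall i j, GRing.comm (r i) (r j)) -> mmap1 r (mu + nu)%MM = mmap1 r mu * mmap1 r nu.
Proof.
move=> rC; rewrite /mmap1 -prodrM_comm => [|i j _ _].
  by apply: eq_bigr => i _; rewrite mnmDE exprD.
by apply/commrX/commr_sym/commrX.
Qed.

Lemma mmap1_comm (n : nat) (S : nzRingType) (r : 'I_n -> S) c mu :
  (forall i, GRing.comm c (r i)) -> GRing.comm c (mmap1 r mu).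
Proof. by move=> cr; apply: commr_prod => i _; apply: commrX. Qed.

Lemma mmap1_exp (n p : nat) (S : nzRingType) (r : 'I_n -> S) mu :
  (forall i j, GRing.comm (r i) (r j)) -> (forall i, r i ^+ p = 1) -> mmap1 r mu ^+ p = 1.
Proof.
move=> rC rp; rewrite /mmap1; elim: (index_enum _) => [|i s IH].
  by rewrite big_nil expr1n.
rewrite big_cons exprMn_comm ?IH ?mulr1; first by rewrite -exprM mulnC exprM rp expr1n.
by apply: commr_prod => j _; apply/commrX/commr_sym/commrX.
Qed.

(* The substitution X_i := X_i r_i, on polynomials and then coefficientwise on matrices:
   monomial_twist (X^mu a) = X^mu r^mu a. It carries generic_op to the commutator with
   generic_elt. *)
HB.lock Definition twist_poly (E : fieldType) (n m : nat) (r : 'I_n -> 'M[E]_m.+1)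
    (f : {mpoly E[n]}) : 'M[{mpoly E[n]}]_m.+1 :=
  mmap (@scalar_mx _ m.+1 \o @mpolyC n E) (fun i => 'X_i *: polymx (r i)) f.

HB.lock Definition monomial_twist (E : fieldType) (n m : nat) (r : 'I_n -> 'M[E]_m.+1)
    (b : 'M[{mpoly E[n]}]_m.+1) : 'M[{mpoly E[n]}]_m.+1 :=
  \sum_i \sum_j twist_poly r (b i j) *m delta_mx i j.

Section MonomialTwistTheory.
Variables (E : fieldType) (n m : nat) (r : 'I_n -> 'M[E]_m.+1).
Local Notation R := {mpoly E[n]}.
Local Notation MR := 'M[R]_m.+1.
Local Notation twist := (monomial_twist r).

Lemma twist_poly_is_additive : zmod_morphism (twist_poly r).
Proof. by move=> f g; rewrite !unlock raddfB. Qed.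
HB.instance Definition _ :=
  GRing.isZmodMorphism.Build R MR (twist_poly r) twist_poly_is_additive.

Lemma monomial_twistE b : twist b = \sum_i \sum_j twist_poly r (b i j) *m delta_mx i j.
Proof. by rewrite unlock. Qed.

Lemma monomial_twist_is_additive : zmod_morphism twist.
Proof.
move=> a b; rewrite !monomial_twistE -sumrB; apply: eq_bigr => i _.
by rewrite -sumrB; apply: eq_bigr => j _; rewrite !mxE raddfB /= mulmxBl.
Qed.
HB.instance Definition _ := GRing.isZmodMorphism.Build MR MR twist monomial_twist_is_additive.

Lemma twist_polyX c mu : twist_poly r (c *: 'X_[mu]) = 'X_[mu] *: polymx (c *: mmap1 r mu).
Proof.
have mmap1E : mmap1 (fun i => 'X_i *: polymx (r i)) mu = 'X_[mu] *: polymx (mmap1 r mu) :> MR.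
  rewrite /mmap1 mpolyXE_id rmorph_prod /=.
  elim/big_rec3: _ => [|i x y z _ ->]; first by rewrite scale1r.
  by rewrite exprZmx rmorphXn /= -!mulmxE -scalemxAl -scalemxAr scalerA.
rewrite [twist_poly]unlock mmapZ mmapX mmap1E /= -mulmxE mul_scalar_mx map_mxZ.
by rewrite !scalerA mulrC.
Qed.

Lemma monomial_twistX mu a : twist ('X_[mu] *: polymx a) = 'X_[mu] *: polymx (mmap1 r mu *m a).
Proof.
rewrite monomial_twistE map_mxM /= [X in _ *: (_ *m X)](matrix_sum_delta (polymx a)).
rewrite mulmx_sumr scaler_sumr; apply: eq_bigr => i _.
rewrite mulmx_sumr scaler_sumr; apply: eq_bigr => j _.
rewrite !mxE [X in twist_poly r X]mulrC mul_mpolyC twist_polyX map_mxZ.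
by rewrite -!scalemxAl -scalemxAr.
Qed.

Lemma monomial_twist_mulr b c : twist (b *m polymx c) = twist b *m polymx c.
Proof.
elim/mpoly_mx_ind: b => [|a b IHa IHb|mu a]; first by rewrite mul0mx raddf0 mul0mx.
  by rewrite mulmxDl !raddfD /= IHa IHb mulmxDl.
by rewrite -scalemxAl -map_mxM !monomial_twistX /= -scalemxAl -map_mxM mulmxA.
Qed.

Lemma monomial_twist_mull b c :
  (forall i, comm_mx c (r i)) -> twist (polymx c *m b) = polymx c *m twist b.
Proof.
move=> cr; elim/mpoly_mx_ind: b => [|a b IHa IHb|mu a]; first by rewrite mulmx0 raddf0 mulmx0.
  by rewrite mulmxDr !raddfD /= IHa IHb.
rewrite -scalemxAr -map_mxM !monomial_twistX /= -scalemxAr -map_mxM; congr (_ *: polymx _).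
by rewrite !mulmxA mulmxE (mmap1_comm _ cr).
Qed.

Hypothesis rC : forall i j, comm_mx (r i) (r j).

Lemma twist_polyM f g : twist_poly r (f * g) = twist_poly r f *m twist_poly r g.
Proof.
elim/mpolyind: f => [|c mu f _ _ IHf]; first by rewrite mul0r raddf0 mul0mx.
rewrite mulrDl !raddfD /= IHf mulmxDl; congr (_ + _).
elim/mpolyind: g {f IHf} => [|d nu g _ _ IHg]; first by rewrite mulr0 raddf0 mulmx0.
rewrite mulrDr !raddfD /= IHg; congr (_ + _).
rewrite -scalerAl -scalerAr scalerA -mpolyXD !twist_polyX mmap1_commD //.
rewrite -scalemxAl -scalemxAr scalerA -mpolyXD -map_mxM; congr (_ *: polymx _).
by rewrite -scalemxAl -scalemxAr scalerA -mulmxE.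
Qed.

Lemma monomial_twist_scale f b : twist (f *: b) = twist_poly r f *m twist b.
Proof.
rewrite !monomial_twistE mulmx_sumr; apply: eq_bigr => i _.
rewrite mulmx_sumr; apply: eq_bigr => j _.
by rewrite mxE twist_polyM mulmxA.
Qed.

Lemma twist_poly_comm c f : (forall i, comm_mx c (r i)) -> comm_mx (polymx c) (twist_poly r f).
Proof.
move=> cr; elim/mpolyind: f => [|d mu f _ _ IH]; first by rewrite raddf0; apply: comm_mx0.
rewrite (raddfD (twist_poly r)) /= twist_polyX; apply: comm_mxD; last exact: IH.
apply: comm_mxZ.
by rewrite /comm_mx -!map_mxM; congr polymx; apply/comm_mxZ/mmap1_comm.
Qed.

Lemma twist_poly_exp p f : p \in [pchar E] -> (forall i, r i ^+ p = 1) ->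
  twist_poly r f ^+ p = (f ^+ p)%:M.
Proof.
move=> pE rp; have p_pr : prime p by case/andP: pE.
have pR : p%:R = 0 :> R by rewrite -mpolyC_nat pcharf0 // mpolyC0.
elim/mpolyind: f => [|c mu f _ _ IH].
  by rewrite raddf0 !expr0n eqn0Ngt (prime_gt0 p_pr) /= (raddf0 (@scalar_mx R m.+1)).
have comm_fg : GRing.comm (twist_poly r (c *: 'X_[mu])) (twist_poly r f).
  by rewrite /GRing.comm -!mulmxE -!twist_polyM mulrC.
rewrite raddfD /= (exprD_comm_prime p_pr (natmx_eq0 _ pR) comm_fg) IH.
rewrite (exprD_comm_prime p_pr pR (mulrC _ _)) raddfD; congr (_ + _).
rewrite twist_polyX map_mxZ scalerA exprZmx -rmorphXn /= (mmap1_exp _ rC rp) rmorph1.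
by rewrite mulrC mul_mpolyC -scalemx1.
Qed.

End MonomialTwistTheory.

Lemma monomial_twistK (E : fieldType) (n m : nat) (r s : 'I_n -> 'M[E]_m.+1) :
  (forall i j, comm_mx (s i) (r j)) -> (forall i, s i *m r i = 1) ->
  cancel (monomial_twist r) (monomial_twist s).
Proof.
move=> srC sr1 b; elim/mpoly_mx_ind: b => [|a b IHa IHb|mu a]; first by rewrite !raddf0.
  by rewrite !raddfD /= IHa IHb.
rewrite !monomial_twistX mulmxA; congr (_ *: polymx _).
suff -> : mmap1 s mu *m mmap1 r mu = 1%:M by rewrite mul1mx.
rewrite mulmxE /mmap1 -prodrM_comm => [|i j _ _]; last first.
  by apply/commrX/commr_sym/commrX/commr_sym/srC.
rewrite big1 // => i _; rewrite -exprMn_comm; last exact: srC.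
by rewrite -mulmxE sr1 expr1n.
Qed.

Section Fractions.
Variable R : idomainType.
Import FracField.

Lemma tofrac_repr (f : {fraction R}) : exists a d : R, d != 0 /\ tofrac d * f = tofrac a.
Proof.
pose r := generic_quotient.repr f; exists (\n_r), (\d_r); split; first exact: denom_ratioP.
rewrite -[f]reprK -/r; unlock tofrac; rewrite -[LHS]pi_mul.
apply/eqmodP; rewrite /= equivfE /mulf !numden_Ratio ?oner_neq0 ?mul1r ?mulr1 ?denom_ratioP //.
Qed.

Lemma clear_denominators r q (a : 'M[{fraction R}]_(r, q)) :
  exists (d : R) (b : 'M[R]_(r, q)), d != 0 /\ tofrac d *: a = fracmx b.
Proof.
have [c cP] := fin_all_exists (fun ij : 'I_r * 'I_q => tofrac_repr (a ij.1 ij.2)).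
have [d dP] := fin_all_exists cP.
pose D := \prod_ij d ij.
have /fin_all_exists [b bP] (ij : 'I_r * 'I_q) : exists b, tofrac D * a ij.1 ij.2 = tofrac b.
  rewrite /D (bigD1 ij) //=; set e := \prod_(_ | _) _.
  by exists (e * c ij); rewrite [d ij * e]mulrC !rmorphM /= -mulrA; case: (dP ij) => _ ->.
exists D, (\matrix_(i, j) b (i, j)); split.
  by apply/prodf_neq0 => ij _; case: (dP ij).
by apply/matrixP => i j; rewrite !mxE (bP (i, j)).
Qed.

Lemma fracmx_inj r q : injective (fracmx : 'M[R]_(r, q) -> 'M[{fraction R}]_(r, q)).
Proof.
move=> a b /matrixP e; apply/matrixP => i j; apply/eqP.
by rewrite -tofrac_eq; apply/eqP; have := e i j; rewrite !mxE.
Qed.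

End Fractions.

(** * The generic Brauer homomorphism *)

Definition frac_const (E : fieldType) (n : nat) : E -> {fraction {mpoly E[n]}} :=
  @tofrac {mpoly E[n]} \o @mpolyC n E.
HB.instance Definition _ E n := GRing.RMorphism.on (@frac_const E n).

Section GenericPolynomial.
Variables (E : fieldType) (n m : nat) (r : 'I_n -> 'M[E]_m).
Local Notation R := {mpoly E[n]}.
Local Notation F := {fraction {mpoly E[n]}}.

Definition poly_generic : 'M[R]_m := generic_elt (fun i => 'X_i) (fun i => polymx (r i)).

Definition frac_generic : 'M[F]_m :=
  generic_elt (fun i => tofrac ('X_i : R)) (fun i => map_mx (@frac_const E n) (r i)).

Lemma fracmx_polymx q t (a : 'M[E]_(q, t)) : fracmx (polymx a) = map_mx (@frac_const E n) a.
Proof. by apply/matrixP => i j; rewrite !mxE. Qed.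

Lemma fracmx_poly_generic : fracmx poly_generic = frac_generic.
Proof.
rewrite map_generic_elt; apply: eq_bigr => i _ /=.
by rewrite fracmx_polymx.
Qed.

Lemma poly_generic_comm a : (forall i, comm_mx a (r i)) -> comm_mx (polymx a) poly_generic.
Proof. by move=> ar; apply: comm_generic_elt => i; rewrite /comm_mx -!map_mxM ar. Qed.

Lemma fracX_independent p (chi : 'I_n -> nat) : p \in [pchar E] ->
  (exists i, ~~ (p %| chi i)%N) -> \sum_i tofrac ('X_i : R) * (chi i)%:R != 0.
Proof.
move=> pE [i0 nd].
have -> : \sum_i tofrac ('X_i : R) * (chi i)%:R = tofrac (\sum_i ((chi i)%:R : E) *: 'X_i : R).
  rewrite rmorph_sum; apply: eq_bigr => i _ /=; rewrite -mul_mpolyC rmorphM mulrC /=.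
  by rewrite mpolyC_nat rmorph_nat.
rewrite tofrac_eq0; apply/eqP => /(congr1 (mcoeff U_(i0)%MM)); rewrite mcoeff0 raddf_sum /=.
rewrite (bigD1 i0) //= mcoeffZ mcoeffX eqxx mulr1 big1 ?addr0 => [/eqP|i ne].
  by rewrite -(dvdn_pcharf pE) (negPf nd).
rewrite mcoeffZ mcoeffX; case: eqP => [e|]; last by rewrite mulr0.
by move/mnmP: e => /(_ i); rewrite !mnm1E eqxx eq_sym (negPf ne).
Qed.

End GenericPolynomial.

Section GenericBrauerMap.
Variables (p : nat) (gT : finGroupType) (E : fieldType) (n m : nat) (Z : {group gT})
  (zs : 'I_n -> gT) (rZ : mx_representation E Z m.+1) (I : finType) (X Y : I -> 'M[E]_m.+1).
Hypotheses (pE : p \in [pchar E]) (pZ : (p.-group Z)%g) (zsZ : forall i, zs i \in Z)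
  (rZ_elem : elementary_rep p zs rZ) (XY : dual_bases X Y) (permX : perm_family Z rZ X).
Local Notation R := {mpoly E[n]}.
Local Notation F := {fraction {mpoly E[n]}}.
Local Notation const := (@frac_const E n).
Local Notation rF := (map_repr (@frac_const E n) rZ).
Local Notation r := (fun i => rZ (zs i)).
Local Notation rV := (fun i => rZ (zs i)^-1%g).
Local Notation xiR := (poly_generic r).
Local Notation xi := (frac_generic r).
Local Notation op :=
  (generic_op (fun i => 'X_i : R) (fun i => polymx (r i)) (fun i => polymx (rV i))).
Local Notation opF :=
  (generic_op (fun i => tofrac ('X_i : R)) (rF \o zs) (fun i => rF (zs i)^-1%g)).

Let p_pr : prime p. Proof. by case/andP: pE. Qed.
Let pF : p \in [pchar F]. Proof. exact: (rmorph_pchar const pE). Qed.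
Let pR : p%:R = 0 :> R. Proof. by rewrite -mpolyC_nat pcharf0 // mpolyC0. Qed.
Let rF_elem : elementary_rep p zs rF. Proof. exact: map_elementary_rep. Qed.
Let XYF : dual_bases (map_mx const \o X) (map_mx const \o Y). Proof. exact: map_dual_bases. Qed.
Let permF : perm_family Z rF (map_mx const \o X). Proof. exact: map_perm_family. Qed.

Let r_comm i j : comm_mx (r i) (r j).
Proof. exact: (elementary_comm rZ_elem). Qed.
Let rV_comm i j : comm_mx (rV i) (r j).
Proof. by apply: (elementary_comm rZ_elem); rewrite ?groupV. Qed.

Local Notation poly_cent b := (forall g, g \in Z -> comm_mx (polymx (rZ g)) b).

Lemma centmx_fracmx b : centmx rF Z (fracmx b) <-> poly_cent b.
Proof.
split=> cb g gZ; last by rewrite /comm_mx /= /map_repr_mx -fracmx_polymx -!map_mxM cb.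
by apply: fracmx_inj; rewrite !map_mxM fracmx_polymx; apply: cb.
Qed.

Lemma poly_cent_generic b : poly_cent b -> comm_mx b xiR.
Proof. by move=> cb; apply: comm_generic_elt => i; apply/comm_mx_sym/cb. Qed.

Lemma fracmx_op b : fracmx (op b) = opF (fracmx b).
Proof. by rewrite map_generic_op; apply: eq_bigr => i _ /=; rewrite !fracmx_polymx. Qed.

Lemma fracmx_iter_op j b : fracmx (iter j op b) = iter j opF (fracmx b).
Proof. by elim: j => // j IH; rewrite !iterS fracmx_op IH. Qed.

Lemma monomial_twist_op b :
  monomial_twist r (op b) = - admx xiR (monomial_twist r b).
Proof.
rewrite /admx /poly_generic /generic_elt /generic_op mulmx_sumr mulmx_suml opprB -sumrB.
rewrite raddf_sum; apply: eq_bigr => i _ /=.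
rewrite (monomial_twist_scale r_comm) raddfB /= monomial_twist_mulr monomial_twist_mull => [|j].
  rewrite -['X_i]scale1r twist_polyX mmap1U scale1r -scalemxAl mulmxBr !mulmxA -map_mxM.
  rewrite repr_mulmxV // map_mx1 mul1mx; move: (monomial_twist r b) => B.
  rewrite -scalemxAr -scalemxAl -scalerBr mulmxBr mulmxBl mulmx1 mul1mx.
  by rewrite scale1r opprB addrA addrNK.
exact: rV_comm.
Qed.

Lemma monomial_twist_iter_op j b :
  monomial_twist r (iter j op b) = (-1) ^+ j *: iter j (admx xiR) (monomial_twist r b).
Proof.
elim: j => [|j IH]; first by rewrite scale1r.
by rewrite !iterS monomial_twist_op IH linearZ /= exprS mulN1r scaleNr.
Qed.

Lemma poly_op_kernel b : op b = 0 -> exists (h : R) b0 b1,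
  [/\ h != 0, poly_cent b0 & h *: b = b0 + iter p.-1 op b1].
Proof.
move=> op_b; have opF_b : opF (fracmx b) = 0 by rewrite -fracmx_op op_b map_mx0.
have [c0 cc0 [c1 e]] := generic_op_kernel pF pZ zsZ (fun chi => fracX_independent pE (chi := chi))
  rF_elem XYF permF opF_b.
have [d0 [b0 [d0_neq0 e0]]] := clear_denominators c0.
have [d1 [b1 [d1_neq0 e1]]] := clear_denominators c1.
exists (d0 * d1), (d1 *: b0), (d0 *: b1); split; first by rewrite mulf_neq0.
  move=> g gZ; apply: comm_mxZ; move: g gZ; apply/centmx_fracmx.
  by rewrite -e0; apply: centmxZ.
apply: fracmx_inj; rewrite !map_mxZ map_mxD fracmx_iter_op !map_mxZ -e0 -e1 e scalerDr.
by rewrite !iter_generic_opZ !scalerA rmorphM /= [tofrac d1 * _]mulrC.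
Qed.

Lemma twist_poly_cent h : poly_cent (twist_poly r h).
Proof.
by move=> g gZ; apply: twist_poly_comm => i; apply: (elementary_comm rZ_elem).
Qed.

(* Pull a back along the twist, decompose it by poly_op_kernel, twist again, and trade the
   factor twist_poly h for h^p by multiplying with its power of exponent p - 1. *)
Lemma poly_centralizer a : comm_mx a xiR -> exists (h : R) a0 a1,
  [/\ h != 0, poly_cent a0 & h *: a = a0 + expmx_deriv xiR p a1].
Proof.
move=> a_xi; pose b := monomial_twist rV a.
have twist_b : monomial_twist r b = a.
  by apply: monomial_twistK => [i j|i]; [apply/comm_mx_sym/rV_comm | apply: repr_mulmxV].
have op_b : op b = 0.
  have twistK : cancel (monomial_twist r) (monomial_twist rV).
    by apply: monomial_twistK => // i; apply: repr_mulVmx.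
  by rewrite -[op b]twistK monomial_twist_op twist_b /admx a_xi subrr oppr0 raddf0.
have [h [b0 [b1 [h0 cb0 e]]]] := poly_op_kernel op_b.
pose S := twist_poly r h; pose a0 := monomial_twist r b0.
have Sa : S *m a = a0 + expmx_deriv xiR p ((-1) ^+ p.-1 *: monomial_twist r b1).
  rewrite -twist_b -(monomial_twist_scale r_comm) e raddfD /= monomial_twist_iter_op.
  by rewrite linearZ /= (expmx_deriv_iter_admx _ p_pr pR).
have cS : poly_cent (S ^+ p.-1) by move=> g gZ; apply/comm_mxX/twist_poly_cent.
have ca0 : poly_cent a0.
  move=> g gZ; rewrite /comm_mx /a0 -monomial_twist_mull; last first.
    by move=> i; apply: (elementary_comm rZ_elem).
  by rewrite cb0 // monomial_twist_mulr.
exists (h ^+ p), (S ^+ p.-1 *m a0).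
exists (S ^+ p.-1 *m ((-1) ^+ p.-1 *: monomial_twist r b1)); split.
- by rewrite expf_neq0.
- by move=> g gZ; apply: comm_mxM; [apply: cS | apply: ca0].
rewrite -expmx_deriv_mull; last exact: poly_cent_generic.
rewrite -mulmxDr -Sa mulmxA mulmx_exprSr prednK ?prime_gt0 //.
rewrite (twist_poly_exp r_comm _ pE) ?mul_scalar_mx // => i.
exact: (elementary_exp rZ_elem).
Qed.

Lemma frac_centralizer a : comm_mx a xi ->
  exists2 a0, centmx rF Z a0 & exists a1, a = a0 + expmx_deriv xi p a1.
Proof.
move=> a_xi; have [d [b [d0 e]]] := clear_denominators a.
have b_xi : comm_mx b xiR.
  apply: fracmx_inj; rewrite !map_mxM fracmx_poly_generic -e.
  by apply/comm_mx_sym/comm_mxZ/comm_mx_sym.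
have [h [b0 [b1 [h0 cb0 eb]]]] := poly_centralizer b_xi.
have hd0 : tofrac h * tofrac d != 0 by rewrite mulf_neq0 ?tofrac_eq0.
exists ((tofrac h * tofrac d)^-1 *: fracmx b0); first by apply/centmxZ/centmx_fracmx.
exists ((tofrac h * tofrac d)^-1 *: fracmx b1).
rewrite linearZ /= -scalerDr; apply: (scalemx_inj hd0); rewrite [RHS]scalerA mulfV // scale1r.
rewrite -scalerA e -map_mxZ eb map_mxD; congr (_ + _).
rewrite /expmx_deriv raddf_sum; apply: eq_bigr => j _ /=.
by rewrite !map_mxM !rmorphXn /= fracmx_poly_generic.
Qed.

Theorem frac_brauer_map : exists l (C : 'M[F]_(l, m.+1)) P,
  tate_basis p xi C P /\ brauer_map p Z rF (map_mx const \o X) (tate_map C P).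
Proof.
have xip : xi ^+ p = 0.
  apply: generic_elt_exp => // [|i j|i]; first exact: pcharf0.
    exact: (elementary_comm rF_elem).
  exact: (elementary_exp rF_elem).
have [l [C [P CP]]] := tate_basis_exists (prime_gt0 p_pr) xip.
exists l, C, P; split=> //.
apply: (tate_map_brauer pZ XYF permF pF xip CP _ _ frac_centralizer) => [a ca|b tr_b].
  by apply: comm_generic_elt => i; apply/comm_mx_sym/ca.
apply: (maximal_trace_generic pF pZ zsZ _ rF_elem tr_b) => chi.
exact: fracX_independent.
Qed.

End GenericBrauerMap.

Section LatticeCoordinates.
Variables (p : nat) (E : fieldType) (n m l : nat) (r : 'I_n -> 'M[E]_m)
  (cent : 'M[E]_m -> Prop) (beta : 'M[E]_m -> 'M[E]_l).
Local Notation R := {mpoly E[n]}.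

(* A polynomial map ker xi -> R^l, for xi generic, which induces an embedding of
   ker xi / im xi^(p-1) up to torsion and is equivariant along beta. *)
Record lattice_coord (P : 'M[R]_(m, l)) : Prop := LatticeCoord {
  lattice_coord_act : forall (v : 'rV[R]_m) a, v *m poly_generic r = 0 -> cent a ->
    v *m polymx a *m P = v *m P *m polymx (beta a);
  lattice_coord_ker : forall v : 'rV[R]_m, v *m poly_generic r = 0 -> v *m P = 0 ->
    exists (h : R) w, h != 0 /\ h *: v = w *m poly_generic r ^+ p.-1;
  lattice_coord_im : forall v : 'rV[R]_m, v *m poly_generic r ^+ p.-1 *m P = 0
}.

End LatticeCoordinates.

Section FracMatrixUnits.
Variables (p : nat) (gT : finGroupType) (k K : fieldType) (f : {rmorphism k -> K}) (m l q : nat)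
  (Z : {group gT}) (rZ : mx_representation k Z m) (I : finType) (X Y : I -> 'M[k]_m)
  (beta : {linear 'M[k]_m -> 'M[k]_l}) (betaK : {linear 'M[K]_m -> 'M[K]_q}) (i0 : 'I_l).
Hypotheses (pZ : (p.-group Z)%g) (XY : dual_bases X Y) (permX : perm_family Z rZ X)
  (betaP : brauer_map p Z rZ X beta)
  (betaKP : brauer_map p Z (map_repr f rZ) (map_mx f \o X) betaK).

Lemma map_brauer_ker a : centmx rZ Z a -> beta a = 0 -> betaK (map_mx f a) = 0.
Proof.
move=> ca ba; have [T TP ->] := brauer_map_ker pZ XY permX betaP ca ba.
rewrite raddf_sum linear_sum big_seq big1 // => b /TP tr_b /=.
by apply: (brauer_map_trace betaKP); apply: map_maximal_trace.
Qed.

Lemma map_brauer_eq a b : centmx rZ Z a -> centmx rZ Z b -> beta a = beta b ->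
  betaK (map_mx f a) = betaK (map_mx f b).
Proof.
move=> ca cb e; apply/eqP; rewrite -subr_eq0 -raddfB -map_mxB; apply/eqP.
apply: map_brauer_ker; last by rewrite raddfB /= e subrr.
by rewrite -scaleN1r; apply/centmxD/centmxZ.
Qed.

(* The images e i j of lifts of the matrix units of 'M[k]_l. *)
Lemma map_brauer_matrix_units : exists e : 'I_l -> 'I_l -> 'M[K]_q,
  [/\ forall a, centmx rZ Z a -> betaK (map_mx f a) = \sum_i \sum_j f (beta a i j) *: e i j,
      forall i j t s, e i j *m e t s = (j == t)%:R *: e i s,
      forall M, exists c : 'I_l -> 'I_l -> K, M = \sum_i \sum_j c i j *: e i j &
      e i0 i0 != 0].
Proof.
have /fin_all_exists2 [u uC uE] (ij : 'I_l * 'I_l) :=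
  brauer_map_surj betaP (delta_mx ij.1 ij.2).
pose e i j := betaK (map_mx f (u (i, j))); exists e.
have betaK_e a : centmx rZ Z a -> betaK (map_mx f a) = \sum_i \sum_j f (beta a i j) *: e i j.
  move=> ca; pose a' := \sum_i \sum_j beta a i j *: u (i, j).
  have ca' : centmx rZ Z a' by do 2!(apply: centmx_sum => ? _); apply: centmxZ.
  rewrite (@map_brauer_eq a a') //; last first.
    rewrite [LHS]matrix_sum_delta linear_sum; apply: eq_bigr => i _.
    by rewrite linear_sum; apply: eq_bigr => j _; rewrite linearZ /= uE.
  rewrite /a' raddf_sum linear_sum; apply: eq_bigr => i _ /=.
  by rewrite raddf_sum linear_sum; apply: eq_bigr => j _ /=; rewrite map_mxZ linearZ.
have eM i j t s : e i j *m e t s = (j == t)%:R *: e i s.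
  rewrite /e -(brauer_mapM betaKP); try exact: map_centmx.
  rewrite -(rmorph_nat f) -linearZ -map_mxZ -map_mxM /=.
  apply: map_brauer_eq; [exact: centmxM | exact: centmxZ |].
  by rewrite (brauer_mapM betaP) // !uE mul_delta_mx_cond linearZ /= uE scaler_nat.
have e_span M : exists c : 'I_l -> 'I_l -> K, M = \sum_i \sum_j c i j *: e i j.
  have [c ->] := brauer_map_span betaKP M.
  exists (fun x y => \sum_(i | basis_fixed Z rZ X i) c i * f (beta (X i) x y)).
  rewrite (eq_bigl _ _ (@map_basis_fixed _ _ _ f _ _ rZ _ X)).
  under eq_bigr => i Xi do rewrite /= (betaK_e _ (basis_fixed_centmx Xi)) scaler_sumr.
  rewrite exchange_big; apply: eq_bigr => x _.
  under eq_bigr do rewrite scaler_sumr.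
  rewrite exchange_big; apply: eq_bigr => y _; rewrite scaler_suml.
  by apply: eq_bigr => i _; rewrite scalerA.
split=> //; apply/eqP => e00.
have e0 i j : e i j = 0.
  have := eM i i0 i0 j; rewrite eqxx scale1r => <-.
  by have := eM i i0 i0 i0; rewrite e00 mulmx0 eqxx scale1r => <-; rewrite mul0mx.
have one0 : 1%:M = 0 :> 'M[K]_q.
  by have [c ->] := e_span 1%:M; do 2!(apply: big1 => ? _); rewrite e0 scaler0.
have no_fixed i : ~~ basis_fixed Z rZ X i.
  apply/negP; rewrite -(map_basis_fixed f) => Xi.
  have := brauer_map_free betaKP (c := fun=> 1) _ Xi; rewrite big1 => [/(_ erefl)/eqP|j _].
    by rewrite oner_eq0.
  by rewrite -[betaK _]mul1mx one0 mul0mx scaler0.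
have [c] := brauer_map_span betaP 1%:M.
rewrite big1 => [/matrixP/(_ i0 i0)|i Xi]; last by have := no_fixed i; rewrite Xi.
by rewrite !mxE eqxx => /eqP; rewrite oner_eq0.
Qed.

End FracMatrixUnits.

Section GenericLattice.
Variables (p : nat) (gT : finGroupType) (E : fieldType) (n m l : nat) (Z : {group gT})
  (zs : 'I_n -> gT) (rZ : mx_representation E Z m.+1) (I : finType) (X Y : I -> 'M[E]_m.+1)
  (beta : {linear 'M[E]_m.+1 -> 'M[E]_l}) (i0 : 'I_l).
Hypotheses (pE : p \in [pchar E]) (pZ : (p.-group Z)%g) (zsZ : forall i, zs i \in Z)
  (rZ_elem : elementary_rep p zs rZ) (XY : dual_bases X Y) (permX : perm_family Z rZ X)
  (betaP : brauer_map p Z rZ X beta).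
Local Notation R := {mpoly E[n]}.
Local Notation F := {fraction {mpoly E[n]}}.
Local Notation r := (fun i => rZ (zs i)).
Local Notation xiR := (poly_generic r).
Local Notation xi := (frac_generic r).

Lemma frac_equivariant_coord : exists Q : 'M[F]_(m.+1, l),
  [/\ forall (v : 'rV[F]_m.+1) a, v *m xi = 0 -> centmx rZ Z a ->
        v *m map_mx (@frac_const E n) a *m Q = v *m Q *m map_mx (@frac_const E n) (beta a),
      forall v : 'rV[F]_m.+1, v *m xi = 0 -> v *m Q = 0 -> (v <= xi ^+ p.-1)%MS,
      xi ^+ p.-1 *m Q = 0 &
      exists v : 'rV[F]_m.+1, v *m xi = 0 /\ v *m Q != 0].
Proof.
have [q [C [P [CP betaFP]]]] := frac_brauer_map pE pZ zsZ rZ_elem XY permX.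
have [e [betaF_e eM e_span e00]] := map_brauer_matrix_units i0 pZ XY permX betaP betaFP.
have [G [eG G_inj [w wG]]] := matrix_units_intertwiner eM e_span e00.
exists (P *m G); split=> [v a v_xi ca|v v_xi|//|].
- have a_xi : comm_mx (map_mx (@frac_const E n) a) xi.
    by apply: comm_generic_elt => i; rewrite /comm_mx -!map_mxM -ca.
  rewrite mulmxA (tate_coord_act CP v_xi a_xi) betaF_e //.
  rewrite [map_mx _ (beta a)]matrix_sum_delta mulmxA -!(mulmxA (v *m P)); congr (_ *m _).
  rewrite mulmx_suml mulmx_sumr; apply: eq_bigr => i _.
  rewrite mulmx_suml mulmx_sumr; apply: eq_bigr => j _.
  by rewrite mxE -scalemxAl -scalemxAr eG.
- by rewrite mulmxA => /G_inj; apply: (tate_coord_eq0 CP v_xi).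
- by rewrite mulmxA (tate_coord_im CP) mul0mx.
exists (w *m C); rewrite -mulmxA (tate_annul CP) mulmx0; split=> //.
by rewrite mulmxA -(mulmxA w) (tate_dual CP) mulmx1.
Qed.

Lemma lattice_coord_exists : exists2 P : 'M[R]_(m.+1, l),
  lattice_coord p r (centmx rZ Z) beta P &
  exists v : 'rV[R]_m.+1, v *m xiR = 0 /\ v *m P != 0.
Proof.
have [Q [Q_act Q_ker Q_im [w [w_xi wQ]]]] := frac_equivariant_coord.
have [d [P [d0 dP]]] := clear_denominators Q.
have td0 : tofrac d != 0 by rewrite tofrac_eq0.
have frac_xi : fracmx xiR = xi := fracmx_poly_generic r.
have frac_xiX j : fracmx (xiR ^+ j) = xi ^+ j by rewrite rmorphXn /= frac_xi.
have fracP s (v : 'M[R]_(s, m.+1)) : fracmx (v *m P) = tofrac d *: (fracmx v *m Q).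
  by rewrite map_mxM -dP -scalemxAr.
have ker_frac (v : 'rV[R]_m.+1) : v *m xiR = 0 -> fracmx v *m xi = 0.
  by rewrite -frac_xi -map_mxM => ->; apply: map_mx0.
exists P; last first.
  have [d' [v [d'0 dv]]] := clear_denominators w; exists v; split.
    by apply: fracmx_inj; rewrite map_mxM frac_xi -dv -scalemxAl w_xi scaler0 map_mx0.
  apply: contraNneq wQ => vP; have := fracP _ v; rewrite vP map_mx0 => /esym/eqP.
  by rewrite scalemx_eq0 (negPf td0) -dv -scalemxAl scalemx_eq0 tofrac_eq0 (negPf d'0).
split=> [v a v_xi ca|v v_xi vP|v].
- apply: fracmx_inj; rewrite fracP [RHS]map_mxM fracP -scalemxAl; congr (_ *: _).
  by rewrite map_mxM !fracmx_polymx Q_act // ker_frac.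
- have vQ : fracmx v *m Q = 0.
    by apply: (scalemx_inj td0); rewrite -fracP vP map_mx0 scaler0.
  have /submxP [D eD] := Q_ker _ (ker_frac v v_xi) vQ.
  have [h [w' [h0 hD]]] := clear_denominators D; exists h, w'; split=> //.
  by apply: fracmx_inj; rewrite map_mxZ map_mxM frac_xiX -hD -scalemxAl -eD.
apply: fracmx_inj; rewrite fracP map_mxM frac_xiX -mulmxA Q_im mulmx0 scaler0.
by rewrite map_mx0.
Qed.

End GenericLattice.

(** * Additive maps over finite fields *)

Section SemilinearSums.
Variables (R : comNzRingType) (s m q : nat) (tau : 'I_s -> {rmorphism R -> R})
  (U : 'I_s -> 'M[R]_(m, q)).

Definition semilin r (v : 'M[R]_(r, m)) : 'M[R]_(r, q) := \sum_i map_mx (tau i) v *m U i.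

Lemma semilin_is_additive r : zmod_morphism (@semilin r).
Proof.
by move=> v w; rewrite /semilin -sumrB; apply: eq_bigr => i _; rewrite map_mxB mulmxBl.
Qed.

HB.instance Definition _ r :=
  GRing.isZmodMorphism.Build _ _ (@semilin r) (@semilin_is_additive r).

Lemma semilinD r (v w : 'M[R]_(r, m)) : semilin (v + w) = semilin v + semilin w.
Proof. exact: raddfD. Qed.

Lemma semilinZ r c d (v : 'M[R]_(r, m)) :
  (forall i, tau i c = d) -> semilin (c *: v) = d *: semilin v.
Proof.
move=> tau_c; rewrite /semilin scaler_sumr; apply: eq_bigr => i _.
by rewrite map_mxZ tau_c -scalemxAl.
Qed.

End SemilinearSums.

Section FrobeniusPowers.
Variables (p : nat) (E : finFieldType) (pE : p \in [pchar E]).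

Let p_pr : prime p. Proof. by case/andP: pE. Qed.
Let p_gt1 : (1 < p)%N. Proof. exact: prime_gt1. Qed.

Definition Frob of p \in [pchar E] := fun i (x : E) => x ^+ (p ^ i).

Lemma Frob_nmod i : nmod_morphism (Frob pE i).
Proof.
split=> [|x y]; first by rewrite /Frob expr0n expn_eq0 eqn0Ngt prime_gt0.
apply: exprDn_pchar; apply/andP; split; first by rewrite expn_gt0 prime_gt0.
apply/allP => q; rewrite mem_primes => /and3P [q_pr _].
by rewrite Euclid_dvdX // => /andP [+ _]; rewrite dvdn_prime2 // => /eqP ->.
Qed.

Lemma Frob_monoid i : monoid_morphism (Frob pE i).
Proof. by split=> [|x y]; rewrite /Frob ?expr1n ?exprMn. Qed.

HB.instance Definition _ i := GRing.isNmodMorphism.Build E E (Frob pE i) (Frob_nmod i).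
HB.instance Definition _ i := GRing.isMonoidMorphism.Build E E (Frob pE i) (Frob_monoid i).

Let s : nat := \dim (fullv : {vspace pPrimeCharType pE}).

Definition Frobs (i : 'I_s) : {rmorphism E -> E} := Frob pE i.

Lemma card_pchar_field : #|E| = (p ^ s)%N.
Proof.
by rewrite -[#|E|]/#|pPrimeCharType pE| (card_pprimeChar pE) /s pprimeChar_dimf.
Qed.

Lemma pchar_field_dim_gt0 : (0 < s)%N.
Proof. by have := finNzRing_gt1 E; rewrite card_pchar_field; case: s. Qed.

Lemma Frob0 x : Frob pE 0 x = x.
Proof. by rewrite /Frob expn0 expr1. Qed.

Lemma Frob_add i j x : Frob pE (i + j) x = Frob pE j (Frob pE i x).
Proof. by rewrite /Frob expnD exprM. Qed.

Lemma Frob_dim x : Frob pE s x = x.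
Proof. by rewrite /Frob -card_pchar_field expf_card. Qed.

Definition Fp_span (eps : 'I_s -> E) :=
  forall x, exists a : 'I_s -> nat, x = \sum_k (a k)%:R * eps k.

Lemma Fp_span_exists : exists eps, Fp_span eps.
Proof.
exists (fun k => (vbasis (fullv : {vspace pPrimeCharType pE}))`_k) => x.
exists (fun k => coord (vbasis fullv) k (x : pPrimeCharType pE) : nat).
exact: (coord_vbasis (memvf (x : pPrimeCharType pE))).
Qed.

Lemma Fp_span_ext (M : zmodType) (f : E -> M) eps : Fp_span eps ->
  {morph f : x y / x + y} -> (forall k, f (eps k) = 0) -> forall x, f x = 0.
Proof.
move=> eps_span fD f_eps x; have [a ->] := eps_span x.
have f0 : f 0 = 0 by apply: (addrI (f 0)); rewrite -fD !addr0.
rewrite (big_morph f fD f0) big1 // => k _; rewrite mulr_natl.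
by elim: (a k) => [|c IH]; rewrite ?mulr0n // mulrS fD IH f_eps addr0.
Qed.

(* The polynomial sum_i a_i X^(p^i) has degree less than p^s = #|E|. *)
Lemma Frob_free (a : 'I_s -> E) : (forall x, \sum_i a i * Frob pE i x = 0) -> forall i, a i = 0.
Proof.
move=> a0; pose f : {poly E} := \sum_(i < s) a i *: 'X^(p ^ i).
have f_root x : f.[x] = 0.
  by rewrite -[RHS](a0 x) horner_sum; apply: eq_bigr => i _; rewrite hornerZ hornerXn.
have size_f : (size f <= p ^ s)%N.
  apply: (leq_trans (size_sum _ _ _)); apply/bigmax_leqP => i _.
  apply: (leq_trans (size_scale_leq _ _)); rewrite size_polyXn.
  by rewrite ltn_exp2l.
have f0 : f = 0.
  apply/eqP; rewrite -size_poly_eq0; apply: contraTT isT => f_neq0.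
  have : (#|E| < size f)%N.
    rewrite cardE; apply: max_poly_roots; rewrite -?size_poly_eq0 ?enum_uniq //.
    by apply/allP => x _; apply/eqP.
  by rewrite ltnNge card_pchar_field size_f.
move=> i; have := congr1 (fun g : {poly E} => g`_(p ^ i)) f0; rewrite coef0 coef_sum.
rewrite (bigD1 i) //= coefZ coefXn eqxx mulr1 big1 ?addr0 // => j ne.
by rewrite coefZ coefXn eqn_exp2l // eq_sym (inj_eq val_inj) (negPf ne) mulr0.
Qed.

Lemma moore_inverse : exists (eps : 'I_s -> E) (N : 'M[E]_s),
  [/\ Fp_span eps,
      forall i j : 'I_s, \sum_k N i k * Frob pE j (eps k) = (i == j)%:R &
      forall k j, \sum_(i < s) Frob pE i (eps k) * N i j = (k == j)%:R].
Proof.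
have [eps eps_span] := Fp_span_exists.
pose moore := \matrix_(k < s, i < s) Frob pE i (eps k).
suff moore_unit : moore \in unitmx.
  exists eps, (invmx moore); split=> // i j.
    have /matrixP/(_ i j) := mulVmx moore_unit; rewrite !mxE => <-.
    by apply: eq_bigr => k _; rewrite mxE.
  have /matrixP/(_ i j) := mulmxV moore_unit; rewrite !mxE => <-.
  by apply: eq_bigr => k _; rewrite mxE.
rewrite -unitmx_tr -row_free_unit -kermx_eq0; apply/rowV0P => a /sub_kermxP a_moore.
apply/rowP => i; rewrite mxE; apply: (Frob_free (a := a 0)) i.
apply: (Fp_span_ext (f := fun x => \sum_i a 0 i * Frob pE i x) eps_span) => [x y|k].
  by rewrite -big_split /=; apply: eq_bigr => i _; rewrite raddfD mulrDr.
have /rowP/(_ k) := a_moore; rewrite !mxE => ak0; rewrite -[RHS]ak0.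
by apply: eq_bigr => i _; rewrite !mxE.
Qed.

Lemma additive_semilin r q (u : 'rV[E]_r -> 'rV[E]_q) : {morph u : x y / x + y} ->
  exists U : 'I_s -> 'M[E]_(r, q), forall v, u v = semilin Frobs U v.
Proof.
move=> uD; have [eps [N [eps_span _ NP]]] := moore_inverse.
have u0 : u 0 = 0 by apply: (addrI (u 0)); rewrite -uD !addr0.
exists (fun i => \matrix_t (\sum_k N i k *: u (eps k *: 'e_t))) => v.
have u_scale t e : u (e *: 'e_t) =
    \sum_(i < s) Frob pE i e *: (\sum_k N i k *: u (eps k *: 'e_t)).
  apply/eqP; rewrite -subr_eq0; apply/eqP.
  apply: (Fp_span_ext (f := fun e => u (e *: 'e_t) - _) eps_span) => [x y|j].
    rewrite scalerDl uD; under eq_bigr do rewrite raddfD scalerDl.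
    by rewrite big_split /= opprD addrACA.
  under eq_bigr do (rewrite scaler_sumr; under eq_bigr do rewrite scalerA).
  rewrite exchange_big (bigD1 j) //= -scaler_suml NP eqxx scale1r big1 ?addr0 ?subrr // => k ne.
  by rewrite -scaler_suml NP eq_sym (negPf ne) scale0r.
rewrite {1}(row_sum_delta v) (big_morph u uD u0).
under eq_bigr do rewrite u_scale.
rewrite exchange_big; apply: eq_bigr => i _; rewrite mulmx_sum_row; apply: eq_bigr => t _.
by rewrite rowK mxE.
Qed.

End FrobeniusPowers.

Arguments Frobs {p E} pE i.

(** * Extension to the reflexive hull *)

Section HullLattice.
Variables (R : idomainType) (m l : nat) (Lam : 'rV[R]_m -> Prop) (P : 'M[R]_(m, l)) (d : R).

(* The image of Lam under P is J^l for an ideal J with gcd d, so its reflexive hull is d R^l. *)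
Record hull_lattice : Prop := HullLattice {
  hull_latticeD : forall v w, Lam v -> Lam w -> Lam (v + w);
  hull_latticeZ : forall c v, Lam v -> Lam (c *: v);
  hull_lattice_elem : forall v i j, Lam v -> exists2 w, Lam w & w *m P = (v *m P) 0 i *: 'e_j;
  hull_gcd_neq0 : d != 0;
  hull_gcd_divides : forall v i, Lam v -> divides d ((v *m P) 0 i);
  hull_gcd_greatest : forall h c,
    (forall v i, Lam v -> divides h (c * (v *m P) 0 i)) -> divides h (c * d)
}.

Record hull_frame (h : R) (L0 : 'M[R]_(l, m)) : Prop := HullFrame {
  hull_frame_neq0 : h != 0;
  hull_frame_lattice : forall y : 'rV[R]_l, Lam (y *m L0);
  hull_frame_coord : L0 *m P = (d * h)%:M
}.

Lemma hull_frameE h L0 (y : 'rV[R]_l) : hull_frame h L0 -> y *m L0 *m P = d *: (h *: y).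
Proof. by move=> frame; rewrite -mulmxA (hull_frame_coord frame) mul_mx_scalar scalerA. Qed.

Variables (S : Type) (s : nat) (tau taui : 'I_s -> {rmorphism R -> R}) (U : 'I_s -> 'M[R]_m)
  (scal : S -> R) (h t : R) (L0 : 'M[R]_(l, m)).
Hypotheses (tauK : forall i, cancel (tau i) (taui i))
  (tauiK : forall i, cancel (taui i) (tau i))
  (scal_separates : forall c (a : 'I_s -> R),
     (forall e, divides c (\sum_i tau i (scal e) * a i)) -> forall i, divides c (a i))
  (tau_h : forall i, tau i h = t) (t_neq0 : t != 0)
  (LamP : hull_lattice) (frame : hull_frame h L0)
  (Lam_stable : forall v, Lam v -> Lam (semilin tau U v))
  (ker_stable : forall v, Lam v -> v *m P = 0 -> semilin tau U v *m P = 0).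

Let C i := map_mx (tau i) L0 *m U i *m P.

Lemma semilin_frame v y : Lam v -> v *m P = d *: y ->
  t *: (semilin tau U v *m P) = semilin tau C y.
Proof.
move=> Lv vP; have Lw : Lam (h *: v - y *m L0).
  rewrite -scaleN1r; apply: hull_latticeD => //; apply: hull_latticeZ => //.
  exact: hull_frame_lattice frame _.
have := ker_stable Lw; rewrite mulmxBl -scalemxAl vP (hull_frameE _ frame) !scalerA mulrC subrr.
move/(_ erefl)/eqP; rewrite raddfB /= mulmxBl subr_eq0 => /eqP e.
rewrite scalemxAl -(semilinZ _ _ tau_h) e /semilin mulmx_suml.
by apply: eq_bigr => i _; rewrite map_mxM /C !mulmxA.
Qed.

Lemma tau_frame_divides v a f i j q : Lam v -> (v *m P) 0 a = d * f ->
  divides (t * d) (tau i f * C i j q).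
Proof.
move=> Lv fE; have [w Lw wP] := hull_lattice_elem LamP a j Lv.
apply: (scal_separates (a := fun i => tau i f * C i j q)) => e.
have Lew := hull_latticeZ LamP (scal e) Lw.
have /(semilin_frame Lew) : (scal e *: w) *m P = d *: (scal e * f *: 'e_j).
  by rewrite -scalemxAl wP fE !scalerA; congr (_ *: _); rewrite mulrCA mulrA.
move/rowP/(_ q); rewrite mxE summxE.
have [c ->] := hull_gcd_divides LamP q (Lam_stable Lew); rewrite mulrCA => ec.
exists c; rewrite ec; apply: eq_bigr => k _.
rewrite map_mxZ map_delta_mx -scalemxAl -rowE [RHS]mxE rmorphM -mulrA; congr (_ * (_ * _)).
by rewrite [RHS]mxE.
Qed.

Lemma frame_divides i j q : divides (t * d) (C i j q).
Proof.
have d_neq0 := hull_gcd_neq0 LamP.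
have : divides (d * taui i (t * d)) (taui i (C i j q) * d).
  apply: (hull_gcd_greatest LamP) => v a Lv.
  have [f] := hull_gcd_divides LamP a Lv; rewrite mulrC => fE.
  have [c cE] := tau_frame_divides i j q Lv fE.
  have := congr1 (taui i) cE; rewrite rmorphM tauK [RHS]rmorphM => gcE.
  by exists (taui i c); rewrite fE [RHS]mulrCA -gcE mulrCA [f * _]mulrC.
rewrite [taui i (C i j q) * d]mulrC => /(divides_mul2l d_neq0) [c cE].
by exists (tau i c); move/(congr1 (tau i)): cE; rewrite tauiK rmorphM tauiK.
Qed.

Theorem hull_extension : exists D : 'I_s -> 'M[R]_l, forall v y,
  Lam v -> v *m P = d *: y -> semilin tau U v *m P = d *: semilin tau D y.
Proof.
have /fin_all_exists [D DP] (x : 'I_s * ('I_l * 'I_l)) := frame_divides x.1 x.2.1 x.2.2.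
exists (fun i => \matrix_(j, q) D (i, (j, q))) => v y Lv vP.
apply: (scalemx_inj t_neq0); rewrite (semilin_frame Lv vP) /semilin !scaler_sumr.
apply: eq_bigr => i _; rewrite !scalerA scalemxAr; congr (_ *m _); apply/matrixP => j q.
by rewrite [RHS]mxE (DP (i, (j, q))) [in RHS]mxE mulrC.
Qed.

End HullLattice.

Section FrobeniusTwists.
Variables (p : nat) (E : finFieldType) (pE : p \in [pchar E]) (n : nat).
Local Notation s := (\dim (fullv : {vspace pPrimeCharType pE})).
Local Notation R := {mpoly E[n]}.

Lemma map_Frob_add i j f :
  map_mpoly (Frob pE (i + j)) f = map_mpoly (Frob pE j) (map_mpoly (Frob pE i) f) :> R.
Proof. by apply/mpolyP => mu; rewrite !mcoeff_map_mpoly /= Frob_add. Qed.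

Lemma map_Frob0 f : map_mpoly (Frob pE 0) f = f :> R.
Proof. by apply/mpolyP => mu; rewrite mcoeff_map_mpoly /= Frob0. Qed.

Lemma map_Frob_dim f : map_mpoly (Frob pE s) f = f :> R.
Proof. by apply/mpolyP => mu; rewrite mcoeff_map_mpoly /= Frob_dim. Qed.

Definition Frob_msym (sg : 'S_n) (i : 'I_s) : {rmorphism R -> R} :=
  msym sg \o map_mpoly (Frob pE i).

Definition Frob_msym_inv (sg : 'S_n) (i : 'I_s) : {rmorphism R -> R} :=
  map_mpoly (Frob pE (s - i)) \o msym sg^-1%g.

Arguments Frob_msym : simpl never.
Arguments Frob_msym_inv : simpl never.

Lemma Frob_msymK sg i : cancel (Frob_msym sg i) (Frob_msym_inv sg i).
Proof.
move=> f; rewrite /Frob_msym /Frob_msym_inv /= -msymMm mulgV msym1m -map_Frob_add.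
by rewrite subnKC ?map_Frob_dim // ltnW.
Qed.

Lemma Frob_msym_invK sg i : cancel (Frob_msym_inv sg i) (Frob_msym sg i).
Proof.
move=> f; rewrite /Frob_msym /Frob_msym_inv /= -map_Frob_add subnK; last exact: ltnW.
by rewrite map_Frob_dim -msymMm mulVg msym1m.
Qed.

Lemma Frob_msymC sg i c : Frob_msym sg i c%:MP = (Frob pE i c)%:MP.
Proof.
by rewrite /Frob_msym /= map_mpolyC -[(Frob pE i c)%:MP]mulr1 mul_mpolyC msymZ msym1.
Qed.

Lemma Frob_msym_coef0 sg i f : (Frob_msym sg i f)@_0%MM = Frob pE i f@_0%MM.
Proof.
rewrite /Frob_msym /= mcoeff_sym mcoeff_map_mpoly; congr (Frob pE i (mcoeff _ f)).
by apply/mnmP => j; rewrite !mnmE.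
Qed.

Lemma Frob_msym_separates sg h (a : 'I_s -> R) :
  (forall e, divides h (\sum_i Frob_msym sg i e%:MP * a i)) -> forall i, divides h (a i).
Proof.
move=> h_div i; have [eps [N [_ NP _]]] := moore_inverse pE.
have [c cP] := fin_all_exists (fun k => h_div (eps k)).
have cE k : c k * h = \sum_(j < s) (Frob pE j (eps k))%:MP * a j.
  by rewrite -cP; apply: eq_bigr => j _; rewrite Frob_msymC.
exists (\sum_k (N i k)%:MP * c k).
rewrite mulr_suml; under eq_bigr do rewrite -mulrA cE mulr_sumr.
rewrite exchange_big (bigD1 i) //= [X in _ + X]big1 ?addr0 => [|j ne].
  under eq_bigr do rewrite mulrA -mpolyCM.
  by rewrite -mulr_suml -rmorph_sum NP eqxx rmorph1 mul1r.
under eq_bigr do rewrite mulrA -mpolyCM.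
by rewrite -mulr_suml -rmorph_sum NP eq_sym (negPf ne) rmorph0 mul0r.
Qed.

Definition Fp_rational (h : R) := forall i, map_mpoly (Frob pE i) h = h.

Lemma Fp_rational_Frob_msym sg i h : Fp_rational h -> Frob_msym sg i h = msym sg h.
Proof. by move=> h_rat; rewrite /Frob_msym /= h_rat. Qed.

Lemma Fp_rational_msym sg h : Fp_rational h -> Fp_rational (msym sg h).
Proof.
move=> h_rat i; apply/mpolyP => mu; rewrite mcoeff_map_mpoly /= !mcoeff_sym.
by rewrite -[in RHS](h_rat i) mcoeff_map_mpoly.
Qed.

Lemma Fp_rationalX mu : Fp_rational 'X_[mu].
Proof. by move=> i; rewrite map_mpolyX. Qed.

(* The witness is the norm of f. *)
Lemma Fp_rational_multiple (f : R) : f != 0 ->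
  exists h, [/\ h != 0, Fp_rational h & divides f h].
Proof.
move=> f0; pose conj i := map_mpoly (Frob pE i) f : R.
have conj_neq0 i : conj i != 0.
  apply: contraNneq f0 => e; apply/eqP/mpolyP => mu; apply: (fmorph_inj (Frob pE i)).
  by rewrite -mcoeff_map_mpoly /= -/(conj i) e !mcoeff0 raddf0.
exists (\prod_(0 <= i < s) conj i); split.
- by rewrite prodf_seq_neq0; apply/allP => i _; rewrite conj_neq0.
- have Frob1 : map_mpoly (Frob pE 1) (\prod_(0 <= i < s) conj i) = \prod_(0 <= i < s) conj i.
    rewrite rmorph_prod /= (eq_bigr (fun i => conj i.+1)) => [|i _]; last first.
      by rewrite /conj -map_Frob_add addn1.
    apply: (mulfI (conj_neq0 0%N)); rewrite -big_nat_recl // big_nat_recr //=.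
    by rewrite {2}/conj map_Frob_dim -[f]map_Frob0 mulrC.
  elim=> [|i IH]; first exact: map_Frob0.
  by rewrite -addn1 map_Frob_add IH.
by rewrite big_ltn ?pchar_field_dim_gt0 // /conj map_Frob0; apply/divides_mulr/divides_refl.
Qed.

End FrobeniusTwists.

Arguments Frob_msym {p E} pE {n} sg i.

Notation mpoly_lift sg U := (semilin (Frob_msym _ sg) (fun i => polymx (U i))).

Section PolynomialLifts.
Variables (p : nat) (E : finFieldType) (pE : p \in [pchar E]) (n m : nat) (r : 'I_n -> 'M[E]_m).
Local Notation s := (\dim (fullv : {vspace pPrimeCharType pE})).
Local Notation R := {mpoly E[n]}.
Implicit Types (u : 'rV[E]_m -> 'rV[E]_m) (sg : 'S_n) (U : 'I_s -> 'M[E]_m) (v : 'rV[R]_m).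

Record permuting_lift u sg U : Prop := PermutingLift {
  permuting_lift_semilin : forall w, u w = semilin (Frobs pE) U w;
  permuting_lift_perm : forall i w, u (w *m r i) = u w *m r (sg i)
}.

Lemma mpoly_lift_rational sg U h v :
  Fp_rational pE h -> mpoly_lift sg U (h *: v) = msym sg h *: mpoly_lift sg U v.
Proof. by move=> h_rat; apply: semilinZ => i; apply: Fp_rational_Frob_msym. Qed.

Section OneLift.
Variables (u : 'rV[E]_m -> 'rV[E]_m) (U : 'I_s -> 'M[E]_m).
Hypothesis uE : forall w, u w = semilin (Frobs pE) U w.

Lemma semilin_morph : {morph u : w w' / w + w'}.
Proof. by move=> w w'; rewrite !uE raddfD. Qed.

Lemma mpoly_lift_const sg w : mpoly_lift sg U (polymx w) = polymx (u w).
Proof.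
rewrite uE /semilin raddf_sum; apply: eq_bigr => i _ /=; rewrite map_mxM; congr (_ *m _).
by apply/matrixP => x y; rewrite !mxE Frob_msymC.
Qed.

Lemma mpoly_lift_monomial sg mu w :
  mpoly_lift sg U ('X_[mu] *: polymx w) = msym sg 'X_[mu] *: polymx (u w).
Proof. by rewrite mpoly_lift_rational ?mpoly_lift_const //; apply: Fp_rationalX. Qed.

End OneLift.

Lemma mpoly_lift_ext u U U' sg v : (forall w, u w = semilin (Frobs pE) U w) ->
  (forall w, u w = semilin (Frobs pE) U' w) -> mpoly_lift sg U v = mpoly_lift sg U' v.
Proof.
move=> uE uE'; elim/mpoly_mx_ind: v => [|a b IHa IHb|mu w]; first by rewrite !raddf0.
  by rewrite !raddfD /= IHa IHb.
by rewrite (mpoly_lift_monomial uE) (mpoly_lift_monomial uE').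
Qed.

Lemma mpoly_lift_comp u1 u2 sg1 sg2 U1 U2 U v :
  (forall w, u1 w = semilin (Frobs pE) U1 w) -> (forall w, u2 w = semilin (Frobs pE) U2 w) ->
  (forall w, u1 (u2 w) = semilin (Frobs pE) U w) ->
  mpoly_lift (sg2 * sg1)%g U v = mpoly_lift sg1 U1 (mpoly_lift sg2 U2 v).
Proof.
move=> u1E u2E uE; elim/mpoly_mx_ind: v => [|a b IHa IHb|mu w]; first by rewrite !raddf0.
  by rewrite [LHS]semilinD [X in _ = _ X]semilinD [RHS]semilinD; apply: (congr2 +%R IHa IHb).
rewrite (mpoly_lift_monomial (u := u1 \o u2) uE) (mpoly_lift_monomial u2E).
rewrite mpoly_lift_rational; last exact/Fp_rational_msym/Fp_rationalX.
by rewrite (mpoly_lift_const u1E) msymMm.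
Qed.

Lemma mpoly_lift_generic u sg U v : permuting_lift u sg U ->
  mpoly_lift sg U (v *m poly_generic r) = mpoly_lift sg U v *m poly_generic r.
Proof.
case=> uE ur; have uD := semilin_morph uE.
have uN w : u (- w) = - u w by rewrite !uE raddfN.
elim/mpoly_mx_ind: v => [|a b IHa IHb|mu w]; first by rewrite mul0mx raddf0 mul0mx.
  by rewrite mulmxDl !raddfD /= IHa IHb mulmxDl.
rewrite !mulmx_sumr raddf_sum (mpoly_lift_monomial uE) [RHS](reindex_inj (@perm_inj _ sg)) /=.
have polymx_sub1 x i : polymx x *m (polymx (r i) - 1%:M) = polymx (x *m r i - x) :> 'rV[R]_m.
  by rewrite mulmxBr mulmx1 map_mxB map_mxM.
apply: eq_bigr => i _; rewrite -!scalemxAl -!scalemxAr !scalerA !polymx_sub1 -mpolyXD.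
rewrite (mpoly_lift_monomial uE) uD uN ur mpolyXD msymM; congr (_ * _ *: _).
by rewrite /msym mmapX mmap1U.
Qed.

Lemma permuting_lift_exists u : injective r -> {morph u : w w' / w + w'} -> bijective u ->
  (forall i, exists j, forall w, u (w *m r i) = u w *m r j) ->
  exists sg U, permuting_lift u sg U.
Proof.
move=> r_inj uD ub ur; have [U uE] := additive_semilin pE uD.
have [f fP] := fin_all_exists ur.
have f_inj : injective f.
  move=> i j e; apply/r_inj/row_matrixP => t; rewrite !rowE.
  by apply: (bij_inj ub); rewrite !fP e.
by exists (perm f_inj), U; split=> // i v; rewrite permE fP.
Qed.

Lemma permuting_lift_perm_unique u sg sg' U U' : injective r -> bijective u ->
  permuting_lift u sg U -> permuting_lift u sg' U' -> sg = sg'.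
Proof.
move=> r_inj [u' _ uK] [_ ur] [_ ur']; apply/permP => i; apply/r_inj/row_matrixP => t.
by rewrite !rowE -[delta_mx 0 t]uK -ur' ur.
Qed.

Lemma permuting_lift_comp u1 u2 sg1 sg2 U1 U2 :
  permuting_lift u1 sg1 U1 -> permuting_lift u2 sg2 U2 ->
  exists2 U, permuting_lift (u1 \o u2) (sg2 * sg1)%g U &
    forall v, mpoly_lift (sg2 * sg1)%g U v = mpoly_lift sg1 U1 (mpoly_lift sg2 U2 v).
Proof.
case=> uE1 ur1 [uE2 ur2]; have [|U uE] := additive_semilin pE (u := u1 \o u2).
  by move=> w w'; rewrite /= (semilin_morph uE2) (semilin_morph uE1).
exists U; last by move=> v; apply: mpoly_lift_comp.
by split=> // i v; rewrite /= ur2 ur1 permM.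
Qed.

End PolynomialLifts.

(** * The action on the reflexive hull *)

Section HullAction.
Variables (p : nat) (E : finFieldType) (pE : p \in [pchar E]) (n m l : nat)
  (r : 'I_n -> 'M[E]_m) (cent : 'M[E]_m -> Prop) (beta : 'M[E]_m -> 'M[E]_l).
Local Notation s := (\dim (fullv : {vspace pPrimeCharType pE})).
Local Notation R := {mpoly E[n]}.
Local Notation xi := (poly_generic r).
Local Notation in_ker := (fun v : 'rV[R]_m => v *m xi = 0).
Local Notation coef0 := (map_mx (mcoeff 0%MM)).
Implicit Types (sg : 'S_n) (U : 'I_s -> 'M[E]_m)
  (u : 'rV[E]_m -> 'rV[E]_m) (f : 'rV[E]_l -> 'rV[E]_l).
Variables (P : 'M[R]_(m, l)) (d : R).

(* ext is the extension to R^l of the action of u on the image of ker xi, and f is its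
   value at X = 0. *)
Record hull_action u sg U ext f : Prop := HullAction {
  hull_action_lift : permuting_lift r u sg U;
  hull_action_ext : forall v y, in_ker v -> v *m P = d *: y ->
    mpoly_lift sg U v *m P = d *: ext y;
  hull_action_rational : forall c y, Fp_rational pE c -> ext (c *: y) = msym sg c *: ext y;
  hull_action_coef0 : forall y, coef0 (ext y) = f (coef0 y)
}.

Definition hull_rel u f := bijective u /\ exists sg U ext, hull_action u sg U ext f.

Lemma msym_neq0 (sg : 'S_n) (c : R) : c != 0 -> msym sg c != 0.
Proof. by rewrite -(inj_eq (inj_msym sg)) msym0. Qed.

Lemma hull_rel_eq u u' f : u =1 u' -> hull_rel u f -> hull_rel u' f.
Proof.
move=> e [ub [sg [U [ext [[uE ur] uP extZ ext0]]]]]; split; first exact: eq_bij ub _ e.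
by exists sg, U, ext; split=> //; split=> [w|i w]; rewrite -!e.
Qed.

Lemma permuting_lift_ker u sg U v : permuting_lift r u sg U -> in_ker v ->
  in_ker (mpoly_lift sg U v).
Proof. by move=> uL v_xi; rewrite /= -(mpoly_lift_generic _ uL) v_xi raddf0. Qed.

Lemma hull_rel_comp u1 u2 f1 f2 : hull_rel u1 f1 -> hull_rel u2 f2 ->
  hull_rel (u1 \o u2) (f1 \o f2).
Proof.
case=> b1 [sg1 [U1 [ext1 [uL1 uP1 extZ1 ext01]]]] [b2 [sg2 [U2 [ext2 [uL2 uP2 extZ2 ext02]]]]].
split; first exact: bij_comp.
have [U uL liftE] := permuting_lift_comp uL1 uL2.
exists (sg2 * sg1)%g, U, (ext1 \o ext2); split=> // [v y v_xi vP|c y c_rat|y].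
- by rewrite liftE; apply: uP1; [apply: permuting_lift_ker uL2 v_xi | apply: uP2].
- by rewrite /= extZ2 // extZ1 ?msymMm //; apply: Fp_rational_msym.
by rewrite /= ext01 ext02.
Qed.

Hypothesis (P_coord : lattice_coord p r cent beta P).

Lemma hull_rel_cent c : (forall i, comm_mx c (r i)) -> cent c -> c \in unitmx ->
  hull_rel (mulmxr c) (mulmxr (beta c)).
Proof.
move=> c_r cc cu; split; first by exists (mulmxr (invmx c)) => v /=; rewrite (mulmxK, mulmxKV).
have [|U uE] := additive_semilin pE (u := mulmxr c); first by move=> v w; rewrite /= mulmxDl.
have liftE (v : 'rV[R]_m) : mpoly_lift 1%g U v = v *m polymx c.
  elim/mpoly_mx_ind: v => [|a b IHa IHb|mu w]; first by rewrite raddf0 mul0mx.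
    by rewrite semilinD IHa IHb mulmxDl.
  by rewrite (mpoly_lift_monomial uE) msym1m /= map_mxM scalemxAl.
exists 1%g, U, (mulmxr (polymx (beta c))); split.
- by split=> // i w; rewrite perm1 /= -!mulmxA c_r.
- by move=> v y v_xi vP; rewrite liftE (lattice_coord_act P_coord) // vP scalemxAl.
- by move=> h y _; rewrite msym1m /= scalemxAl.
move=> y; apply/rowP => q; rewrite !mxE raddf_sum; apply: eq_bigr => j _ /=.
by rewrite !mxE rmorphM /= mpolyCK.
Qed.

Variables (h : R) (L : 'M[R]_(l, m)).
Hypotheses (r_inj : injective r) (h_rat : Fp_rational pE h)
  (P_hull : hull_lattice in_ker P d) (frame : hull_frame in_ker P d h L).

Lemma permuting_lift_ker_coord u sg U v : permuting_lift r u sg U ->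
  in_ker v -> v *m P = 0 -> mpoly_lift sg U v *m P = 0.
Proof.
move=> uL v_xi vP; have lift_xiX (w : 'rV[R]_m) j :
    mpoly_lift sg U (w *m xi ^+ j) = mpoly_lift sg U w *m xi ^+ j.
  elim: j w => [|j IH] w; first by rewrite !mulmx1.
  by rewrite -!mulmx_exprS !mulmxA IH (mpoly_lift_generic _ uL).
have [c [w [c0 cv]]] := lattice_coord_ker P_coord v_xi vP.
have [e [e0 e_rat [b eE]]] := Fp_rational_multiple pE c0.
apply: (scalemx_inj (msym_neq0 sg e0)); rewrite scaler0 scalemxAl.
rewrite -(mpoly_lift_rational _ _ _ e_rat) eE -scalerA cv scalemxAl lift_xiX.
exact: lattice_coord_im P_coord _.
Qed.

Lemma hull_rel_exists u : {morph u : w w' / w + w'} -> bijective u ->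
  (forall i, exists j, forall w, u (w *m r i) = u w *m r j) ->
  exists f, hull_rel u f /\ {morph f : w w' / w + w'}.
Proof.
move=> uD ub ur; have [sg [U uL]] := permuting_lift_exists pE r_inj uD ub ur.
have [D DP] := hull_extension (Frob_msymK sg) (Frob_msym_invK sg) (@Frob_msym_separates _ _ pE _ sg)
  (fun i => Fp_rational_Frob_msym sg i h_rat) (msym_neq0 sg (hull_frame_neq0 frame)) P_hull frame
  (fun v => permuting_lift_ker uL) (fun v => permuting_lift_ker_coord uL).
pose f (w : 'rV[E]_l) := semilin (Frobs pE) (fun i => coef0 (D i)) w.
exists f; split; last by move=> w w'; apply: semilinD.
split=> //; exists sg, U, (@semilin _ _ _ _ (Frob_msym pE sg) D 1); split=> // [c y c_rat|y].
  by apply: semilinZ => i; apply: Fp_rational_Frob_msym.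
apply/rowP => q; rewrite mxE !summxE raddf_sum; apply: eq_bigr => i _ /=.
rewrite !mxE raddf_sum; apply: eq_bigr => j _ /=.
by rewrite !mxE rmorphM /= Frob_msym_coef0.
Qed.

Lemma hull_rel_unique u f f' : hull_rel u f -> hull_rel u f' -> f =1 f'.
Proof.
case=> ub [sg [U [ext [uL uP extZ ext0]]]] [_ [sg' [U' [ext' [uL' uP' extZ' ext0']]]]].
have sgE := permuting_lift_perm_unique r_inj ub uL uL'; subst sg'.
move=> w; pose y : 'rV[R]_l := polymx w.
have <- : coef0 y = w by apply/rowP => q; rewrite !mxE mcoeffC eqxx mulr1.
have yL_xi := hull_frame_lattice frame y; have yLP := hull_frameE y frame.
rewrite -ext0 -ext0'; congr (map_mx _ _).
apply: (scalemx_inj (msym_neq0 sg (hull_frame_neq0 frame))).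
rewrite -extZ // -extZ' //; apply: (scalemx_inj (hull_gcd_neq0 P_hull)).
rewrite -(uP _ _ yL_xi yLP) -(uP' _ _ yL_xi yLP).
by rewrite (mpoly_lift_ext _ _ (permuting_lift_semilin uL) (permuting_lift_semilin uL')).
Qed.

End HullAction.

Section KernelFrame.
Variables (p : nat) (E : finFieldType) (pE : p \in [pchar E]) (n m l : nat)
  (r : 'I_n -> 'M[E]_m) (cent : 'M[E]_m -> Prop) (beta : 'M[E]_m -> 'M[E]_l).
Local Notation R := {mpoly E[n]}.
Local Notation xi := (poly_generic r).
Local Notation in_ker := (fun v : 'rV[R]_m => v *m xi = 0).
Variables (P : 'M[R]_(m, l)) (v0 : 'rV[R]_m).
Hypotheses (cent_comm : forall a i, cent a -> comm_mx a (r i))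
  (beta_surj : forall b, exists2 a, cent a & beta a = b)
  (P_coord : lattice_coord p r cent beta P) (v0_xi : v0 *m xi = 0) (v0P : v0 *m P != 0).

Lemma ker_cent v a : in_ker v -> cent a -> in_ker (v *m polymx a).
Proof.
move=> v_xi ca; rewrite /= -mulmxA poly_generic_comm => [|i]; last exact: cent_comm.
by rewrite mulmxA v_xi mul0mx.
Qed.

Lemma ker_coord_delta v i j : in_ker v ->
  exists2 w, in_ker w & w *m P = (v *m P) 0 i *: 'e_j.
Proof.
move=> v_xi; have [a ca aE] := beta_surj (delta_mx i j).
exists (v *m polymx a); first exact: ker_cent.
by rewrite (lattice_coord_act P_coord) // aE map_delta_mx row_mul_delta.
Qed.

Let v0_coord : exists i, (v0 *m P) 0 i != 0.
Proof.
apply/existsP; apply: contraNT v0P => /existsPn h; apply/eqP/rowP => i.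
by have := h i; rewrite negbK [RHS]mxE => /eqP.
Qed.

Lemma ker_hull_lattice : exists d, hull_lattice in_ker P d.
Proof.
have [i0 f0] := v0_coord.
pose J (f : R) := exists (v : 'rV[R]_m) i, in_ker v /\ f = (v *m P) 0 i.
have [|d [d0 d_div d_gcd]] := gcd_family (I := J) _ f0; first by exists v0, i0.
exists d; split=> [v w v_xi w_xi|c v v_xi|||v i v_xi|h c hc].
- by rewrite mulmxDl v_xi w_xi addr0.
- by rewrite -scalemxAl v_xi scaler0.
- exact: ker_coord_delta.
- by [].
- by apply: d_div; exists v, i.
by apply: d_gcd => _ [v [i [v_xi ->]]]; apply: hc.
Qed.

Lemma ker_hull_frame d : hull_lattice in_ker P d ->
  exists h (L : 'M[R]_(l, m)), Fp_rational pE h /\ hull_frame in_ker P d h L.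
Proof.
move=> P_hull; have [i0 f0] := v0_coord.
have [f fE] := hull_gcd_divides P_hull i0 v0_xi.
have f_neq0 : f != 0 by apply: contraNneq f0 => e; rewrite fE e mul0r.
have [h [h0 h_rat [c cE]]] := Fp_rational_multiple pE f_neq0.
have /fin_all_exists2 [w w_xi wP] j := ker_coord_delta i0 j v0_xi.
exists h, (\matrix_j (c *: w j)); split=> //; split=> // [y|].
  rewrite /= -mulmxA [X in _ *m X](_ : _ = 0) ?mulmx0 //; apply/row_matrixP => j.
  by rewrite row_mul rowK -scalemxAl w_xi scaler0 row0.
apply/row_matrixP => j; rewrite row_mul rowK -scalemxAl wP fE scalerA row_scalar_mx.
by rewrite mulrA -cE mulrC.
Qed.

End KernelFrame.

(** * Descent of normalizers *)

Section NormalizerRelation.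
Variables (gT : finGroupType) (E : finFieldType) (m l : nat) (G : {group gT})
  (rho : gT -> 'M[E]_m).
Implicit Types (u : 'rV[E]_m -> 'rV[E]_m) (f : 'rV[E]_l -> 'rV[E]_l).

Record normalizing u : Prop := Normalizing {
  normalizingD : {morph u : v w / v + w};
  normalizing_bij : bijective u;
  normalizing_conj : forall g, g \in G ->
    exists2 h, h \in G & forall v, u (v *m rho g) = u v *m rho h;
  normalizing_conjV : forall h, h \in G ->
    exists2 g, g \in G & forall v, u (v *m rho g) = u v *m rho h
}.

(* The graph of a homomorphism from the additive bijections normalizing rho G to those of
   E^l, which extends beta on the units of the centralizer. *)
Record norm_rel (beta : 'M[E]_m -> 'M[E]_l)
    (Phi : ('rV[E]_m -> 'rV[E]_m) -> ('rV[E]_l -> 'rV[E]_l) -> Prop) : Prop := NormRel {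
  norm_rel_total : forall u, normalizing u -> exists f, Phi u f /\ {morph f : v w / v + w};
  norm_rel_unique : forall u f f', Phi u f -> Phi u f' -> f =1 f';
  norm_rel_comp : forall u u' f f', Phi u f -> Phi u' f' -> Phi (u \o u') (f \o f');
  norm_rel_cent : forall c, centmx rho G c -> c \in unitmx -> Phi (mulmxr c) (mulmxr (beta c));
  norm_rel_eq : forall u u' f, u =1 u' -> Phi u f -> Phi u' f
}.

End NormalizerRelation.

Lemma repr_image_enum (gT : finGroupType) (E : finFieldType) m (Z : {group gT})
    (rZ : mx_representation E Z m) : exists n (zs : 'I_n -> gT), [/\ forall i, zs i \in Z,
  injective (fun i => rZ (zs i)) & forall z, z \in Z -> exists i, rZ z = rZ (zs i)].
Proof.
pose S := [set rZ z | z in Z]; exists #|S|.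
have /fin_all_exists2 [zs zsZ zsE] (i : 'I_#|S|) : exists2 z, z \in Z & rZ z = enum_val i.
  by have /imsetP [z zZ ->] := enum_valP i; exists z.
exists zs; split=> // [i j|z zZ]; first by rewrite !zsE => /enum_val_inj.
have zS : rZ z \in S by apply: imset_f.
by exists (enum_rank_in zS (rZ z)); rewrite zsE enum_rankK_in.
Qed.

Section ElementaryNormRelation.
Variables (p : nat) (gT : finGroupType) (E : finFieldType) (Z : {group gT}).
Hypotheses (pE : p \in [pchar E]) (pZ : (p.-group Z)%g).

Lemma norm_rel_elementary_pos m l (rZ : mx_representation E Z m.+1) (I : finType)
    (X Y : I -> 'M[E]_m.+1) (beta : {linear 'M[E]_m.+1 -> 'M[E]_l.+1}) :
  (forall z, z \in Z -> rZ z ^+ p = 1) -> {in Z &, forall y z, comm_mx (rZ y) (rZ z)} ->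
  dual_bases X Y -> perm_family Z rZ X -> brauer_map p Z rZ X beta ->
  exists Phi, norm_rel Z rZ beta Phi.
Proof.
move=> rZp rZC XY permX betaP.
have [n [zs [zsZ zs_inj zsP]]] := repr_image_enum rZ.
have rZ_elem : elementary_rep p zs rZ by [].
have [P P_coord [v0 [v0_xi v0P]]] := lattice_coord_exists ord0 pE pZ zsZ rZ_elem XY permX betaP.
have beta_surj b : exists2 a, centmx rZ Z a & beta a = b := brauer_map_surj betaP b.
have cent_comm a i : centmx rZ Z a -> comm_mx a (rZ (zs i)).
  by move=> ca; apply/comm_mx_sym/ca.
have [d P_hull] := ker_hull_lattice cent_comm beta_surj P_coord v0_xi v0P.
have [h [L [h_rat frame]]] := ker_hull_frame pE cent_comm beta_surj P_coord v0_xi v0P P_hull.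
exists (hull_rel pE (fun i => rZ (zs i)) P d); split.
- move=> u [uD ub uG _]; apply: (hull_rel_exists P_coord zs_inj h_rat P_hull frame) => // i.
  by have [z zZ e] := uG _ (zsZ i); have [j ez] := zsP z zZ; exists j => v; rewrite e ez.
- by move=> u f f' uf uf'; apply: (hull_rel_unique zs_inj h_rat P_hull frame uf uf').
- by move=> u u' f f'; apply: hull_rel_comp.
- by move=> c cc cu; apply: (hull_rel_cent pE d P_coord) => // i; apply: cent_comm.
by move=> u u' f; apply: hull_rel_eq.
Qed.

Lemma norm_rel_elementary m (rZ : mx_representation E Z m) (I : finType) (X Y : I -> 'M[E]_m) :
  (forall z, z \in Z -> rZ z ^+ p = 1) -> {in Z &, forall y z, comm_mx (rZ y) (rZ z)} ->
  dual_bases X Y -> perm_family Z rZ X ->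
  exists l (beta : {linear 'M[E]_m -> 'M[E]_l}) Phi,
    brauer_map p Z rZ X beta /\ norm_rel Z rZ beta Phi.
Proof.
move=> rZp rZC XY permX; have [l [beta betaP]] := brauer_map_exists pE pZ XY permX.
exists l, beta; case: l beta betaP => [|l] beta betaP.
  exists (fun _ _ => True); split=> //; split=> // [u _|u f f' _ _ w]; first by exists id.
  by rewrite !thinmx0.
case: m rZ X Y beta rZp rZC XY permX betaP => [|m] rZ X Y beta rZp rZC XY permX betaP; last first.
  by have [Phi PhiP] := norm_rel_elementary_pos rZp rZC XY permX betaP; exists Phi.
have := brauer_map1 betaP; rewrite flatmx0 -(flatmx0 0) raddf0.
by move/matrixP/(_ 0 0)/eqP; rewrite !mxE eq_sym oner_eq0.
Qed.

End ElementaryNormRelation.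

Section NormalizingMaps.
Variables (gT : finGroupType) (E : finFieldType) (m : nat) (G : {group gT})
  (rho : gT -> 'M[E]_m).
Implicit Types u : 'rV[E]_m -> 'rV[E]_m.

Lemma intertwine_exp u (a b : 'M[E]_m) j : (forall v, u (v *m a) = u v *m b) ->
  forall v, u (v *m a ^+ j) = u v *m b ^+ j.
Proof.
move=> uab; elim: j => [|j IH] v; first by rewrite !mulmx1.
by rewrite -!mulmx_exprS !mulmxA IH uab.
Qed.

Lemma normalizing_inv u u' : cancel u u' -> cancel u' u ->
  normalizing G rho u -> normalizing G rho u'.
Proof.
move=> uK u'K [uD ub uG uGV]; split.
- by move=> v w; rewrite -{1}[v]u'K -{1}[w]u'K -uD uK.
- by exists u.
- by move=> g gG; have [h hG e] := uGV g gG; exists h => // v; rewrite -{1}[v]u'K -e uK.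
by move=> g gG; have [h hG e] := uG g gG; exists h => // v; rewrite -{1}[v]u'K -e uK.
Qed.

End NormalizingMaps.

Section CentralExponent.
Variables (p : nat) (gT : finGroupType) (E : finFieldType) (m : nat) (G : {group gT})
  (rG : mx_representation E G m).

Definition central_exp_set :=
  [set z in G | (rG z ^+ p == 1) && [forall g in G, comm_mxb (rG g) (rG z)]].

Lemma central_expP z : reflect
  [/\ z \in G, rG z ^+ p = 1 & forall g, g \in G -> comm_mx (rG g) (rG z)]
  (z \in central_exp_set).
Proof.
rewrite inE; apply: (iffP and3P) => [[zG /eqP zp /forall_inP zC]|[zG zp zC]]; split=> //.
- by move=> g gG; apply/comm_mxP/zC.
- exact/eqP.
by apply/forall_inP => g gG; apply/comm_mxP/zC.
Qed.

Lemma central_exp_group_set : group_set central_exp_set.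
Proof.
apply/group_setP; split=> [|x y /central_expP [xG xp xC] /central_expP [yG yp yC]].
  by apply/central_expP; rewrite repr_mx1; split=> // [|g gG]; [apply: expr1n | apply: comm_mx1].
apply/central_expP; rewrite repr_mxM //; split=> [||g gG]; first exact: groupM.
  by rewrite mulmxE exprMn_comm ?xp ?yp ?mulr1 //; apply: yC.
by apply: comm_mxM; [apply: xC | apply: yC].
Qed.

Canonical central_exp := Group central_exp_group_set.

Lemma central_exp_sub : central_exp \subset G.
Proof. by apply/subsetP => z /central_expP []. Qed.

Lemma centmx_central_exp g : g \in G -> centmx rG central_exp (rG g).
Proof. by move=> gG z /central_expP [_ _ zC]; apply/comm_mx_sym/zC. Qed.

Lemma normalizing_central_exp_conj u z : normalizing G rG u -> z \in central_exp ->
  exists2 h, h \in central_exp & forall v, u (v *m rG z) = u v *m rG h.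
Proof.
case=> _ [u' _ u'K] uG uGV /central_expP [zG zp zC].
have [h hG uzh] := uG z zG; exists h => //; apply/central_expP; split=> // [|g gG].
  by apply/eqP/mulmxP => w; rewrite -[w]u'K -(intertwine_exp _ uzh) zp !mulmx1.
have [g' g'G ug'] := uGV g gG; apply/eqP/mulmxP => w.
by rewrite -[w]u'K !mulmxA -ug' -!uzh -ug' -!mulmxA zC.
Qed.

Lemma normalizing_central_exp u : normalizing G rG u -> normalizing central_exp rG u.
Proof.
move=> uG; have [uD [u' uK u'K] _ _] := uG; split=> // [|z zC|h hC]; first by exists u'.
  exact: normalizing_central_exp_conj.
have [g gC e] := normalizing_central_exp_conj (normalizing_inv uK u'K uG) hC.
by exists g => // v; rewrite -[LHS]u'K -{1}[v]uK -e u'K.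
Qed.

End CentralExponent.

Section NormRelation.
Variables (gT : finGroupType) (E : finFieldType) (m l : nat) (G : {group gT})
  (rho : gT -> 'M[E]_m) (beta : 'M[E]_m -> 'M[E]_l)
  (Phi : ('rV[E]_m -> 'rV[E]_m) -> ('rV[E]_l -> 'rV[E]_l) -> Prop).
Hypotheses (beta1 : beta 1%:M = 1%:M) (PhiP : norm_rel G rho beta Phi).

Lemma norm_rel_cancel u u' f f' : cancel u u' -> Phi u f -> Phi u' f' -> cancel f f'.
Proof.
move=> uK Puf Pu'f' w; have id_rel := norm_rel_cent PhiP (@centmx1 _ _ _ rho G) (unitmx1 _ _).
have e : u' \o u =1 mulmxr 1%:M by move=> v; rewrite /= uK mulmx1.
have comp_rel := norm_rel_eq PhiP e (norm_rel_comp PhiP Pu'f' Puf).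
by have := norm_rel_unique PhiP comp_rel id_rel w; rewrite /= beta1 mulmx1.
Qed.

Lemma norm_rel_intertwine u f a b : centmx rho G a -> a \in unitmx ->
  centmx rho G b -> b \in unitmx -> Phi u f ->
  (forall v, u (v *m a) = u v *m b) -> forall w, f (w *m beta a) = f w *m beta b.
Proof.
move=> ca ua cb ub Puf uab w; have e : u \o mulmxr a =1 mulmxr b \o u by [].
have rel_a := norm_rel_comp PhiP Puf (norm_rel_cent PhiP ca ua).
have rel_b := norm_rel_comp PhiP (norm_rel_cent PhiP cb ub) Puf.
exact: (norm_rel_unique PhiP (norm_rel_eq PhiP e rel_a) rel_b w).
Qed.

End NormRelation.

Section NormComposition.
Variables (p : nat) (gT : finGroupType) (E : finFieldType) (m : nat) (G : {group gT})
  (rG : mx_representation E G m) (I : finType) (X : I -> 'M[E]_m)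
  (l l2 : nat) (beta : {linear 'M[E]_m -> 'M[E]_l}) (beta2 : {linear 'M[E]_l -> 'M[E]_l2})
  (Phi : ('rV[E]_m -> 'rV[E]_m) -> ('rV[E]_l -> 'rV[E]_l) -> Prop)
  (Phi2 : ('rV[E]_l -> 'rV[E]_l) -> ('rV[E]_l2 -> 'rV[E]_l2) -> Prop).
Local Notation Z := (central_exp p rG).
Local Notation sZG := (central_exp_sub p rG).
Local Notation centZ := (@centmx_central_exp p _ _ _ _ rG).
Hypotheses (betaP : brauer_map p Z rG X beta) (PhiP : norm_rel Z rG beta Phi).
Local Notation rB := (brauer_repr centZ betaP).
Hypothesis (Phi2P : norm_rel G rB beta2 Phi2).

Lemma norm_rel_normalizing u f : normalizing G rG u -> Phi u f ->
  {morph f : v w / v + w} -> normalizing G rB f.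
Proof.
move=> uG Puf fD; have [_ [u' uK u'K] uGC uGV] := uG.
have u'Z := normalizing_central_exp p (normalizing_inv uK u'K uG).
have [f' [Puf' _]] := norm_rel_total PhiP u'Z.
have f_conj g h : g \in G -> h \in G -> (forall v, u (v *m rG g) = u v *m rG h) ->
    forall w, f (w *m rB g) = f w *m rB h.
  move=> gG hG; apply: (norm_rel_intertwine PhiP) => //; do ?exact: centZ.
    exact: repr_mx_unit.
  exact: repr_mx_unit.
split=> //.
- have beta1 := brauer_map1 betaP.
  by exists f'; [apply: (norm_rel_cancel beta1 PhiP uK) | apply: (norm_rel_cancel beta1 PhiP u'K)].
- by move=> g gG; have [h hG e] := uGC g gG; exists h => //; apply: f_conj.
by move=> h hG; have [g gG e] := uGV h hG; exists g => //; apply: f_conj.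
Qed.

Definition comp_rel u f := exists2 f1, Phi u f1 & Phi2 f1 f.

Lemma norm_rel_comp_rel : norm_rel G rG (beta2 \o beta) comp_rel.
Proof.
split=> [u uG|u f f' [f1 uf1 f1f] [f1' uf1' f1f']|u u' f f' [f1 uf1 f1f] [f1' uf1' f1f']|c cG cu|].
- have [f1 [uf1 f1D]] := norm_rel_total PhiP (normalizing_central_exp p uG).
  have [f [f1f fD]] := norm_rel_total Phi2P (norm_rel_normalizing uG uf1 f1D).
  by exists f; split=> //; exists f1.
- have f1E : f1 =1 f1' := norm_rel_unique PhiP uf1 uf1'.
  exact: (norm_rel_unique Phi2P (norm_rel_eq Phi2P f1E f1f) f1f').
- by exists (f1 \o f1'); [apply: (norm_rel_comp PhiP) | apply: (norm_rel_comp Phi2P)].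
- have cZ : centmx rG Z c by apply: centmxS cG; apply: sZG.
  have beta_cu : beta c \in unitmx.
    have cVZ := centmx_invmx cu cZ.
    have /mulmx1_unit [] // : beta c *m beta (invmx c) = 1%:M.
    by rewrite -(brauer_mapM betaP) // mulmxV // (brauer_map1 betaP).
  exists (mulmxr (beta c)); first exact: (norm_rel_cent PhiP cZ cu).
  apply: (norm_rel_cent Phi2P _ beta_cu).
  exact: centmx_brauer_repr.
by move=> u u' f e [f1 uf1 f1f]; exists f1; first exact: (norm_rel_eq PhiP e uf1).
Qed.

End NormComposition.

Theorem brauer_norm_exists p (gT : finGroupType) (E : finFieldType) (G : {group gT}) m
    (rG : mx_representation E G m) (I : finType) (X Y : I -> 'M[E]_m) :
  p \in [pchar E] -> (p.-group G)%g -> dual_bases X Y -> perm_family G rG X ->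
  exists l (beta : {linear 'M[E]_m -> 'M[E]_l}) Phi,
    brauer_map p G rG X beta /\ norm_rel G rG beta Phi.
Proof.
move=> pE pG; apply: (central_descent pE pG (P := fun m rG I X =>
  exists l (beta : {linear 'M[E]_m -> 'M[E]_l}) Phi,
    brauer_map p G rG X beta /\ norm_rel G rG beta Phi)) =>
  {}m {}rG {}I {}X {}Y => [XY kG|z XY permX zG zp zC].
  exists m, idfun, (fun u f => u =1 f); split; first exact: brauer_map_trivial XY kG.
  split=> // [u [uD _ _ _]|u f f' e e' w|u u' f f' e e' w|u u' f e e' w].
  - by exists u.
  - by rewrite -e e'.
  - by rewrite /= e' e.
  by rewrite -e e'.
pose Z := central_exp p rG; have sZG : Z \subset G := central_exp_sub p rG.
have [|y x yZ /central_expP [xG _ xC]||l [beta [Phi [betaP PhiP]]]] :=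
  norm_rel_elementary pE (pgroupS sZG pG) (rZ := subg_repr rG sZG) _ _ XY _.
- by move=> y /central_expP [].
- exact/xC/(subsetP sZG).
- by move=> g i /(subsetP sZG); apply: permX.
exists Z, sZG, (@centmx_central_exp p _ _ _ _ rG), l, beta, betaP; split; first exact/central_expP.
case=> l2 [beta2 [Phi2 [beta2P Phi2P]]]; exists l2, (beta2 \o beta), (comp_rel Phi Phi2).
split; first by apply: comp_brauer_map beta2P.
exact: norm_rel_comp_rel Phi2P.
Qed.

(** * Restriction of scalars to the prime field *)

Lemma additive_Fp_mx p a b (f : 'rV['F_p]_a -> 'rV['F_p]_b) : {morph f : v w / v + w} ->
  exists M, forall v, f v = v *m M.
Proof.
move=> fD; have f0 : f 0 = 0 by apply: (addrI (f 0)); rewrite -fD !addr0.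
have fMn n v : f (v *+ n) = f v *+ n by elim: n => // n IH; rewrite !mulrS fD IH.
exists (\matrix_i f 'e_i) => v.
rewrite {1}(row_sum_delta v) (big_morph f fD f0) mulmx_sum_row; apply: eq_bigr => i _.
by rewrite rowK -[v 0 i]natr_Zp !scaler_nat fMn.
Qed.

Lemma unitary_embedding_row p (E : fieldType) q t (iota : 'M[E]_q -> 'M['F_p]_t) :
  unitary_embedding iota -> exists k : 'rV[E]_q -> 'rV['F_p]_t,
    [/\ {morph k : v w / v + w}, injective k & forall v a, k (v *m a) = k v *m iota a].
Proof.
case: q iota => [|q] iota [iotaD iotaM _ iota_inj].
  exists (fun=> 0); split=> [v w|v w _|v a]; first by rewrite addr0.
    by rewrite !thinmx0.
  by rewrite mul0mx.
have iota0 : iota 0 = 0 by apply: (addrI (iota 0)); rewrite -iotaD !addr0.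
have /rowV0Pn [_ /submxP [v0 ->] v0_neq0] : iota (delta_mx 0 0) != 0.
  rewrite -iota0 (inj_eq iota_inj); apply/eqP => /matrixP/(_ 0 0)/eqP.
  by rewrite !mxE oner_eq0.
pose k (v : 'rV[E]_q.+1) := v0 *m iota (delta_mx 0 0 *m v).
have kD : {morph k : v w / v + w} by move=> v w; rewrite /k mulmxDr iotaD mulmxDr.
have k_act v a : k (v *m a) = k v *m iota a by rewrite /k mulmxA iotaM mulmxA.
have k_eq0 v : k v = 0 -> v = 0.
  move=> kv; apply/rowP => t0; rewrite [RHS]mxE; apply/eqP; apply: contraNT v0_neq0 => vt.
  suff -> : v0 *m iota (delta_mx 0 0) = k (v *m ((v 0 t0)^-1 *: delta_mx t0 0)).
    by rewrite k_act kv mul0mx.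
  rewrite -scalemxAr row_mul_delta scalerA mulVf // scale1r /k; congr (_ *m iota _).
  by rewrite mul_delta_mx.
exists k; split=> // v w e; apply/eqP; rewrite -subr_eq0; apply/eqP/k_eq0.
by apply: (addIr (k w)); rewrite -kD subrK e add0r.
Qed.

Section ScalarRestriction.
Variables (p : nat) (E : finFieldType).

(* The module defined by iota is E^q, viewed over the prime field through the additive
   bijection k with inverse k'. *)
Record scalar_restriction q t (iota : 'M[E]_q -> 'M['F_p]_t)
    (k : 'rV[E]_q -> 'rV['F_p]_t) (k' : 'rV['F_p]_t -> 'rV[E]_q) : Prop := ScalarRestriction {
  scalar_restrictionD : {morph k : v w / v + w};
  scalar_restrictionK : cancel k k';
  scalar_restrictionVK : cancel k' k;
  scalar_restriction_act : forall v a, k (v *m a) = k v *m iota a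
}.

(* M_q(E) has a unique simple module E^q, and counting shows that the module defined by
   iota has no room for a second copy. *)
Lemma scalar_restriction_exists (pE : p \in [pchar E]) q s (iota : 'M[E]_q -> 'M['F_p]_(q * s)) :
  s = \dim (fullv : {vspace pPrimeCharType pE}) -> unitary_embedding iota ->
  exists k k', scalar_restriction iota k k'.
Proof.
move=> sE /unitary_embedding_row [k [kD k_inj k_act]].
have [|k' kK k'K] := inj_card_bij k_inj; last by exists k, k'.
have /andP [p_pr _] := pE.
by rewrite !card_mx !mul1n card_Fp // (card_pchar_field pE) -sE -expnM mulnC.
Qed.

End ScalarRestriction.

Section NormalizerTransport.
Variables (p : nat) (gT : finGroupType) (G : {group gT}) (E : finFieldType) (m l M L : nat)
  (rho : gT -> 'M[E]_m) (beta : 'M[E]_m -> 'M[E]_l)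
  (Phi : ('rV[E]_m -> 'rV[E]_m) -> ('rV[E]_l -> 'rV[E]_l) -> Prop)
  (iota : 'M[E]_m -> 'M['F_p]_M) (k : 'rV[E]_m -> 'rV['F_p]_M) (k' : 'rV['F_p]_M -> 'rV[E]_m)
  (iota2 : 'M[E]_l -> 'M['F_p]_L) (k2 : 'rV[E]_l -> 'rV['F_p]_L) (k2' : 'rV['F_p]_L -> 'rV[E]_l).
Hypotheses (beta1 : beta 1%:M = 1%:M) (PhiP : norm_rel G rho beta Phi)
  (iota1 : iota 1%:M = 1%:M) (iota21 : iota2 1%:M = 1%:M)
  (kP : scalar_restriction iota k k') (k2P : scalar_restriction iota2 k2 k2').
Local Notation N := (unit_normalizer [set iota (rho d) | d in G]).

Definition additive_of_mx (u : 'M['F_p]_M) v := k' (k v *m u).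

Lemma additive_of_mx_normalizing u : u \in N -> normalizing G rho (additive_of_mx u).
Proof.
have [kD kK k'K k_act] := kP; rewrite inE => /andP [uu /eqP uN].
have conj_u d e v : invmx u *m iota (rho d) *m u = iota (rho e) ->
    additive_of_mx u (v *m rho d) = additive_of_mx u v *m rho e.
  move=> ue; apply: (can_inj kK); rewrite k_act !k'K k_act -ue.
  by rewrite !mulmxA mulmxK.
split.
- by move=> v w; apply: (can_inj kK); rewrite kD !k'K kD mulmxDl.
- by exists (additive_of_mx (invmx u)) => v; rewrite /additive_of_mx k'K (mulmxK, mulmxKV) ?kK.
- move=> d dG; have : invmx u *m iota (rho d) *m u \in [set iota (rho d) | d in G].
    by rewrite -uN; apply/imset_f/imset_f.
  by case/imsetP => e eG ue; exists e => // v; apply: conj_u.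
move=> e eG; have : iota (rho e) \in [set iota (rho d) | d in G] by apply: imset_f.
by rewrite -{1}uN => /imsetP [_ /imsetP [d dG ->] ue]; exists d => // v; apply: conj_u.
Qed.

Definition norm_mx u A := exists2 f, Phi (additive_of_mx u) f & forall v, k2 (f v) = k2 v *m A.

Lemma norm_mx_total u : normalizing G rho (additive_of_mx u) -> exists A, norm_mx u A.
Proof.
have [k2D k2K k2'K _] := k2P; move=> /(norm_rel_total PhiP) [f [uf fD]].
have [|A AP] := @additive_Fp_mx p _ _ (k2 \o f \o k2').
  by move=> v w; rewrite -{1}[v]k2'K -{1}[w]k2'K -k2D /= k2K fD k2D.
by exists A, f => // v; rewrite -AP /= k2K.
Qed.

Lemma norm_mx_unique u A A' : norm_mx u A -> norm_mx u A' -> A = A'.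
Proof.
case=> f uf fA [f' uf' fA']; apply/eqP/mulmxP => v.
by rewrite -[v](scalar_restrictionVK k2P) -fA -fA' (norm_rel_unique PhiP uf uf').
Qed.

Lemma norm_mxM u v A B : norm_mx u A -> norm_mx v B -> norm_mx (u *m v) (A *m B).
Proof.
case=> f uf fA [g vg gB]; exists (g \o f) => [|w]; last by rewrite /= gB fA mulmxA.
apply: (norm_rel_eq PhiP) (norm_rel_comp PhiP vg uf) => w.
by rewrite /additive_of_mx /= (scalar_restrictionVK kP) mulmxA.
Qed.

Lemma norm_mx_cent c : centmx rho G c -> c \in unitmx -> norm_mx (iota c) (iota2 (beta c)).
Proof.
move=> cc cu; exists (mulmxr (beta c)) => [|v]; last exact: (scalar_restriction_act k2P).
apply: (norm_rel_eq PhiP) (norm_rel_cent PhiP cc cu) => v.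
by rewrite /additive_of_mx -(scalar_restriction_act kP) (scalar_restrictionK kP).
Qed.

Lemma norm_mx_unit u A : u \in N -> norm_mx u A -> A \in unitmx.
Proof.
move=> uN uA; have [_ kK k'K _] := kP; have uu : u \in unitmx by move: uN; rewrite inE => /andP [].
have [|B uB] := @norm_mx_total (invmx u).
  apply: normalizing_inv (additive_of_mx_normalizing uN) => v;
    by rewrite /additive_of_mx k'K (mulmxK, mulmxKV) ?kK.
have := norm_mx_cent (@centmx1 _ _ _ rho G) (unitmx1 _ _).
rewrite beta1 iota1 iota21 -(mulmxV uu) => one_rel.
by have /mulmx1_unit [] := norm_mx_unique (norm_mxM uA uB) one_rel.
Qed.

Theorem norm_rel_hom : exists phi : 'M['F_p]_M -> 'M['F_p]_L,
  [/\ forall u, u \in N -> phi u \in unitmx,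
      forall u v, u \in N -> v \in N -> phi (u *m v) = phi u *m phi v &
      forall c, centmx rho G c -> c \in unitmx -> phi (iota c) = iota2 (beta c)].
Proof.
have /fin_all_exists [phi phiP] u : exists A, (exists A', norm_mx u A') -> norm_mx u A.
  have [[A uA]|nu] := classic (exists A, norm_mx u A); first by exists A.
  by exists 0 => uA; case: nu.
have phiE u A : norm_mx u A -> phi u = A.
  by move=> uA; apply: norm_mx_unique (uA); apply: phiP; exists A.
have phiN u : u \in N -> norm_mx u (phi u).
  by move=> uN; apply/phiP/norm_mx_total/additive_of_mx_normalizing.
exists phi; split=> [u uN|u v uN vN|c cc cu].
- exact: norm_mx_unit uN (phiN u uN).
- by apply/phiE/norm_mxM; apply: phiN.
exact/phiE/norm_mx_cent.
Qed.

End NormalizerTransport.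

(** * The Brauer quotient of a Dade algebra *)

Lemma unit_morph_mx_repr (gT : finGroupType) (D : {group gT}) (R : comUnitRingType) m
    (rho : gT -> 'M[R]_m) :
  (forall d, d \in D -> rho d \in unitmx) ->
  (forall d e, d \in D -> e \in D -> rho (d * e)%g = rho d *m rho e) -> mx_repr D rho.
Proof.
move=> rho_unit rho_morph; split=> //; have u1 := rho_unit _ (group1 D).
have := rho_morph _ _ (group1 D) (group1 D); rewrite mulg1.
by move=> /(congr1 (mulmx (invmx (rho 1%g)))); rewrite mulKmx // mulVmx.
Qed.

Section BrauerQuotient.
Variables (p : nat) (gT : finGroupType) (D : {group gT}) (E : finFieldType) (m : nat)
  (act : gT -> 'M[E]_m -> 'M[E]_m) (rD : mx_representation E D m).
Hypotheses (pD : (p.-group D)%g) (actE : forall d x, d \in D -> act d x = rep_conj rD d x).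

Lemma fixptsP (H : {group gT}) x : H \subset D -> reflect (centmx rD H x) (x \in fixpts act H).
Proof.
move=> sHD; have HD := subsetP sHD; rewrite inE.
apply: (iffP forall_inP) => fix_x h hH; have hD := HD h hH.
  by apply/rep_conj_id; rewrite // -actE //; apply/eqP/fix_x.
by rewrite actE //; apply/eqP/rep_conj_id; last exact: fix_x.
Qed.

Lemma maximal_trace_brauer_ideal b : maximal_trace p D rD b -> b \in brauer_ideal act D.
Proof.
case=> H g a mH gD gH ca; have sHD := proper_sub (maxgroupp mH).
apply: memv_span; rewrite mem_enum; apply/imset2P; exists H a.
- by rewrite inE (maxgroupp mH).
- exact/fixptsP.
rewrite (trace_pow_rcosets pD mH gD gH ca); apply: eq_bigr => C /rcosetsP [x xD ->].
rewrite actE //; apply: (subsetP _ _ (mem_repr_rcoset H x)).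
by rewrite mul_subG // sub1set.
Qed.

Lemma dade_basis : is_Dade act D -> exists (I : finType) (X Y : I -> 'M[E]_m),
  dual_bases X Y /\ perm_family D rD X.
Proof.
case=> _ [X [X_basis XD _]]; exists 'I_(size X), (fun i : 'I_(size X) => X`_i).
have [span_X free_X] := andP X_basis.
have [c h i|b|Y XY] := @dual_bases_exists E m _ (fun i : 'I_(size X) => X`_i).
- by have /(@freeP _ _ _ (in_tuple X))/(_ c h i) := free_X.
- exists (fun i => coord (in_tuple X) i b).
  exact: (@coord_basis _ _ fullv _ (in_tuple X) b X_basis (memvf b)).
exists Y; split=> // g i gD; have := XD g _ gD (mem_nth 0 (ltn_ord i)).
by move/(nthP 0) => [j jX e]; exists (Ordinal jX); rewrite -actE.
Qed.

Variables (I : finType) (X Y : I -> 'M[E]_m) (l : nat) (beta : {linear 'M[E]_m -> 'M[E]_l})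
  (B : falgType E) (br : 'M[E]_m -> B).
Hypotheses (XY : dual_bases X Y) (permX : perm_family D rD X)
  (betaP : brauer_map p D rD X beta) (brP : is_brauer_quotient act D br).
Local Notation cent := (centmx rD D).

Let fixC x : reflect (cent x) (x \in fixpts act D).
Proof. exact: fixptsP. Qed.

Lemma br_linear a x y : cent x -> cent y -> br (a *: x + y) = a *: br x + br y.
Proof. by case: brP => br_lin _ _ _ _ /fixC cx /fixC cy; apply: br_lin. Qed.

Lemma brM x y : cent x -> cent y -> br (x *m y) = br x * br y.
Proof. by case: brP => _ br_mul _ _ _ /fixC cx /fixC cy; apply: br_mul. Qed.

Lemma br0 : br 0 = 0.
Proof.
have := br_linear 1 (@centmx0 _ _ _ rD D) (@centmx0 _ _ _ rD D).
by rewrite !scale1r addr0 => h; apply: (addrI (br 0)); rewrite -h addr0.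
Qed.

Lemma br_sum (J : Type) (s : seq J) (F : J -> 'M[E]_m) : (forall j, cent (F j)) ->
  br (\sum_(j <- s) F j) = \sum_(j <- s) br (F j).
Proof.
move=> cF; elim: s => [|j s IH]; first by rewrite !big_nil br0.
rewrite !big_cons -IH -[F j in LHS]scale1r br_linear ?scale1r //.
by apply: centmx_sum.
Qed.

Lemma br_ker x : cent x -> beta x = 0 -> br x = 0.
Proof.
move=> cx bx; case: (brP) => _ _ _ _ kerP; apply/eqP; rewrite kerP; last exact/fixC.
have [T TP ->] := brauer_map_ker pD XY permX betaP cx bx.
by rewrite big_seq; apply: rpred_sum => b /TP; apply: maximal_trace_brauer_ideal.
Qed.

Lemma br_eq x y : cent x -> cent y -> beta x = beta y -> br x = br y.
Proof.
move=> cx cy e; have cxy : cent (-1 *: y + x) by apply: centmxD => //; apply: centmxZ.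
have := br_ker cxy; rewrite linearP /= e scaleN1r addNr br_linear // scaleN1r addrC.
by move=> /(_ erefl)/eqP; rewrite subr_eq0 => /eqP.
Qed.

(* A nonzero element of the matrix algebra 'M[E]_l generates it as a two-sided ideal. *)
Lemma br_inj x : cent x -> br x = 0 -> beta x = 0.
Proof.
move=> cx bx; apply/matrixP => i j; rewrite [RHS]mxE; apply/eqP; apply: contraT => bij.
have /fin_all_exists2 [e eC eE] (t : 'I_l * 'I_l) := brauer_map_surj betaP (delta_mx t.1 t.2).
pose F t := e (t, i) *m x *m e (j, t); have cF t : cent (F t) by do 2!apply: centmxM => //.
have sumF : beta (\sum_t F t) = beta (beta x i j *: 1%:M).
  rewrite linearZ /= (brauer_map1 betaP) linear_sum mx1_sum_delta scaler_sumr.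
  apply: eq_bigr => t _ /=; rewrite !(brauer_mapM betaP) ?eE //=; last exact: centmxM.
  rewrite -(mul_delta_mx (0 : 'I_1) t i) -!mulmxA (mulmxA 'e_i) -rowE row_mul_delta mxE.
  by rewrite -scalemxAr mul_delta_mx.
have := br_eq (centmx_sum _ (fun t _ => cF t)) (centmxZ _ (@centmx1 _ _ _ rD D)) sumF.
rewrite br_sum // big1 => [|t _]; last by rewrite !brM ?bx ?mulr0 ?mul0r //; apply: centmxM.
rewrite -[_ *: 1%:M]addr0 br_linear ?br0 ?addr0; [|exact: centmx1|exact: centmx0].
by case: (brP) => _ _ -> _ _ /esym/eqP; rewrite scaler_eq0 oner_eq0 orbF (negPf bij).
Qed.

Lemma brauer_quotient_iso : exists j : {linear 'M[E]_l -> B},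
  [/\ {morph j : x y / x *m y >-> x * y}, j 1%:M = 1, bijective j &
      forall x, cent x -> j (beta x) = br x].
Proof.
have /fin_all_exists2 [sec secC secK] (b : 'M[E]_l) := brauer_map_surj betaP b.
have brE x : cent x -> br (sec (beta x)) = br x by move=> cx; apply: br_eq.
have j_linear : linear (br \o sec).
  move=> a x y; rewrite /= -[x in LHS]secK -[y in LHS]secK -linearP brE ?br_linear //.
  by apply: centmxD => //; apply: centmxZ.
pose j : {linear 'M[E]_l -> B} :=
  HB.pack (br \o sec) (GRing.isLinear.Build _ _ _ _ (br \o sec) j_linear).
have j_inj : injective j.
  move=> x y /eqP; rewrite -subr_eq0 -linearB /= => /eqP e; apply/eqP.
  by rewrite -subr_eq0 -[x - y]secK; apply/eqP/br_inj.
case: (brP) => _ _ br1 br_surj _; exists j; split=> //= [x y||].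
- rewrite /= -[x in LHS]secK -[y in LHS]secK -(brauer_mapM betaP) // brE ?brM //.
  exact: centmxM.
- by rewrite -(brauer_map1 betaP) brE //; apply: centmx1.
have j_surj b : exists x, j x == b.
  by have [x /fixC cx <-] := br_surj b; exists (beta x); apply/eqP/brE.
have j'K b : j (xchoose (j_surj b)) = b by apply/eqP/(xchooseP (j_surj b)).
by exists (fun b => xchoose (j_surj b)) => // x; apply: j_inj.
Qed.

Lemma brauer_quotient_dim : \dim (fullv : {vspace B}) = (l * l)%N.
Proof.
have [j [_ _ [j' jK j'K] _]] := brauer_quotient_iso.
have j_ker : lker (linfun j) = 0%VS by apply/eqP/lker0P => x y; rewrite !lfunE => /(can_inj jK).
have <- : (linfun j @: fullv)%VS = fullv.
  apply/vspaceP => b; rewrite memvf; apply/memv_imgP; exists (j' b); first exact: memvf.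
  by rewrite lfunE /= j'K.
by rewrite limg_dim_eq ?j_ker ?capv0 // dimvf dim_matrix.
Qed.

End BrauerQuotient.

Theorem mainTheorem14
  (p : nat) (gT : finGroupType) (D : {group gT}) (pD : (p.-group D)%g)
  (E : finFieldType) (pcharEp : p \in [pchar E])
  (m : nat) (act : gT -> 'M[E]_m -> 'M[E]_m) (Dade : is_Dade act D)
  (rho : gT -> 'M[E]_m)
  (rho_unit : forall d, d \in D -> rho d \in unitmx)
  (rho_morph : forall d e, d \in D -> e \in D -> rho (d * e)%g = rho d *m rho e)
  (rho_act : forall d x, d \in D -> act d x = invmx (rho d) *m x *m rho d)
  (B : falgType E) (br : 'M[E]_m -> B) (brP : is_brauer_quotient act D br)
  (l : nat) (dimB : \dim (fullv : {vspace B}) = (l * l)%N)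
  (s : nat) (degE : s = \dim (fullv : {vspace pPrimeCharType pcharEp}))
  (iota : 'M[E]_m -> 'M['F_p]_(m * s)) (iotaP : unitary_embedding iota)
  (iota' : B -> 'M['F_p]_(l * s)) (iota'P : unitary_embedding iota') :
  exists phi : 'M['F_p]_(m * s) -> 'M['F_p]_(l * s),
    let N := unit_normalizer [set iota (rho d) | d in D] in
    [/\ (forall u, u \in N -> phi u \in unitmx),
        (forall u v, u \in N -> v \in N -> phi (u *m v) = phi u *m phi v) &
        (forall c, c \in fixpts act D -> c \in unitmx -> invmx c \in fixpts act D ->
           phi (iota c) = iota' (br c))].
Proof.
pose rD := MxRepresentation (unit_morph_mx_repr rho_unit rho_morph).
have actE d x : d \in D -> act d x = rep_conj rD d x.
  by move=> dD; rewrite rho_act // /rep_conj (repr_mxV rD).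
have [I [X [Y [XY permX]]]] := dade_basis actE Dade.
have [l' [beta [Phi [betaP PhiP]]]] := brauer_norm_exists pcharEp pD XY permX.
have dimB' := brauer_quotient_dim pD actE XY permX betaP brP.
have el : l' = l by apply/eqP; rewrite -eqn_sqr -!mulnn -dimB' dimB.
subst l'.
have [j [jM j1 jb jE]] := brauer_quotient_iso pD actE XY permX betaP brP.
have iota'jP : unitary_embedding (iota' \o j).
  case: iota'P => iD iM i1 i_inj; split=> [x y|x y||] /=; last exact: inj_comp i_inj (bij_inj jb).
  - by rewrite raddfD iD.
  - by rewrite jM iM.
  by rewrite j1 i1.
have [k [k' kP]] := scalar_restriction_exists degE iotaP.
have [k2 [k2' k2P]] := scalar_restriction_exists degE iota'jP.
have [[_ _ iota1 _] [_ _ iota'j1 _]] := (iotaP, iota'jP).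
have [phi [phi_unit phiM phi_cent]] := norm_rel_hom (brauer_map1 betaP) PhiP iota1 iota'j1 kP k2P.
exists phi; split=> // c /(fixptsP actE _ (subxx _)) cc cu _.
by rewrite phi_cent //= jE.
Qed.
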